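(* Let $\mathcal R$ belong to the inverse Stieltjes class $\widetilde{\mathcal S}^{(-1)}(\mathfrak M)$ in the Hilbert space $\mathfrak M$. Then there exists, up to unitary equivalence, a unique nonnegative selfadjoint relation $\widetilde A$ in a Hilbert space $\mathfrak M\oplus\mathfrak K$ such that $\widetilde A$ is $\mathfrak M$-minimal and the relation $$P_{\mathfrak M}\big(\widetilde A-\lambda I\big)^{-1}\!\upharpoonright\mathfrak M=-\big(\mathcal R(\lambda)+\lambda I_{\mathfrak M}\big)^{-1},\qquad \lambda\in\mathbb C\setminus\mathbb R_+,$$ holds.
   Context: All Hilbert spaces are complex and separable; $\mathbb R_+=[0,+\infty)$, $\mathbb C_\pm$ are the open upper/lower half-planes. $\mathbf B(\mathfrak M)$ is the algebra of bounded everywhere defined operators on $\mathfrak M$; $P_{\mathfrak M}$ is the orthogonal projection onto $\mathfrak M$. A linear relation in a Hilbert space is a linear subspace $H$ of its cartesian square, with elements $\{f,f'\}$; operators are identified with graphs. $H^{-1}=\{\{f',f\}:\{f,f'\}\in H\}$, $H+cI=\{\{f,f'+cf\}\}$. Adjoint: $H^*=\{\{k,k'\}:(h',k)=(h,k')\ \forall\{h,h'\}\in H\}$; $H$ is selfadjoint if $H=H^*$; $H\ge0$ (nonnegative) if $(f',f)\ge0$ for all $\{f,f'\}\in H$; $H\le0$ if $-H\ge0$. $H$ is dissipative (accumulative) if $\operatorname{Im}(f',f)\ge0$ ($\le0$) on $H$; maximal means having no proper extension with the same property. A family of linear relations $\mathcal M(\lambda)$, $\lambda\in\mathbb C\setminus\mathbb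 R$, in $\mathfrak M$ is a Nevanlinna family if: (i) $\mathcal M(\lambda)$ is maximal dissipative for $\lambda\in\mathbb C_+$ (resp. maximal accumulative for $\lambda\in\mathbb C_-$); (ii) $\mathcal M(\lambda)^*=\mathcal M(\bar\lambda)$; (iii) for some (hence all) $\mu\in\mathbb C_+$ ($\mathbb C_-$) the family $(\mathcal M(\lambda)+\mu)^{-1}\in\mathbf B(\mathfrak M)$ is holomorphic for $\lambda\in\mathbb C_+$ ($\mathbb C_-$). A family $\mathcal M(\lambda)$, $\lambda\in\mathbb C\setminus\mathbb R_+$, is an inverse Stieltjes family (class $\widetilde{\mathcal S}^{(-1)}(\mathfrak M)$) if it is a Nevanlinna family and, moreover, (i) $\mathcal M(x)\le0$ for all $x<0$, (ii) for some (hence all) $\mu\in\mathbb C_+$ ($\mathbb C_-$) the operator family $(\mathcal M(\lambda)+\mu)^{-1}\in\mathbf B(\mathfrak M)$, $\lambda\in\mathbb C_+$ ($\mathbb C_-$), admits an analytic continuation to $(-\infty,0)$. A selfadjoint relation $\widetilde A$ in $\mathfrak H=\mathfrak M\oplus\mathfrak K$ is $\mathfrak M$-minimal if $\mathfrak H=\overline{\operatorname{span}}\{\mathfrak M+(\widetilde A-\lambda I)^{-1}\mathfrak M:\lambda\in\mathbb C\setminus\mathbb R\}$. Two relations $\widetilde A^{(j)}$ in $\mathfrak M\oplus\mathfrak K^{(j)}$, $j=1,2$, are unitarily equivalent if there is a unitary operator $\mathcal V$ from $\mathfrak K^{(1)}$ onto $\mathfrak K^{(2)}$ such that $\widetilde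 A^{(2)}=\{\{(\varphi,\mathcal Vf),(\varphi',\mathcal Vf')\}:\{(\varphi,f),(\varphi',f')\}\in\widetilde A^{(1)}\}$ with $\varphi,\varphi'\in\mathfrak M$, $f,f'\in\mathfrak K^{(1)}$. *)

(* Defs.v *)
From HB Require Import structures.
From mathcomp Require Import all_boot all_order all_algebra.
From mathcomp Require Import complex ring.
From mathcomp Require Import boolp classical_sets functions cardinality.
From mathcomp Require Import reals topology normedtype.

Set Implicit Arguments.
Unset Strict Implicit.
Unset Printing Implicit Defensive.

Import Order.TTheory GRing.Theory Num.Theory.
Import numFieldNormedType.Exports.

Local Open Scope classical_set_scope.
Local Open Scope ring_scope.

(* [inner] is linear in its first and antilinear in its second argument. *)
HB.mixin Record isHilbert (R : realType) H & CompleteNormedModule R[i] H := {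
  inner : {dot H for Num.conj} ;
  sqr_norm_inner : forall x : H, `|x| ^+ 2 = inner x x ;
  separable : exists2 D : set H, countable D & dense D
}.

#[short(type="hilbertType")]
HB.structure Definition Hilbert (R : realType) :=
  {H of CompleteNormedModule R[i] H & isHilbert R H}.

(* The orthogonal sum. This is an alias of the product type because the
   product already carries the maximum norm, which is not Hilbertian. *)
Definition hsum (R : realType) (H K : hilbertType R) : Type := (H * K)%type.

Section OrthogonalSum.
Context (R : realType) (H K : hilbertType R).
Local Notation HK := (hsum H K).

HB.instance Definition _ := GRing.Lmodule.copy HK (H * K)%type.

Definition hsum_inner (x y : HK) : R[i] := inner x.1 y.1 + inner x.2 y.2.

Definition hsum_norm (x : HK) : R[i] := sqrtC (`|x.1| ^+ 2 + `|x.2| ^+ 2).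

Let sqn_ge0 (x : HK) : 0 <= `|x.1| ^+ 2 + `|x.2| ^+ 2.
Proof. by rewrite addr_ge0 ?exprn_ge0. Qed.

Let hsum_norm_ge0 x : 0 <= hsum_norm x.
Proof. by rewrite sqrtC_ge0. Qed.

Let hsum_normK x : hsum_norm x ^+ 2 = `|x.1| ^+ 2 + `|x.2| ^+ 2.
Proof. by rewrite sqrtCK. Qed.

Let hsum_normZ (l : R[i]) x : hsum_norm (l *: x) = `|l| * hsum_norm x.
Proof.
apply/eqP; rewrite -(@eqrXn2 _ 2) ?mulr_ge0// exprMn !hsum_normK.
by rewrite !normrZ !exprMn mulrDr.
Qed.

Let hsum_norm_eq0 x : hsum_norm x = 0 -> x = 0.
Proof.
move=> /(congr1 (fun z => z ^+ 2)); rewrite hsum_normK expr0n/= => /eqP.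
rewrite paddr_eq0 ?exprn_ge0// !expf_eq0/= !normr_eq0 => /andP[/eqP a /eqP b].
by apply/eqP; rewrite -pair_eqE /pair_eq/= a b !eqxx.
Qed.

Let hsum_normD x y : hsum_norm (x + y) <= hsum_norm x + hsum_norm y.
Proof.
have cs : `|x.1| * `|y.1| + `|x.2| * `|y.2| <= hsum_norm x * hsum_norm y.
  rewrite -(@ler_pXn2r _ 2) ?nnegrE ?addr_ge0 ?mulr_ge0//.
  rewrite exprMn !hsum_normK -subr_ge0.
  set a := `|x.1|; set b := `|x.2|; set c := `|y.1|; set d := `|y.2|.
  have -> : (a ^+ 2 + b ^+ 2) * (c ^+ 2 + d ^+ 2) - (a * c + b * d) ^+ 2 =
            (a * d - b * c) ^+ 2.
    by ring.
  by rewrite real_exprn_even_ge0// rpredB// rpredM// normr_real.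
rewrite -(@ler_pXn2r _ 2) ?nnegrE ?addr_ge0// sqrrD !hsum_normK.
apply: (@le_trans _ _ ((`|x.1| + `|y.1|) ^+ 2 + (`|x.2| + `|y.2|) ^+ 2)).
  by rewrite lerD// lerXn2r ?nnegrE ?addr_ge0// ler_normD.
set n := hsum_norm x * hsum_norm y in cs *.
rewrite -subr_ge0 !sqrrD; move: cs; rewrite -subr_ge0.
set a := `|x.1|; set b := `|x.2|; set c := `|y.1|; set d := `|y.2| => cs.
by have := mulrn_wge0 2 cs; congr (0 <= _); ring.
Qed.

HB.instance Definition _ :=
  Lmodule_isNormed.Build R[i] HK hsum_normD hsum_normZ hsum_norm_eq0.

Let norm_hsum (x : HK) : `|x| = hsum_norm x. Proof. by []. Qed.

Let norm_fst (x : HK) : `|x.1| <= `|x|.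
Proof.
rewrite -(@ler_pXn2r _ 2) ?nnegrE// norm_hsum hsum_normK.
by rewrite lerDl exprn_ge0.
Qed.

Let norm_snd (x : HK) : `|x.2| <= `|x|.
Proof.
rewrite -(@ler_pXn2r _ 2) ?nnegrE// norm_hsum hsum_normK.
by rewrite lerDr exprn_ge0.
Qed.

Let norm_le (x : HK) : `|x| <= `|x.1| + `|x.2|.
Proof.
rewrite -(@ler_pXn2r _ 2) ?nnegrE ?addr_ge0// norm_hsum hsum_normK.
by rewrite sqrrD addrAC lerDl mulrn_wge0// mulr_ge0.
Qed.

Let hsum_complete (F : set_system HK) : ProperFilter F -> cauchy F -> cvg F.
Proof.
move=> FF /cauchyP Fex.
have c1 : cvg (@fst H K @ F).
  apply/cauchy_cvgP/cauchyP => e e0; have [x Fx] := Fex e e0.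
  exists x.1; apply: (@filterS _ F _ _ _ _ Fx) => y; rewrite -!ball_normE/=.
  by apply: le_lt_trans; exact: (norm_fst (x - y)).
have c2 : cvg (@snd H K @ F).
  apply/cauchy_cvgP/cauchyP => e e0; have [x Fx] := Fex e e0.
  exists x.2; apply: (@filterS _ F _ _ _ _ Fx) => y; rewrite -!ball_normE/=.
  by apply: le_lt_trans; exact: (norm_snd (x - y)).
move/cvg_ex : c1 => [a /cvgrPdist_lt Fa]; move/cvg_ex : c2 => [b /cvgrPdist_lt Fb].
apply/cvg_ex; exists ((a, b) : HK); apply/cvgrPdist_lt => e e0.
have e20 : 0 < e / 2 by rewrite divr_gt0.
apply: (@filterS _ F _ _ _ _ (filterI (Fa _ e20) (Fb _ e20))) => y [/= ya yb].
apply: (le_lt_trans (norm_le _)) => /=.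
by rewrite (splitr e) ltrD.
Qed.

HB.instance Definition _ := Uniform_isComplete.Build HK hsum_complete.

Let hsum_inner_linearl (y : HK) : linear_for *%R (hsum_inner ^~ y).
Proof.
by move=> a u v; rewrite /hsum_inner/= !linearDl/= !linearZl_LR/= mulrDr addrACA.
Qed.

Let hsum_inner_linearr (x : HK) :
  linear_for (Num.conj \; *%R) (hsum_inner x).
Proof.
by move=> a u v; rewrite /hsum_inner/= !linearDr/= !linearZr_LR/= mulrDr addrACA.
Qed.

HB.instance Definition _ := bilinear_isBilinear.Build R[i] HK HK R[i] *%R
  (Num.conj \; *%R) hsum_inner (hsum_inner_linearl, hsum_inner_linearr).

Let hsum_inner_herm (x y : HK) :
  hsum_inner x y = (-1) ^+ false * Num.conj (hsum_inner y x).
Proof.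
rewrite /hsum_inner rmorphD/= (hermC inner x.1) (hermC inner x.2)/=.
by rewrite expr0 !mul1r.
Qed.

HB.instance Definition _ := isHermitianSesquilinear.Build R[i] HK false Num.conj
  hsum_inner hsum_inner_herm.

Let sqr_norm_hsum (x : HK) : `|x| ^+ 2 = hsum_inner x x.
Proof. by rewrite norm_hsum hsum_normK !sqr_norm_inner. Qed.

Let hsum_inner_gt0 (x : HK) : x != 0 -> 0 < hsum_inner x x.
Proof. by move=> x0; rewrite -sqr_norm_hsum exprn_gt0// normr_gt0. Qed.

HB.instance Definition _ := isDotProduct.Build R[i] HK hsum_inner hsum_inner_gt0.

Let hsum_separable : exists2 D : set HK, countable D & dense D.
Proof.
have [D cD dD] := @separable R H; have [E cE dE] := @separable R K.
exists (D `*` E : set HK); first exact: countableX.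
move=> O [x Ox]; rewrite openE => /(_ _ Ox).
rewrite /interior -nbhs_ballE => -[e /= e0 eO].
have e20 : 0 < e / 2 by rewrite divr_gt0.
have [d [] xd Dd] : ball x.1 (e / 2) `&` D !=set0.
  by apply: dD; [exists x.1; exact: ballxx|exact: ball_open].
have [k [] xk Ek] : ball x.2 (e / 2) `&` E !=set0.
  by apply: dE; [exists x.2; exact: ballxx|exact: ball_open].
exists ((d, k) : HK); split=> //; apply: eO.
rewrite -!ball_normE/= in xd xk *; apply: (le_lt_trans (norm_le _)) => /=.
by rewrite (splitr e) ltrD.
Qed.

HB.instance Definition _ :=
  isHilbert.Build R HK sqr_norm_hsum hsum_separable.

End OrthogonalSum.

Section Relations.
Context (R : realType) (H : hilbertType R).
Implicit Types T : set (H * H).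

Definition linear_relation T :=
  T 0 /\ forall (a : R[i]) p q, T p -> T q -> T (a *: p + q).

Definition graph (F : H -> H) : set (H * H) := [set p | p.2 = F p.1].

Definition rel_inv T : set (H * H) := [set p | T (p.2, p.1)].

Definition rel_opp T : set (H * H) := [set (p.1, - p.2) | p in T].

Definition rel_shift T (c : R[i]) : set (H * H) :=
  [set (p.1, p.2 + c *: p.1) | p in T].

Definition adjoint T : set (H * H) :=
  [set k | forall h, T h -> inner h.2 k.1 = inner h.1 k.2].

Definition selfadjoint T := T = adjoint T.

(* On [R[i]], [0 <= z] means that [z] is real and nonnegative, and [x < 0]
   that [x] is real and negative. *)
Definition nonnegative T := forall p, T p -> 0 <= inner p.2 p.1.

Definition nonpositive T := nonnegative (rel_opp T).

Definition dissipative T := forall p, T p -> 0 <= 'Im (inner p.2 p.1).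

Definition accumulative T := forall p, T p -> 'Im (inner p.2 p.1) <= 0.

Definition maximal (P : set (H * H) -> Prop) T :=
  [/\ linear_relation T, P T &
    forall T', linear_relation T' -> P T' -> T `<=` T' -> T' = T].

Definition bounded_operator (F : H -> H) :=
  linear F /\ exists c : R[i], forall x, `|F x| <= c * `|x|.

(* Holomorphy in the operator norm; [D] is the derivative at [l]. *)
Definition holomorphic_on (U : set R[i]^o) (F : R[i] -> H -> H) :=
  open U /\ forall l, U l ->
    bounded_operator (F l) /\
    exists2 D : H -> H, bounded_operator D &
      forall e : R[i], 0 < e -> \forall m \near (l : R[i]^o),
        forall x, `|F m x - F l x - (m - l) *: D x| <= e * `|m - l| * `|x|.

End Relations.

Definition upper_half_plane (R : realType) : set R[i] := [set z | 0 < 'Im z].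
Definition lower_half_plane (R : realType) : set R[i] := [set z | 'Im z < 0].
Definition negative_axis (R : realType) : set R[i] := [set z | z < 0].

Arguments upper_half_plane {R}.
Arguments lower_half_plane {R}.
Arguments negative_axis {R}.

Section Families.
Context (R : realType) (M : hilbertType R).
Implicit Type N : R[i] -> set (M * M).

(* The values of the family on the real axis are irrelevant here. *)
Definition nevanlinna_family N :=
  [/\ forall l, upper_half_plane l -> maximal (@dissipative R M) (N l),
      forall l, lower_half_plane l -> maximal (@accumulative R M) (N l),
      forall l : R[i], l \isn't Num.real -> adjoint (N l) = N (Num.conj l) &
      forall C : set R[i], C = upper_half_plane \/ C = lower_half_plane ->
        exists2 m, C m &
          exists2 F, holomorphic_on C F &
            forall l, C l -> rel_inv (rel_shift (N l) m) = graph (F l)].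

(* The values of the family on the half-line [0, +oo) are irrelevant here.
   Since [N x] belongs to the family for x < 0, the analytic continuation of
   (N l + m)^-1 is required to take the value (N x + m)^-1 at x. *)
Definition inverse_stieltjes_family N :=
  [/\ forall l : R[i], ~~ (0 <= l) -> linear_relation (N l),
      nevanlinna_family N,
      forall x, negative_axis x -> nonpositive (N x) &
      forall C : set R[i], C = upper_half_plane \/ C = lower_half_plane ->
        exists2 m, C m &
          exists U F, [/\ C `|` negative_axis `<=` U, holomorphic_on U F &
            forall l, (C `|` negative_axis) l ->
              rel_inv (rel_shift (N l) m) = graph (F l)]].

End Families.

Section Dilations.
Context (R : realType) (M K : hilbertType R).
Implicit Type A : set (hsum M K * hsum M K).

Definition hsum_inl (f : M) : hsum M K := (f, 0).

Definition resolvent A (l : R[i]) := rel_inv (rel_shift A (- l)).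

Definition compressed_resolvent A (l : R[i]) : set (M * M) :=
  [set p | exists k : K, resolvent A l (hsum_inl p.1, (p.2, k))].

Definition linear_span (S : set (hsum M K)) : set (hsum M K) :=
  [set x | exists n (a : 'I_n -> R[i]) (v : 'I_n -> hsum M K),
    (forall i, S (v i)) /\ x = \sum_i a i *: v i].

Definition minimal A :=
  closure (linear_span
    [set x | exists (l : R[i]) (f g : M) (h : hsum M K),
      [/\ l \isn't Num.real, resolvent A l (hsum_inl g, h)
        & x = hsum_inl f + h]]) = setT.

End Dilations.

Definition unitarily_equivalent (R : realType) (M K1 K2 : hilbertType R)
    (A1 : set (hsum M K1 * hsum M K1)) (A2 : set (hsum M K2 * hsum M K2)) :=
  exists V : {linear K1 -> K2},
    [/\ isometry inner inner V, set_surj setT setT V &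
      A2 = [set ((p.1.1, V p.1.2), (p.2.1, V p.2.2)) | p in A1]].

Definition is_minimal_model (R : realType) (M K : hilbertType R)
    (N : R[i] -> set (M * M)) (A : set (hsum M K * hsum M K)) :=
  [/\ linear_relation A, selfadjoint A, nonnegative A, minimal A &
    forall l : R[i], ~~ (0 <= l) ->
      compressed_resolvent A l = rel_opp (rel_inv (rel_shift (N l) l))].

(* Main.v *)
Require Import Defs.
From HB Require Import structures.
From mathcomp Require Import all_boot all_order all_algebra complex ring lra.
From mathcomp Require Import boolp classical_sets functions cardinality.
From mathcomp Require Import reals topology normedtype sequences derive realfun.
From mathcomp Require Import measure lebesgue_measure lebesgue_integral ftc trigo.

Set Implicit Arguments.
Unset Strict Implicit.
Unset Printing Implicit Defensive.

Import Order.TTheory GRing.Theory Num.Theory.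
Import numFieldNormedType.Exports.

Local Open Scope classical_set_scope.
Local Open Scope ring_scope.

(** Write [Q l = - (R l + l)^-1], so that a model is a nonnegative selfadjoint
    relation whose resolvent compresses to [Q]. By the resolvent identity the
    inner products of the vectors [f] and [(A - l)^-1 g] are determined by [Q].
    Minimality makes these vectors total, so two models are intertwined by a
    unitary, which fixes [M] pointwise.

    For existence, the Cayley transform [l = i (1 + z) / (1 - z)] turns [Q] into
    the function [- i (l + (1 + l^2) Q l)] of [z] in the unit disc, which has
    nonnegative real part and the value [1] at [0]. By Cauchy's formula its
    Taylor coefficients form a positive definite Toeplitz kernel on [Z x M]; the
    shift is unitary on the space represented by this kernel, and the inverse
    Cayley transform of the shift is the required relation [A].

    For [A >= 0], let [h] be a combination of vectors [f] and [(A - l)^-1 g].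
    Since [Q] continues analytically to the negative axis, so does
    [((A - l)^-1 h, h)] from the upper half-plane; there it is real,
    nondecreasing and vanishes at [-oo], hence nonnegative. If [h = (A - x) u],
    its value at [x < 0] is [(u, (A - x) u)], and one lets [x] tend to [0]. *)

(** * Hilbert space preliminaries *)

(** The function of [z] is chosen so that [Q] drops out at [z = 0], where [1 + l^2 = 0]: the
    diagonal of the Toeplitz kernel is then the inner product of [M], and [f] goes isometrically to
    the vector of index [(0, f)]. Only values of [Q] in the upper half-plane enter the kernel; the
    lower half-plane is recovered from adjoints. The inverse Cayley transform of a unitary is a
    selfadjoint relation with no condition on fixed vectors, so a multivalued part needs no separate
    treatment. The obstacle is that positivity of the kernel says nothing about [A >= 0]: the
    behaviour of [Q] on the negative axis has to be carried from [M] to the whole space, one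
    resolvent at a time. Before [A >= 0] is known, [A - x] with [x < 0] is out of control, so the
    compression formula at such [x] comes last. Near the negative axis, functions are differentiated
    only relative to the union of the upper half-plane and the axis; this is enough, because the
    sign of the real derivative is read off from vertical increments. *)

Section InnerProduct.
Context (R : realType) (H : hilbertType R).
Local Notation C := R[i].
Implicit Types (x y z : H) (a : C).

Lemma innerDl x y z : inner (x + y) z = inner x z + inner y z.
Proof. exact: linearDl. Qed.

Lemma innerDr x y z : inner x (y + z) = inner x y + inner x z.
Proof. exact: linearDr. Qed.

Lemma innerBl x y z : inner (x - y) z = inner x z - inner y z.
Proof. exact: linearBl. Qed.

Lemma innerBr x y z : inner x (y - z) = inner x y - inner x z.
Proof. exact: linearBr. Qed.

Lemma innerNl x y : inner (- x) y = - inner x y.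
Proof. exact: linearNl. Qed.

Lemma innerNr x y : inner x (- y) = - inner x y.
Proof. exact: linearNr. Qed.

Lemma inner0l x : inner 0 x = 0.
Proof. exact: linear0l. Qed.

Lemma inner0r x : inner x 0 = 0.
Proof. exact: linear0r. Qed.

Lemma innerZl a x y : inner (a *: x) y = a * inner x y.
Proof. exact: linearZl_LR. Qed.

Lemma innerZr a x y : inner x (a *: y) = a^* * inner x y.
Proof. exact: linearZr_LR. Qed.

Lemma innerC x y : inner x y = (inner y x)^*.
Proof. by rewrite (hermC inner) expr0 mul1r. Qed.

Lemma inner_norm x : inner x x = `|x| ^+ 2.
Proof. by rewrite sqr_norm_inner. Qed.

Lemma inner_suml I (s : seq I) (F : I -> H) y :
  inner (\sum_(i <- s) F i) y = \sum_(i <- s) inner (F i) y.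
Proof. exact: linear_sumlz. Qed.

Lemma inner_sumr I (s : seq I) (F : I -> H) y :
  inner y (\sum_(i <- s) F i) = \sum_(i <- s) inner y (F i).
Proof. exact: linear_sumr. Qed.

Lemma norm2D x y :
  `|x + y| ^+ 2 = `|x| ^+ 2 + `|y| ^+ 2 + (inner x y + (inner x y)^*).
Proof.
by rewrite -!inner_norm innerDl !innerDr (innerC y x); ring.
Qed.

Lemma norm2B x y :
  `|x - y| ^+ 2 = `|x| ^+ 2 + `|y| ^+ 2 - (inner x y + (inner x y)^*).
Proof. by rewrite norm2D normrN innerNr rmorphN/=; ring. Qed.

Lemma cauchy_schwarz x y : `|inner x y| <= `|x| * `|y|.
Proof.
have [->|y0] := eqVneq y 0; first by rewrite inner0r !normr0 mulr0.
have ny : 0 < `|y| by rewrite normr_gt0.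
rewrite -(@ler_pXn2r _ 2) ?nnegrE ?mulr_ge0// exprMn.
rewrite -ler_pdivrMr ?exprn_gt0//.
set c := inner x y; set n := `|y| ^+ 2.
have nr : n^* = n by apply: CrealP; rewrite rpredX// normr_real.
have n0 : n != 0 by rewrite expf_neq0// gt_eqF.
have := exprn_ge0 2 (normr_ge0 (x - (c / n) *: y)).
rewrite norm2B normrZ exprMn normrM normfV exprMn exprVn.
rewrite innerZr -/c rmorphM/= fmorphV/= nr.
have -> : `|n| = n by rewrite ger0_norm// exprn_ge0.
rewrite rmorphM/= rmorphM/= conjCK fmorphV/= nr.
rewrite -[in X in _ -> X]subr_ge0; congr (0 <= _).
have -> : c^* / n * c = `|c| ^+ 2 / n by rewrite normCK; ring.
have -> : c / n * c^* = `|c| ^+ 2 / n by rewrite normCK; ring.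
by rewrite -[`|y| ^+ 2]/n; clearbody n c; field.
Qed.

Lemma inner_eq x y : (forall z, inner x z = inner y z) -> x = y.
Proof.
move=> h; apply/eqP; rewrite -subr_eq0 -normr_eq0 -sqrf_eq0.
by rewrite -inner_norm innerBl h subrr.
Qed.

Lemma inner_eqr x y : (forall z, inner z x = inner z y) -> x = y.
Proof. by move=> h; apply: inner_eq => z; rewrite innerC h -innerC. Qed.

End InnerProduct.

(** * Epsilon arguments and completeness of the complex numbers *)

Section SmallNumbers.
Context (R : realType).
Local Notation C := R[i].

Lemma small_eq0 (V : normedModType C) (x : V) (c : C) :
  (forall e, 0 < e -> `|x| <= c * e) -> x = 0.
Proof.
move=> h; apply/eqP; rewrite -normr_eq0 eq_le normr_ge0 andbT.
have c0 : 0 <= c by have := h 1 ltr01; rewrite mulr1; exact: le_trans.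
have [//|x0] := eqVneq `|x| 0; first by move=> ->.
have px : 0 < `|x| by rewrite lt_def x0 normr_ge0.
have d0 : 0 < 2 * (c + 1) by rewrite mulr_gt0// ltr_wpDl.
have := h _ (divr_gt0 px d0); rewrite mulrA ler_pdivlMr//.
rewrite mulrC ler_pM2r// => /le_trans/(_ (_ : c <= c + 1)).
rewrite lerDl ler01 => /(_ isT).
rewrite mulr_natl mulr2n gerDl => /le_lt_trans/(_ _)/=.
by move=> /(_ _ (ltr_wpDl c0 ltr01)); rewrite ltxx.
Qed.

Lemma complex_gt0E (e : C) : 0 < e -> e = (complex.Re e)%:C%C /\ 0 < complex.Re e.
Proof.
by move=> e0; have := gtr0_real e0 => /RRe_real re; split => //; rewrite -ltcR re.
Qed.

Lemma inv_small (e : C) : 0 < e -> exists N, forall n, (N <= n)%N -> n.+1%:R^-1 < e.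
Proof.
move=> /complex_gt0E[-> e0].
exists (Num.truncn (complex.Re e)^-1).+1 => n Nn.
have -> : n.+1%:R^-1 = (n.+1%:R^-1 : R)%:C%C by rewrite fmorphV/= rmorph_nat.
rewrite ltcR invf_plt ?posrE//.
apply: (lt_trans (truncnS_gt _)); by rewrite ltr_nat.
Qed.

Lemma invS_gt0 n : 0 < (n.+1%:R^-1 : C).
Proof. by rewrite invr_gt0 ltr0n. Qed.

Lemma geom_small (q e : C) : 0 <= q -> q < 1 -> 0 < e ->
  exists N, forall n, (N <= n)%N -> q ^+ n < e.
Proof.
move=> q0 q1 /complex_gt0E[-> e0].
have qE : q = (complex.Re q)%:C%C by rewrite RRe_real// ger0_real.
move: q0 q1; rewrite qE => q0 q1; rewrite -[1]/(1%:C%C) ltcR in q1.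
rewrite ler0c in q0.
have : (fun n => complex.Re q ^+ n) @ \oo --> (0 : R).
  by apply: cvg_expr; rewrite ger0_norm.
move=> /cvgrPdist_lt/(_ _ e0)[N _ hN]; exists N => n Nn.
have := hN _ Nn; rewrite /= sub0r normrN normrX ger0_norm// => h.
by rewrite -rmorphXn/= ltcR.
Qed.

Lemma cauchy_limit (V : completeNormedModType C) (u : nat -> V) :
  (forall e, 0 < e -> exists N, forall n m, (N <= n)%N -> (N <= m)%N ->
     `|u n - u m| < e) ->
  exists h, forall e, 0 < e -> exists N, forall n, (N <= n)%N -> `|h - u n| < e.
Proof.
move=> hu.
have /cvg_ex[h /cvgrPdist_lt hh] : cvg (u @ \oo).
  apply/cauchy_cvgP/cauchyP => e e0; have [N hN] := hu e e0.
  exists (u N); exists N => // n /= Nn; rewrite -ball_normE/=.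
  exact: hN.
by exists h => e /hh[N _ hN]; exists N => n Nn; exact: hN.
Qed.

Lemma norm_iC : `|'i%C : C| = 1.
Proof. by rewrite complexiE normCi. Qed.

Lemma norm_real_complex (x : R) : `|x%:C%C : C| = `|x|%:C%C.
Proof. by rewrite normc_def/= expr0n/= addr0 sqrtr_sqr. Qed.

Lemma normc_ge_Im (x : C) : `|complex.Im x|%:C%C <= `|x|.
Proof. by have := normc_ge_Re (x * 'i%C); rewrite ReiNIm normrN normrM norm_iC mulr1. Qed.

Lemma norm_le_Re_Im (x : C) : `|x| <= (`|complex.Re x| + `|complex.Im x|)%:C%C.
Proof.
rewrite [in leLHS](complexE x); apply: (le_trans (ler_normD _ _)).
by rewrite normrM norm_iC mul1r !norm_real_complex rmorphD.
Qed.

Lemma complex_cauchy (u : nat -> C) :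
  (forall e, 0 < e -> exists N, forall n m, (N <= n)%N -> (N <= m)%N ->
     `|u n - u m| < e) ->
  exists h, forall e, 0 < e -> exists N, forall n, (N <= n)%N -> `|h - u n| < e.
Proof.
move=> hu.
have part (p : C -> R) : {morph p : x y / x - y} ->
    (forall x, `|p x|%:C%C <= `|x|) ->
    exists a, forall e : R, 0 < e -> exists N, forall n, (N <= n)%N -> `|a - p (u n)| < e.
  move=> pB pn.
  have /cvg_ex[h /cvgrPdist_lt hh] : cvg ((p \o u) @ \oo).
    apply/cauchy_cvgP/cauchyP => e e0; have [|N hN] := hu e%:C%C; first by rewrite ltcR.
    exists (p (u N)); exists N => // n /= Nn; rewrite -ball_normE/= -pB.
    by rewrite -ltcR; apply: (le_lt_trans (pn _)); apply: hN.
  by exists h => e /hh[N _ hN]; exists N => n Nn; exact: hN.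
have [|//|a ha] := part (@complex.Re R); first by move=> [? ?] [? ?].
  exact: normc_ge_Re.
have [||b hb] := part (@complex.Im R); first by move=> [? ?] [? ?].
  exact: normc_ge_Im.
exists (a +i* b)%C => e /complex_gt0E[-> e0].
have e20 : 0 < complex.Re e / 2 by rewrite divr_gt0.
have [N1 h1] := ha _ e20; have [N2 h2] := hb _ e20.
exists (maxn N1 N2) => n; rewrite geq_max => /andP[n1 n2].
apply: (le_lt_trans (norm_le_Re_Im _)); rewrite ltcR (splitr (complex.Re e)).
by have := h1 _ n1; have := h2 _ n2; case: (u n) => c d /= ? ?; rewrite ltrD.
Qed.

End SmallNumbers.

Section Combinations.
Context (R : realType).
Local Notation C := R[i].

(** Formal combinations are lists with repetitions allowed, so that addition is concatenation and no
    choice of a normal form is involved. *)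
Definition lcomb (V : lmodType C) X (v : X -> V) (l : seq (C * X)) : V :=
  \sum_(p <- l) p.1 *: v p.2.

Definition lscale X (a : C) (l : seq (C * X)) := [seq (a * p.1, p.2) | p <- l].

Definition gram X (k : X -> X -> C) (l l' : seq (C * X)) : C :=
  \sum_(p <- l) \sum_(q <- l') p.1 * q.1^* * k p.2 q.2.

Lemma lcomb_nil (V : lmodType C) X (v : X -> V) : lcomb v [::] = 0.
Proof. exact: big_nil. Qed.

Lemma lcomb_cat (V : lmodType C) X (v : X -> V) l l' :
  lcomb v (l ++ l') = lcomb v l + lcomb v l'.
Proof. exact: big_cat. Qed.

Lemma lcomb_scale (V : lmodType C) X (v : X -> V) a l :
  lcomb v (lscale a l) = a *: lcomb v l.
Proof.
by rewrite /lcomb big_map scaler_sumr; apply: eq_bigr => p _; rewrite scalerA.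
Qed.

Lemma lcomb1 (V : lmodType C) X (v : X -> V) x : lcomb v [:: (1, x)] = v x.
Proof. by rewrite /lcomb big_seq1 scale1r. Qed.

Lemma gram_inner (H : hilbertType R) X (v : X -> H) l l' :
  inner (lcomb v l) (lcomb v l') = gram (fun x y => inner (v x) (v y)) l l'.
Proof.
rewrite inner_suml; apply: eq_bigr => p _.
rewrite inner_sumr; apply: eq_bigr => q _.
by rewrite innerZl innerZr mulrA.
Qed.

Lemma eq_gram X (k k' : X -> X -> C) l l' : (forall x y, k x y = k' x y) ->
  gram k l l' = gram k' l l'.
Proof. by move=> kk; do 2!apply: eq_bigr => ? _; rewrite kk. Qed.

Definition total (H : hilbertType R) X (v : X -> H) :=
  forall h e, 0 < e -> exists l, `|h - lcomb v l| < e.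

End Combinations.

(** * Neumann iteration and the Riesz representation *)

Section Neumann.
Context (R : realType) (H : hilbertType R).
Local Notation C := R[i].

(** The fixed point of [x |-> y + T x]. Asking only additivity and a contraction constant allows [T]
    to be built from a function obtained by choice. *)
Lemma neumann (T : H -> H) (q : C) : {morph T : x y / x - y} ->
  0 <= q -> q < 1 -> (forall x, `|T x| <= q * `|x|) ->
  forall y, exists x, x - T x = y.
Proof.
move=> TB q0 q1 Tq y.
pose u n := iter n (fun x => y + T x) y.
have uS n : u n.+1 = y + T (u n) by [].
have q1' : 0 < 1 - q by rewrite subr_gt0.
pose K := q * `|y| / (1 - q).
have K0 : 0 <= K by rewrite divr_ge0 ?mulr_ge0// ltW.
have KE : q * (K + `|y|) = K.
  by rewrite /K; have := gt_eqF q1' => /negbT; move: `|y| => n ?; field.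
have hk k : `|u k - u 0%N| <= K.
  elim: k => [|k ih]; first by rewrite subrr normr0.
  rewrite uS addrAC subrr add0r; apply: (le_trans (Tq _)).
  rewrite -[leRHS]KE ler_wpM2l//.
  by rewrite -[u k](subrK (u 0%N)) (le_trans (ler_normD _ _))// lerD2r.
have hn n k : `|u (n + k)%N - u n| <= q ^+ n * K.
  elim: n => [|n ih]; first by rewrite expr0 mul1r; exact: hk.
  rewrite addSn !uS opprD addrACA subrr add0r -TB.
  by apply: (le_trans (Tq _)); rewrite exprS -mulrA ler_wpM2l.
have [|x hx] := @cauchy_limit _ H u.
  move=> e e0; have K1 : 0 < K + K + 1 by rewrite ltr_wpDl// addr_ge0.
  have [N hN] := geom_small q0 q1 (divr_gt0 e0 K1).
  have hN' n : (N <= n)%N -> `|u n - u N| <= q ^+ N * K.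
    by move=> /subnKC <-; exact: hn.
  exists N => n m Nn Nm; have -> : u n - u m = (u n - u N) - (u m - u N) by rewrite opprB addrA subrK.
  apply: (le_lt_trans (ler_normB _ _)).
  apply: (le_lt_trans (lerD (hN' _ Nn) (hN' _ Nm))).
  rewrite -mulrDr; apply: (@le_lt_trans _ _ (q ^+ N * (K + K + 1))).
    by rewrite ler_wpM2l ?exprn_ge0// lerDl.
  by rewrite -ltr_pdivlMr//; exact: hN.
exists x; apply/eqP; rewrite -subr_eq0; apply/eqP.
apply: (@small_eq0 _ H _ 2) => e e0; have [N hN] := hx e e0.
have -> : x - T x - y = (x - u N.+1) - T (x - u N) by rewrite uS TB opprB opprD !addrA subrK addrAC.
apply: (le_trans (ler_normB _ _)); rewrite mulr_natl mulr2n lerD//.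
  by rewrite ltW// hN.
apply: (le_trans (Tq _)); rewrite -[leRHS]mul1r ler_pM// ?ltW// hN//.
Qed.

(** The representing vector minimises [|y|^2 - 2 Re (phi y)] and is the limit of a minimising
    sequence. On the zero space the bound does not give [0 <= c], whence the initial case
    distinction. *)
Lemma riesz (phi : H -> C) (c : C) :
  (forall a x y, phi (a *: x + y) = a * phi x + phi y) ->
  (forall x, `|phi x| <= c * `|x|) ->
  exists y, forall x, phi x = inner x y.
Proof.
move=> lphi bphi.
have c0 : 0 <= c \/ forall x, phi x = 0.
  have [[x x0]|h] := pselect (exists x : H, x != 0).
    left; have := le_trans (normr_ge0 _) (bphi x).
    by rewrite pmulr_lge0// normr_gt0.
  right => x; have -> : x = 0 by apply: contrapT => /eqP x0; apply: h; exists x.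
  by have := bphi 0; rewrite normr0 mulr0 normr_le0 => /eqP.
case: c0 => [c0|p0]; last by exists 0 => x; rewrite inner0r.
pose J y : R := complex.Re (`|y| ^+ 2 - (phi y + (phi y)^*)).
have Jreal y : (J y)%:C%C = `|y| ^+ 2 - (phi y + (phi y)^*).
  rewrite RRe_real// rpredB ?rpredX ?normr_real//.
  by apply/CrealP; rewrite rmorphD/= conjCK addrC.
have phi0 : phi 0 = 0.
  by have := lphi (-1) 0 0; rewrite scaler0 addr0 mulN1r addNr.
have phiD x y : phi (x + y) = phi x + phi y.
  by have := lphi 1 x y; rewrite scale1r mul1r.
have phiZ a x : phi (a *: x) = a * phi x.
  by have := lphi a x 0; rewrite phi0 !addr0.
have Jlb y : - (c ^+ 2) <= (J y)%:C%C.
  rewrite Jreal -subr_ge0 opprK.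
  apply: (@le_trans _ _ ((`|y| - c) ^+ 2)).
    by rewrite real_exprn_even_ge0// rpredB ?normr_real// ger0_real.
  rewrite -subr_ge0.
  have -> : `|y| ^+ 2 - (phi y + (phi y)^*) + c ^+ 2 - (`|y| - c) ^+ 2 =
     (c * `|y| + c * `|y|) - (phi y + (phi y)^*) by ring.
  rewrite subr_ge0.
  have re : phi y + (phi y)^* \is Num.real by apply/CrealP; rewrite rmorphD/= conjCK addrC.
  apply: (le_trans (real_ler_norm re)); apply: (le_trans (ler_normD _ _)).
  by rewrite norm_conjC lerD.
have hasinf : has_inf [set J y | y in [set: H]].
  split; first by exists (J 0), 0.
  exists (- complex.Re (c ^+ 2)) => _ [y _ <-].
  have := Jlb y; rewrite -(RRe_real (_ : c ^+ 2 \is Num.real)) ?rpredX ?ger0_real//.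
  by rewrite -rmorphN lecR.
pose m := inf [set J y | y in [set: H]].
have mJ y : m <= J y by apply: ge_inf; [exact: hasinf.2 | exists y].
have /choice[u hu] n : exists y, J y < m + n.+1%:R^-1.
  have e0 : 0 < n.+1%:R^-1 :> R by rewrite invr_gt0 ltr0n.
  by have [_ [y _ <-] hy] := inf_adherent e0 hasinf; exists y.
(* Moving from [u n] by [- s d^* x] changes [J] by [s^2 |d|^2 |x|^2 - 2 s |d|^2], which is at most
   [- s |d|^2] for this [s]; but [J (u n)] is within [1 / (n + 1)] of the infimum. *)
have key n x : `|inner x (u n) - phi x| ^+ 2 <= (1 + `|x| ^+ 2) * n.+1%:R^-1.
  set d := _ - _; set s : C := (1 + `|x| ^+ 2)^-1.
  have s1 : 0 < 1 + `|x| ^+ 2 by rewrite ltr_pwDl// exprn_ge0.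
  have s0 : 0 < s by rewrite invr_gt0.
  have sr : s^* = s by apply: CrealP; rewrite gtr0_real.
  have : (J (u n))%:C%C - n.+1%:R^-1 <= (J (u n + (- (s * d^*)) *: x))%:C%C.
    have -> : n.+1%:R^-1 = (n.+1%:R^-1 : R)%:C%C by rewrite fmorphV/= rmorph_nat.
    rewrite -rmorphB lecR; apply: le_trans (mJ _).
    by rewrite lerBlDr ltW.
  rewrite !Jreal norm2D phiD phiZ normrZ exprMn innerZr.
  rewrite (innerC (u n) x) /d normrN normrM norm_conjC (gtr0_norm s0) exprMn.
  move: (inner x (u n)) (phi x) (phi (u n)) => a b f.
  rewrite -subr_ge0 => h.
  rewrite mulrC -ler_pdivrMr// -/s -subr_ge0; apply: (le_trans h).
  rewrite -subr_ge0.
  set X := (X in 0 <= X).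
  have -> : X = s * `|a - b| ^+ 2 * (1 - s * `|x| ^+ 2).
    rewrite /X normCK !(rmorphD, rmorphM, rmorphN)/= !conjCK sr.
    by move: (`|x| ^+ 2) (`|u n| ^+ 2) n.+1%:R^-1 => N M I; clear; ring.
  rewrite mulr_ge0 ?mulr_ge0 ?exprn_ge0 ?(ltW s0)//.
  by rewrite subr_ge0 mulrC ler_pdivrMr// mul1r lerDr.
have nat_real n : (n.+1%:R^-1 : R)%:C%C = n.+1%:R^-1 :> C.
  by rewrite fmorphV/= rmorph_nat.
have hu' n : (J (u n) - m)%:C%C < n.+1%:R^-1.
  by rewrite -nat_real ltcR ltrBlDl.
(* Parallelogram law: the linear part of [J] cancels against its value at the midpoint. Since [J] is
   at least [m] there, the minimising sequence is Cauchy. *)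
have par n k : `|u n - u k| ^+ 2 = ((J (u n) - m) + (J (u k) - m) -
   (J ((2^-1 : C) *: (u n + u k)) - m) *+ 2)%:C%C *+ 2.
  have -> : (J (u n) - m) + (J (u k) - m) -
   (J ((2^-1 : C) *: (u n + u k)) - m) *+ 2 =
    J (u n) + J (u k) - J ((2^-1 : C) *: (u n + u k)) *+ 2 by ring.
  rewrite rmorphB rmorphD rmorphMn/= !Jreal norm2B normrZ exprMn norm2D phiZ phiD.
  have -> : `|2^-1 : C| = 2^-1 by rewrite ger0_norm ?invr_ge0.
  have c2 : (2^-1)^* = 2^-1 :> C by rewrite fmorphV/= conjC_nat.
  by rewrite !(rmorphD, rmorphM)/= c2; field.
have [|y hy] := @cauchy_limit _ H u.
  move=> e e0; have e4 : 0 < e ^+ 2 / 4 by rewrite divr_gt0// exprn_gt0.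
  have [N hN] := inv_small e4; exists N => n k Nn Nk.
  rewrite -(@ltr_pXn2r _ 2) ?nnegrE//; last exact: ltW.
  rewrite par; apply: (@le_lt_trans _ _ (((J (u n) - m)%:C%C + (J (u k) - m)%:C%C) *+ 2)).
    rewrite -rmorphD lerMn2r/= lecR gerDl oppr_le0 mulrn_wge0// subr_ge0; exact: mJ.
  have := ltrD (lt_trans (hu' n) (hN _ Nn)) (lt_trans (hu' k) (hN _ Nk)).
  rewrite -(@ltr_pMn2r _ 2)// => /lt_le_trans; apply.
  by rewrite le_eqVlt; apply/orP; left; apply/eqP; field.
exists y => x; apply/eqP; rewrite eq_sym -subr_eq0; apply/eqP.
apply: (@small_eq0 R (R[i]^o) _ (`|x| + 1)) => e e0.
have s1 : 0 < 1 + `|x| ^+ 2 by rewrite ltr_pwDl// exprn_ge0.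
have [N1 h1] := hy _ e0.
have [N2 h2] := inv_small (divr_gt0 (exprn_gt0 2 e0) s1).
pose n := maxn N1 N2.
have -> : inner x y - phi x = inner x (y - u n) + (inner x (u n) - phi x).
  by rewrite innerBr addrA subrK.
apply: (le_trans (ler_normD _ _)); rewrite mulrDl mul1r lerD//.
  apply: (le_trans (cauchy_schwarz _ _)); rewrite ler_wpM2l// ltW// h1//.
  exact: leq_maxl.
rewrite -(@ler_pXn2r _ 2) ?nnegrE//; last exact: ltW.
apply: (le_trans (key _ _)); rewrite mulrC -ler_pdivlMr// ltW// h2//.
exact: leq_maxr.
Qed.

End Neumann.

(** * Unitaries determined by equal Gram kernels *)

Section Gram.
Context (R : realType).
Local Notation C := R[i].

Lemma inner_of_norm (H1 H2 : hilbertType R) (W : H1 -> H2) :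
  linear W -> (forall x, `|W x| = `|x|) ->
  forall x y, inner (W x) (W y) = inner x y.
Proof.
move=> lW nW.
have WD x y : W (x + y) = W x + W y by have := lW 1 x y; rewrite !scale1r.
have W0 : W 0 = 0 by apply: normr0_eq0; rewrite nW normr0.
have WZ a x : W (a *: x) = a *: W x by have := lW a x 0; rewrite W0 !addr0.
have re x y : inner (W x) (W y) + (inner (W x) (W y))^* =
    inner x y + (inner x y)^*.
  by have := norm2D x y; rewrite -nW WD norm2D !nW => /addrI.
move=> x y; have h1 := re x y; have h2 := re ('i *: x) y.
rewrite WZ !innerZl !rmorphM/= conjCi in h2.
have {}h2 : inner (W x) (W y) - (inner (W x) (W y))^* = inner x y - (inner x y)^*.
  apply: (mulfI (neq0Ci C)); rewrite !mulrBr.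
  by rewrite !mulNr in h2.
have h := congr2 +%R h1 h2.
have {}h : (inner (W x) (W y)) *+ 2 = (inner x y) *+ 2.
  move: h; set a := inner (W x) (W y); set b := inner x y => h.
  have -> : a *+ 2 = (a + a^*) + (a - a^*) by ring.
  by rewrite h; ring.
by apply/eqP; move/eqP: h; rewrite eqrMn2r.
Qed.

Section Unitary.
Context (H1 H2 : hilbertType R) (X : Type) (v1 : X -> H1) (v2 : X -> H2).
Hypothesis v12 : forall x y, inner (v1 x) (v1 y) = inner (v2 x) (v2 y).

Let norm12 l : `|lcomb v1 l| = `|lcomb v2 l|.
Proof.
apply/eqP; rewrite -(@eqrXn2 _ 2)//; apply/eqP.
by rewrite -!inner_norm !gram_inner; exact: eq_gram.
Qed.

Lemma lcomb_sub (V : lmodType C) (v : X -> V) l k :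
  lcomb v l - lcomb v k = lcomb v (l ++ lscale (-1) k).
Proof. by rewrite lcomb_cat lcomb_scale scaleN1r. Qed.

(** The closure of the assignment [lcomb v1 l |-> lcomb v2 l]. As a closed relation it can be
    studied before it is known to be single valued. *)
Definition gram_rel h h' := forall e, 0 < e ->
  exists l, `|h - lcomb v1 l| < e /\ `|h' - lcomb v2 l| < e.

Lemma gram_rel_total : total v1 -> forall h, exists h', gram_rel h h'.
Proof.
move=> t1 h; have /choice[l hl] n := t1 h _ (invS_gt0 R n).
have [|h' hh'] := @cauchy_limit _ H2 (lcomb v2 \o l).
  move=> e e0; have e20 : 0 < e / 2 by rewrite divr_gt0.
  have [N hN] := inv_small e20; exists N => n m Nn Nm /=.
  rewrite lcomb_sub -norm12 -lcomb_sub.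
  have -> : lcomb v1 (l n) - lcomb v1 (l m) =
    (h - lcomb v1 (l m)) - (h - lcomb v1 (l n)) by rewrite opprB [RHS]addrC addrA subrK.
  apply: (le_lt_trans (ler_normB _ _)); rewrite (splitr e) ltrD//.
    exact: lt_trans (hl _) (hN _ Nm).
  exact: lt_trans (hl _) (hN _ Nn).
exists h' => e e0; have [N1 h1] := hh' _ e0; have [N2 h2] := inv_small e0.
exists (l (maxn N1 N2)); split; last by apply: h1; exact: leq_maxl.
by apply: lt_trans (hl _) _; apply: h2; exact: leq_maxr.
Qed.

Lemma gram_rel_linear a h h' g g' : gram_rel h h' -> gram_rel g g' ->
  gram_rel (a *: h + g) (a *: h' + g').
Proof.
move=> hh gg e e0; have a1 : 0 < `|a| + 1 by rewrite ltr_wpDl.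
have e1 : 0 < e / (`|a| + 1) by rewrite divr_gt0.
have [l [l1 l2]] := hh _ e1; have [k [k1 k2]] := gg _ e1.
have aux (V : normedModType C) (x y z t : V) : `|x - z| < e / (`|a| + 1) ->
    `|y - t| < e / (`|a| + 1) -> `|a *: x + y - (a *: z + t)| < e.
  move=> xz yt; rewrite opprD addrACA -scalerBr.
  apply: (le_lt_trans (ler_normD _ _)); rewrite normrZ.
  apply: (@lt_le_trans _ _ (`|a| * (e / (`|a| + 1)) + e / (`|a| + 1))).
    by rewrite ler_ltD// ler_wpM2l// ltW.
  by rewrite -[X in _ + X]mul1r -mulrDl mulrC mulfVK// gt_eqF.
by exists (lscale a l ++ k); rewrite !lcomb_cat !lcomb_scale; split; exact: aux.
Qed.

Lemma gram_rel_norm h h' : gram_rel h h' -> `|h| = `|h'|.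
Proof.
move=> hh; apply/eqP; rewrite -subr_eq0; apply/eqP.
apply: (@small_eq0 R (R[i]^o) _ 2) => e e0; have [l [l1 l2]] := hh _ e0.
have -> : `|h| - `|h'| = (`|h| - `|lcomb v1 l|) - (`|h'| - `|lcomb v2 l|).
  by rewrite norm12 opprB addrA subrK.
apply: (le_trans (ler_normB _ _)); rewrite mulr_natl mulr2n lerD//.
  by apply: (le_trans (ler_dist_dist _ _)); exact: ltW.
by apply: (le_trans (ler_dist_dist _ _)); exact: ltW.
Qed.

End Unitary.

(** The closed relation preserves norms, hence is single valued; surjectivity is its totality with
    the two families exchanged. *)
Lemma gram_unitary (H1 H2 : hilbertType R) X (v1 : X -> H1) (v2 : X -> H2) :
  (forall x y, inner (v1 x) (v1 y) = inner (v2 x) (v2 y)) ->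
  total v1 -> total v2 ->
  exists W : {linear H1 -> H2},
    [/\ isometry inner inner W, forall h', exists h, W h = h' &
      forall x, W (v1 x) = v2 x].
Proof.
move=> v12 t1 t2.
have /choice[W hW] := gram_rel_total v12 t1.
have rel_fun h h' : gram_rel v1 v2 h h' -> h' = W h.
  move=> hh; apply/eqP; rewrite -subr_eq0 -normr_eq0.
  have := gram_rel_linear (-1) (hW h) hh; rewrite scaleN1r addNr => /(gram_rel_norm v12).
  by rewrite normr0 scaleN1r [- _ + _]addrC => <-.
have lW : linear W.
  by move=> a x y; apply/esym/rel_fun; exact: gram_rel_linear.
have nW x : `|W x| = `|x| by rewrite -(gram_rel_norm v12 (hW x)).
pose Wl : {linear H1 -> H2} := HB.pack W (GRing.isLinear.Build C H1 H2 *:%R W lW).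
exists Wl; split.
- exact: (inner_of_norm lW nW).
- move=> h'; have [||h hh] := @gram_rel_total _ _ _ v2 v1 _ _ h' => //.
  exists h; apply/esym/rel_fun => e /hh[l [? ?]]; exists l; split => //.
- move=> x; apply/esym/rel_fun => e e0; exists [:: (1, x)].
  by rewrite !lcomb1 !subrr !normr0.
Qed.

End Gram.

(** * The Hilbert space represented by a positive kernel *)

Section Limits.
Context (R : realType).
Local Notation C := R[i].
Implicit Types (u v : nat -> C) (a b c : C).

Definition conv u c := forall e, 0 < e ->
  exists N, forall n, (N <= n)%N -> `|c - u n| < e.

Lemma conv_uniq u a b : conv u a -> conv u b -> a = b.
Proof.
move=> ua ub; apply/eqP; rewrite -subr_eq0; apply/eqP.
apply: (@small_eq0 R (R[i]^o) _ 2) => e e0.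
have [N hN] := ua _ e0; have [M hM] := ub _ e0; pose n := maxn N M.
have -> : a - b = (a - u n) - (b - u n) by rewrite opprB addrA subrK.
rewrite mulr_natl mulr2n; apply: (le_trans (ler_normB _ _)).
by rewrite lerD// ltW//; [apply: hN; exact: leq_maxl|apply: hM; exact: leq_maxr].
Qed.

Lemma conv_linear u v a b c : conv u a -> conv v b ->
  conv (fun n => c * u n + v n) (c * a + b).
Proof.
move=> ua vb e e0; have c1 : 0 < `|c| + 1 by rewrite ltr_wpDl.
have e1 : 0 < e / (`|c| + 1) by rewrite divr_gt0.
have [N hN] := ua _ e1; have [M hM] := vb _ e1.
exists (maxn N M) => n; rewrite geq_max => /andP[Nn Mn].
rewrite opprD addrACA -mulrBr; apply: (le_lt_trans (ler_normD _ _)).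
rewrite normrM; apply: (@lt_le_trans _ _ (`|c| * (e / (`|c| + 1)) + e / (`|c| + 1))).
  by rewrite ler_ltD ?hM// ler_wpM2l// ltW// hN.
by rewrite -[X in _ + X]mul1r -mulrDl mulrC mulfVK// gt_eqF.
Qed.

Lemma conv_conj u a : conv u a -> conv (fun n => (u n)^*) a^*.
Proof.
move=> ua e /ua[N hN]; exists N => n /hN.
by rewrite -rmorphB norm_conjC.
Qed.

Lemma conv_cst a : conv (fun=> a) a.
Proof. by move=> e e0; exists 0%N => n _; rewrite subrr normr0. Qed.

Lemma eq_conv u v a : (forall n, u n = v n) -> conv u a -> conv v a.
Proof. by move=> uv ua e /ua[N hN]; exists N => n; rewrite -uv; exact: hN. Qed.

Lemma convD u v a b : conv u a -> conv v b -> conv (fun n => u n + v n) (a + b).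
Proof.
move=> ua vb; have := conv_linear 1 ua vb; rewrite mul1r.
by apply: eq_conv => n; rewrite mul1r.
Qed.

Lemma conv_ge0 u a : conv u a -> (forall n, 0 <= u n) -> 0 <= a.
Proof.
move=> ua u0; suff -> : a = `|a| by [].
apply/eqP; rewrite -subr_eq0; apply/eqP.
apply: (@small_eq0 R (R[i]^o) _ 2) => e e0.
have [N /(_ N (leqnn _)) hN] := ua _ e0.
have -> : a - `|a| = (a - u N) - (`|a| - `|u N|).
  by rewrite (ger0_norm (u0 _)) opprB addrA subrK.
rewrite mulr_natl mulr2n; apply: (le_trans (ler_normB _ _)).
by rewrite lerD ?(ltW hN)//; apply: (le_trans (ler_dist_dist _ _)); exact: ltW.
Qed.

Lemma conv_shift u a N : conv (fun n => u (n + N)%N) a -> conv u a.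
Proof.
move=> ua e /ua[M hM]; exists (M + N)%N => n h.
have Nn : (N <= n)%N by apply: leq_trans h; exact: leq_addl.
by rewrite -(subnK Nn); apply: hM; rewrite leq_subRL// addnC.
Qed.

Lemma psd_cauchy_schwarz (A B g : C) : 0 <= A -> 0 <= B ->
  (forall t, 0 <= A + t^* * g + t * g^* + t * t^* * B) -> `|g| ^+ 2 <= A * B.
Proof.
move=> A0 B0 h.
have key e : 0 < e -> `|g| ^+ 2 <= A * (B + e).
  move=> e0; have Be : 0 < B + e by rewrite ltr_wpDl.
  have sr : ((B + e)^-1)^* = (B + e)^-1.
    by apply: CrealP; rewrite rpredV gtr0_real.
  have := h (- (g * (B + e)^-1)); rewrite !(rmorphN, rmorphM)/= sr.
  have -> : A + - (g^* * (B + e)^-1) * g + - (g * (B + e)^-1) * g^* +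
      - (g * (B + e)^-1) * - (g^* * (B + e)^-1) * B =
      (A * (B + e) ^+ 2 - `|g| ^+ 2 * (B + e + e)) / (B + e) ^+ 2.
    by rewrite normCK; have := gt_eqF Be => /negbT; clear; move=> ?; field.
  rewrite pmulr_lge0 ?invr_gt0 ?exprn_gt0// subr_ge0 => {}h.
  rewrite -(@ler_pM2r _ (B + e))//.
  have -> : A * (B + e) * (B + e) = A * (B + e) ^+ 2 by ring.
  apply: le_trans h.
  by rewrite ler_wpM2l ?exprn_ge0// lerDl ltW.
have gr : `|g| ^+ 2 \is Num.real by rewrite rpredX ?normr_real.
have ABr : A * B \is Num.real by rewrite rpredM// ger0_real.
have [//|] := real_leP gr ABr; rewrite -subr_gt0 => d0.
have A1 : 0 < 2 * (A + 1) by rewrite mulr_gt0// ltr_wpDl.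
have := key _ (divr_gt0 d0 A1); rewrite mulrDr -lerBlDl.
set d := `|g| ^+ 2 - _ in d0 *; rewrite mulrCA -{1}[d]mulr1 ler_pM2l//.
rewrite ler_pdivlMr// mul1r => h1.
have : A + 1 + 1 <= 0 by move: h1; rewrite -subr_le0; congr (_ <= 0); ring.
by move=> /(lt_le_trans (ltr_wpDl (addr_ge0 A0 ler01) ltr01)); rewrite ltxx.
Qed.

Lemma sqrtC_triangle (A B g : C) : 0 <= A -> 0 <= B -> `|g| ^+ 2 <= A * B ->
  0 <= A + B + (g + g^*) ->
  sqrtC (A + B + (g + g^*)) <= sqrtC A + sqrtC B.
Proof.
move=> A0 B0 gAB h0.
rewrite -(@ler_pXn2r _ 2) ?nnegrE ?addr_ge0 ?sqrtC_ge0// sqrrD !sqrtCK.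
rewrite [leRHS]addrAC lerD2l.
have re : g + g^* \is Num.real by apply/CrealP; rewrite rmorphD/= conjCK addrC.
apply: (le_trans (real_ler_norm re)); apply: (le_trans (ler_normD _ _)).
rewrite norm_conjC -mulr2n lerMn2r/=.
rewrite -(@ler_pXn2r _ 2) ?nnegrE ?mulr_ge0 ?sqrtC_ge0//.
by rewrite exprMn !sqrtCK.
Qed.

End Limits.

(** The expression in [ker_sep] is the squared distance of the vectors representing [x] and [D n];
    this condition makes the represented space separable, as [hilbertType] demands. *)
Record pkernel (R : realType) (X : Type) := PKernel {
  ker :> X -> X -> R[i] ;
  ker_conj : forall x y, ker x y = (ker y x)^* ;
  ker_psd : forall l, 0 <= gram ker l l ;
  ker_sep : exists D : nat -> X, forall x e, 0 < e -> exists n,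
    ker x x - ker x (D n) - ker (D n) x + ker (D n) (D n) < e
}.

Section Rkhs.
Context (R : realType) (X : Type) (k : pkernel R X).
Local Notation C := R[i].
Implicit Types (l : seq (C * X)) (a b c : C) (x y : X).

Let g := gram k.
Let sub l l' := l ++ lscale (-1) l'.

Let gDl l1 l2 l : g (l1 ++ l2) l = g l1 l + g l2 l.
Proof. exact: big_cat. Qed.

Let gC l l' : g l l' = (g l' l)^*.
Proof.
rewrite /g /gram exchange_big/= rmorph_sum/=; apply: eq_bigr => p _.
rewrite rmorph_sum/=; apply: eq_bigr => q _.
by rewrite !rmorphM/= conjCK -ker_conj [_^* * _]mulrC.
Qed.

Let gDr l1 l2 l : g l (l1 ++ l2) = g l l1 + g l l2.
Proof. by rewrite gC gDl rmorphD/= -!gC. Qed.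

Let gZl a l l' : g (lscale a l) l' = a * g l l'.
Proof.
rewrite /g /gram big_map mulr_sumr; apply: eq_bigr => p _.
by rewrite mulr_sumr; apply: eq_bigr => q _; rewrite /= !mulrA.
Qed.

Let gZr a l l' : g l (lscale a l') = a^* * g l l'.
Proof. by rewrite gC gZl rmorphM/= -gC. Qed.

Let gBl l1 l2 l : g (sub l1 l2) l = g l1 l - g l2 l.
Proof. by rewrite gDl gZl mulN1r. Qed.

Let gBr l1 l2 l : g l (sub l1 l2) = g l l1 - g l l2.
Proof. by rewrite gDr gZr rmorphN rmorph1 mulN1r. Qed.

Let sn l : C := sqrtC (g l l).

Let g0 l : 0 <= g l l. Proof. exact: ker_psd. Qed.

Let sn_ge0 l : 0 <= sn l. Proof. by rewrite sqrtC_ge0. Qed.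

Let sn2 l : sn l ^+ 2 = g l l. Proof. exact: sqrtCK. Qed.

Let gcs l l' : `|g l l'| <= sn l * sn l'.
Proof.
rewrite -(@ler_pXn2r _ 2) ?nnegrE ?mulr_ge0// exprMn !sn2.
apply: psd_cauchy_schwarz => // t.
have := g0 (l ++ lscale t l'); rewrite gDl !gDr !gZl !gZr (gC l' l).
by congr (0 <= _); rewrite mulrA !addrA.
Qed.

Let snD l l' : sn (l ++ l') <= sn l + sn l'.
Proof.
have -> : sn (l ++ l') = sqrtC (g l l + g l' l' + (g l l' + (g l l')^*)).
  by rewrite /sn gDl !gDr (gC l' l); congr sqrtC; ring.
apply: sqrtC_triangle => //; first by have := gcs l l'; rewrite -(@ler_pXn2r _ 2) ?nnegrE ?mulr_ge0// exprMn !sn2.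
have := g0 (l ++ l'); rewrite gDl !gDr (gC l' l); congr (0 <= _); ring.
Qed.

Let snZ a l : sn (lscale a l) = `|a| * sn l.
Proof.
apply/eqP; rewrite -(@eqrXn2 _ 2) ?mulr_ge0// exprMn !sn2 gZl gZr mulrA.
by rewrite normCK.
Qed.

Let cauchy_rep (u : nat -> seq (C * X)) := forall e, 0 < e ->
  exists N, forall n m, (N <= n)%N -> (N <= m)%N -> sn (sub (u n) (u m)) < e.

(* The points of the completion are the functions [x |-> lim (u n, x)] for
   Cauchy sequences [u] of formal combinations. *)
Let rep u (f : X -> C) :=
  cauchy_rep u /\ forall x, conv (fun n => g (u n) [:: (1, x)]) (f x).

(** By the reproducing property this is the inner product of [f] with the combination [l]. *)
Let ev (f : X -> C) l := \sum_(q <- l) q.1^* * f q.2.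

Let rep_ev u f l : rep u f -> conv (fun n => g (u n) l) (ev f l).
Proof.
move=> [_ uf]; elim: l => [|p l ih].
  rewrite /ev big_nil; apply: (eq_conv _ (conv_cst 0)) => n.
  by rewrite /g /gram big1// => q _; rewrite big_nil.
rewrite /ev big_cons -/(ev f l).
apply: (eq_conv _ (conv_linear p.1^* (uf p.2) ih)) => n.
cbv beta; rewrite -[p :: l]cat1s gDr; congr (_ + _).
by rewrite -gZr; congr (g _ _); rewrite /lscale/= mulr1; case: p {ih}.
Qed.

Let cauchy_bound u : cauchy_rep u -> exists B, forall n, sn (u n) <= B.
Proof.
move=> cu; have [N hN] := cu 1 ltr01.
exists (1 + \sum_(i < N.+1) sn (u i)) => n.
have Si i : (i < N.+1)%N -> sn (u i) <= \sum_(i < N.+1) sn (u i).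
  move=> iN; rewrite (bigD1 (Ordinal iN))//= lerDl sumr_ge0//.
have [nN|Nn] := ltnP n N.+1.
  by apply: (le_trans (Si _ nN)); rewrite lerDr.
have -> : sn (u n) = sn (sub (u n) (u N) ++ u N).
  by rewrite /sn; congr sqrtC; rewrite !(gDl, gDr, gZl, gZr) rmorphN rmorph1; ring.
apply: (le_trans (snD _ _)); rewrite lerD ?Si// ltW// hN// ltnW//.
Qed.

(** This is why a point of the completion may be identified with its function of limits. The
    difference [d] is Cauchy and pairs to [0] in the limit with each fixed combination; splitting
    [g (d n) (d n)] at a late [d N] makes both parts small. *)
Let rep_uniq u w f : rep u f -> rep w f ->
  forall e, 0 < e -> exists N, forall n, (N <= n)%N -> sn (sub (u n) (w n)) < e.
Proof.
move=> uf wf.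
pose d n := sub (u n) (w n).
have dl l : conv (fun n => g (d n) l) 0.
  have := conv_linear (-1) (rep_ev l wf) (rep_ev l uf).
  rewrite mulN1r addNr; apply: eq_conv => n.
  by rewrite gBl mulN1r addrC.
have cd : cauchy_rep d.
  move=> e e0; have e20 : 0 < e / 2 by rewrite divr_gt0.
  have [N hN] := uf.1 _ e20; have [M hM] := wf.1 _ e20.
  exists (maxn N M) => n m; rewrite !geq_max => /andP[Nn Mn] /andP[Nm Mm].
  have -> : sn (sub (d n) (d m)) = sn (sub (u n) (u m) ++ sub (w m) (w n)).
    by rewrite /sn /d; congr sqrtC; rewrite !(gDl, gDr, gZl, gZr) rmorphN rmorph1; ring.
  by apply: (le_lt_trans (snD _ _)); rewrite (splitr e) ltrD ?hN ?hM.
have [B hB] := cauchy_bound cd; have B0 : 0 <= B := le_trans (sn_ge0 _) (hB 0%N).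
move=> e e0; have B1 : 0 < B + 1 by rewrite ltr_wpDl.
have e1 : 0 < e ^+ 2 / (B + 1) by rewrite divr_gt0// exprn_gt0.
have [N hN] := cd _ e1.
have [|M hM] := dl (d N) (e ^+ 2 / (B + 1)) => //.
exists (maxn N M) => n; rewrite geq_max => /andP[Nn Mn].
rewrite -/(d n) -(@ltr_pXn2r _ 2) ?nnegrE ?sn_ge0 ?(ltW e0)// sn2.
rewrite -(ger0_norm (g0 (d n))).
have -> : g (d n) (d n) = g (d n) (sub (d n) (d N)) + g (d n) (d N).
  by rewrite gBr subrK.
apply: (le_lt_trans (ler_normD _ _)).
apply: (@lt_le_trans _ _ (B * (e ^+ 2 / (B + 1)) + e ^+ 2 / (B + 1))).
  rewrite ler_ltD//; last by have := hM _ Mn; rewrite sub0r normrN.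
  apply: (le_trans (gcs _ _)); rewrite ler_pM// ltW// hN//.
by rewrite -[X in _ + X]mul1r -mulrDl mulrC mulfVK// gt_eqF.
Qed.

Let rep_conv u w u' w' f f' c : rep u f -> rep u' f -> rep w f' -> rep w' f' ->
  conv (fun n => g (u n) (w n)) c -> conv (fun n => g (u' n) (w' n)) c.
Proof.
move=> uf uf' wf wf' cc.
suff d0 : conv (fun n => g (u' n) (w' n) - g (u n) (w n)) 0.
  have := convD d0 cc; rewrite add0r.
  by apply: eq_conv => n; rewrite subrK.
have [B hB] := cauchy_bound wf.1; have [B' hB'] := cauchy_bound uf'.1.
have B0 : 0 <= B := le_trans (sn_ge0 _) (hB 0%N).
have B0' : 0 <= B' := le_trans (sn_ge0 _) (hB' 0%N).
have BB : 0 < B + B' + 1 by rewrite ltr_wpDl// addr_ge0.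
move=> e e0; have e1 : 0 < e / (B + B' + 1) by rewrite divr_gt0.
have [N hN] := rep_uniq uf' uf e1; have [M hM] := rep_uniq wf' wf e1.
exists (maxn N M) => n; rewrite geq_max => /andP[Nn Mn].
rewrite sub0r normrN.
have -> : g (u' n) (w' n) - g (u n) (w n) =
   g (sub (u' n) (u n)) (w n) + g (u' n) (sub (w' n) (w n)).
  by rewrite gBl gBr; ring.
apply: (le_lt_trans (ler_normD _ _)).
apply: (@le_lt_trans _ _ ((B + B') * (e / (B + B' + 1)))).
  rewrite mulrDl; apply: lerD; apply: (le_trans (gcs _ _)).
    by rewrite mulrC ler_pM// ltW// hN.
  by rewrite ler_pM// ltW// hM.
by rewrite mulrA ltr_pdivrMr// mulrC ltr_pM2l// ltrDl.
Qed.


Let rep_ip u w f f' : rep u f -> rep w f' ->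
  exists c, conv (fun n => g (u n) (w n)) c.
Proof.
move=> uf wf; apply: complex_cauchy.
have [B hB] := cauchy_bound wf.1; have [B' hB'] := cauchy_bound uf.1.
have B0 : 0 <= B := le_trans (sn_ge0 _) (hB 0%N).
have B0' : 0 <= B' := le_trans (sn_ge0 _) (hB' 0%N).
have BB : 0 < B + B' + 1 by rewrite ltr_wpDl// addr_ge0.
move=> e e0; have e1 : 0 < e / (B + B' + 1) by rewrite divr_gt0.
have [N hN] := uf.1 _ e1; have [M hM] := wf.1 _ e1.
exists (maxn N M) => n m; rewrite !geq_max => /andP[Nn Mn] /andP[Nm Mm].
have -> : g (u n) (w n) - g (u m) (w m) =
   g (sub (u n) (u m)) (w n) + g (u m) (sub (w n) (w m)).
  by rewrite gBl gBr; ring.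
apply: (le_lt_trans (ler_normD _ _)).
apply: (@le_lt_trans _ _ ((B + B') * (e / (B + B' + 1)))).
  rewrite mulrDl; apply: lerD; apply: (le_trans (gcs _ _)).
    by rewrite mulrC ler_pM// ltW// hN.
  by rewrite ler_pM// ltW// hM.
by rewrite mulrA ltr_pdivrMr// mulrC ltr_pM2l// ltrDl.
Qed.

Let rep_linear u w f f' a : rep u f -> rep w f' ->
  rep (fun n => lscale a (u n) ++ w n) (a *: f + f').
Proof.
move=> uf wf; split; last first.
  move=> x; apply: (eq_conv _ (conv_linear a (uf.2 x) (wf.2 x))) => n.
  by rewrite gDl gZl.
have a1 : 0 < `|a| + 1 by rewrite ltr_wpDl.
move=> e e0; have e1 : 0 < e / (`|a| + 1) by rewrite divr_gt0.
have [N hN] := uf.1 _ e1; have [M hM] := wf.1 _ e1.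
exists (maxn N M) => n m; rewrite !geq_max => /andP[Nn Mn] /andP[Nm Mm].
have -> : sn (sub (lscale a (u n) ++ w n) (lscale a (u m) ++ w m)) =
   sn (lscale a (sub (u n) (u m)) ++ sub (w n) (w m)).
  by rewrite /sn; congr sqrtC; rewrite !(gDl, gDr, gZl, gZr) rmorphN rmorph1; ring.
apply: (le_lt_trans (snD _ _)); rewrite snZ.
apply: (@lt_le_trans _ _ (`|a| * (e / (`|a| + 1)) + e / (`|a| + 1))).
  by rewrite ler_ltD ?hM// ler_wpM2l// ltW// hN.
by rewrite -[X in _ + X]mul1r -mulrDl mulrC mulfVK// gt_eqF.
Qed.

Let rep_cst l : rep (fun=> l) (fun x => g l [:: (1, x)]).
Proof.
split; last by move=> x; exact: conv_cst.
move=> e e0; exists 0%N => n m _ _; rewrite /sn gBl !gBr.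
by rewrite subrr sqrtC0.
Qed.

Definition rkhs_pred : {pred (X -> C)} := fun f => `[< exists u, rep u f >].

Record rkhs := Rkhs { rkhs_fun :> X -> C ; _ : rkhs_fun \in rkhs_pred }.

Fact rkhs_pred_submod : submod_closed rkhs_pred.
Proof.
split=> [|a f f' /asboolP[u uf] /asboolP[w wf]]; apply/asboolP.
  exists (fun=> [::]); have := rep_cst [::].
  by congr (rep _ _); apply/funext => x; rewrite /g /gram big_nil.
by exists (fun n => lscale a (u n) ++ w n); exact: rep_linear.
Qed.

HB.instance Definition _ := GRing.isSubmodClosed.Build C (X -> C) rkhs_pred
  rkhs_pred_submod.
HB.instance Definition _ := [isSub for rkhs_fun].
HB.instance Definition _ := [Choice of rkhs by <:].
HB.instance Definition _ := [SubChoice_isSubLmodule of rkhs by <:].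

Implicit Types f h : rkhs.

Let rkhs_funP a f f' : rkhs_fun (a *: f + f') = a *: rkhs_fun f + rkhs_fun f'.
Proof. by []. Qed.

Let rep_lin u w f f' a : rep u f -> rep w f' ->
  rep (fun n => lscale a (u n) ++ w n) (rkhs_fun (a *: f + f')).
Proof. by rewrite rkhs_funP; exact: rep_linear. Qed.

Let repE f : exists u, rep u f.
Proof. by case: f => f /= /asboolP. Qed.

Definition rkhs_rep f := projT1 (cid (repE f)).

Let rkhs_repP f : rep (rkhs_rep f) f.
Proof. exact: projT2 (cid (repE f)). Qed.

Definition rkhs_inner f h : C := projT1 (cid (rep_ip (rkhs_repP f) (rkhs_repP h))).

Let rkhs_innerP u w f h : rep u f -> rep w h ->
  conv (fun n => g (u n) (w n)) (rkhs_inner f h).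
Proof.
move=> uf wh; apply: (rep_conv (rkhs_repP f) uf (rkhs_repP h) wh).
exact: projT2 (cid _).
Qed.

Let rkhs_inner_linearl h : linear_for *%R (rkhs_inner ^~ h).
Proof.
move=> a f f'; have H := rkhs_repP.
have c1 := conv_linear a (rkhs_innerP (H f) (H h)) (rkhs_innerP (H f') (H h)).
have c2 := rkhs_innerP (rep_lin a (H f) (H f')) (H h).
by apply: (conv_uniq c2); apply: eq_conv c1 => n; rewrite gDl gZl.
Qed.

Let rkhs_inner_herm f h : rkhs_inner f h = (-1) ^+ false * (rkhs_inner h f)^*.
Proof.
rewrite expr0 mul1r; have H := rkhs_repP.
apply: (conv_uniq (rkhs_innerP (H f) (H h))).
by apply: (eq_conv _ (conv_conj (rkhs_innerP (H h) (H f)))) => n; rewrite -gC.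
Qed.

Let rkhs_inner_linearr f : linear_for (Num.conj \; *%R) (rkhs_inner f).
Proof.
move=> a h h'; rewrite rkhs_inner_herm expr0 mul1r rkhs_inner_linearl.
rewrite rmorphD rmorphM/= (rkhs_inner_herm f h) (rkhs_inner_herm f h').
by rewrite expr0 !mul1r.
Qed.

Let rkhs_inner_ge0 f : 0 <= rkhs_inner f f.
Proof.
by apply: (conv_ge0 (rkhs_innerP (rkhs_repP f) (rkhs_repP f))) => n; exact: g0.
Qed.

Let rkhs_cs f h : `|rkhs_inner f h| ^+ 2 <= rkhs_inner f f * rkhs_inner h h.
Proof.
apply: psd_cauchy_schwarz => // t; have := rkhs_inner_ge0 (t *: h + f).
rewrite rkhs_inner_linearl !rkhs_inner_linearr/= (rkhs_inner_herm h f) expr0 mul1r.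
by congr (0 <= _); ring.
Qed.

Definition rkhs_norm f : C := sqrtC (rkhs_inner f f).

Let rkhs_normK f : rkhs_norm f ^+ 2 = rkhs_inner f f.
Proof. exact: sqrtCK. Qed.

Let rkhs_norm_ge0 f : 0 <= rkhs_norm f.
Proof. by rewrite sqrtC_ge0. Qed.

Let rkhs_normD f h : rkhs_norm (f + h) <= rkhs_norm f + rkhs_norm h.
Proof.
have E : rkhs_inner (f + h) (f + h) =
   rkhs_inner f f + rkhs_inner h h + (rkhs_inner f h + (rkhs_inner f h)^*).
  have := rkhs_inner_linearl (f + h) 1 f h; rewrite scale1r mul1r => ->.
  have lr f' : rkhs_inner f' (f + h) = rkhs_inner f' f + rkhs_inner f' h.
    by have := rkhs_inner_linearr f' 1 f h; rewrite scale1r /= rmorph1 mul1r.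
  by rewrite !lr (rkhs_inner_herm h f) expr0 mul1r; ring.
by rewrite /rkhs_norm E; apply: sqrtC_triangle => //; rewrite -E.
Qed.

Let rkhs_normZ (a : C) f : rkhs_norm (a *: f) = `|a| * rkhs_norm f.
Proof.
apply/eqP; rewrite -(@eqrXn2 _ 2) ?mulr_ge0// exprMn !rkhs_normK.
have i0l h : rkhs_inner 0 h = 0.
  by have := rkhs_inner_linearl h (-1) 0 0; rewrite scaler0 addr0 mulN1r addNr.
have i0r h : rkhs_inner h 0 = 0 by rewrite rkhs_inner_herm i0l rmorph0 mulr0.
have := rkhs_inner_linearl (a *: f) a f 0; rewrite addr0 i0l addr0 => ->.
have := rkhs_inner_linearr f a f 0; rewrite addr0 i0r addr0/= => ->.
by rewrite mulrA normCK.
Qed.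

Definition rkhs_lift l : rkhs :=
  Rkhs (asboolT (ex_intro (fun u => rep u _) _ (rep_cst l))).

Let rkhs_norm_lift l : rkhs_norm (rkhs_lift l) = sn l.
Proof.
congr sqrtC; have c := @rkhs_innerP _ _ (rkhs_lift l) (rkhs_lift l) (rep_cst l) (rep_cst l).
exact: (conv_uniq c (conv_cst _)).
Qed.

Let rkhs_eval f l : rkhs_inner f (rkhs_lift l) = ev f l.
Proof.
have c := @rkhs_innerP _ _ f (rkhs_lift l) (rkhs_repP f) (rep_cst l).
exact: (conv_uniq c (rep_ev l (rkhs_repP f))).
Qed.

Let rkhs_norm_eq0 f : rkhs_norm f = 0 -> f = 0.
Proof.
move=> /(congr1 (fun z => z ^+ 2)); rewrite rkhs_normK expr0n/= => f0.
apply/val_inj/funext => x /=.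
have := rkhs_cs f (rkhs_lift [:: (1, x)]).
rewrite f0 mul0r rkhs_eval /ev big_seq1/= rmorph1 mul1r.
by rewrite -normrX normr_le0 sqrf_eq0 => /eqP.
Qed.

HB.instance Definition _ :=
  Lmodule_isNormed.Build C rkhs rkhs_normD rkhs_normZ rkhs_norm_eq0.


Let norm_rkhs f : `|f| = rkhs_norm f. Proof. by []. Qed.

Let rkhs_lift_approx u f : rep u f -> forall e, 0 < e ->
  exists N, forall n, (N <= n)%N -> `|f - rkhs_lift (u n)| < e.
Proof.
move=> uf e e0; have e20 : 0 < e / 2 by rewrite divr_gt0.
have [N hN] := uf.1 _ e20; exists N => n Nn.
have c : conv (fun m => g (sub (u (m + N)%N) (u n)) (sub (u (m + N)%N) (u n)))
     (rkhs_inner (f - rkhs_lift (u n)) (f - rkhs_lift (u n))).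
  have uN : rep (fun m => u (m + N)%N) f.
    split=> [d d0|x d d0].
      have [M hM] := uf.1 _ d0; exists M => i j Mi Mj.
      by apply: hM; [apply: leq_trans Mi _|apply: leq_trans Mj _]; exact: leq_addr.
    have [M hM] := uf.2 x _ d0; exists M => i Mi.
    by apply: hM; apply: leq_trans Mi _; exact: leq_addr.
  have r : rep (fun m => sub (u (m + N)%N) (u n)) (rkhs_fun (f - rkhs_lift (u n))).
    have := @rep_lin _ _ (rkhs_lift (u n)) f (-1) (rep_cst (u n)) uN.
    rewrite scaleN1r addrC => -[ca cw]; split.
      move=> d /ca[M hM]; exists M => i j Mi Mj; have := hM _ _ Mi Mj.
      congr (_ < _); rewrite /sn; congr sqrtC.
      by rewrite !(gDl, gDr, gZl, gZr) rmorphN rmorph1; ring.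
    by move=> x; apply: eq_conv (cw x) => m; rewrite !(gDl, gZl) addrC.
  exact: (rkhs_innerP r r).
rewrite -(@ltr_pXn2r _ 2) ?nnegrE ?(ltW e0)// norm_rkhs rkhs_normK.
have {}c := conv_linear (-1) c (conv_cst ((e / 2) ^+ 2)).
have : 0 <= -1 * rkhs_inner (f - rkhs_lift (u n)) (f - rkhs_lift (u n)) + (e / 2) ^+ 2.
  apply: (conv_ge0 c) => m; rewrite mulN1r addrC subr_ge0 -sn2.
  by rewrite lerXn2r ?nnegrE// ?(ltW e20)// ltW// hN// leq_addl.
rewrite mulN1r addrC subr_ge0 => /le_lt_trans; apply.
rewrite expr_div_n ltr_pdivrMr ?exprn_gt0// ltr_pMr ?exprn_gt0//.
by rewrite exprn_egt1// ltr1n.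
Qed.

Let rkhs_lift_sub l l' : `|rkhs_lift l - rkhs_lift l'| = sn (sub l l').
Proof.
rewrite -rkhs_norm_lift norm_rkhs; congr rkhs_norm.
apply/val_inj/funext => x /=.
by rewrite gBl.
Qed.

(** Centres [phi n] of balls of radius [1 / (n + 1)] in [F] are replaced by combinations [l n] at
    most as far away. The sequence [l] is itself a Cauchy representative, so its function of limits
    is already a point of the space. *)
Let rkhs_complete (F : set_system rkhs) : ProperFilter F -> cauchy F -> cvg F.
Proof.
move=> FF /cauchyP Fex.
have /choice[phi Fphi] n : exists f, F (ball f (n.+1%:R^-1)) by apply: Fex; exact: invS_gt0.
have /choice[l hl] n : exists l, `|phi n - rkhs_lift l| < n.+1%:R^-1.
  have [N /(_ N (leqnn _)) hN] := rkhs_lift_approx (rkhs_repP (phi n)) (invS_gt0 R n).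
  by exists (rkhs_rep (phi n) N).
have close n m : `|phi n - phi m| < n.+1%:R^-1 + m.+1%:R^-1.
  have [h [hn hm]] := @filter_ex _ F _ _ (filterI (Fphi n) (Fphi m)).
  rewrite -!ball_normE/= in hn hm.
  have -> : phi n - phi m = (phi n - h) - (phi m - h) by rewrite opprB addrA subrK.
  by apply: (le_lt_trans (ler_normB _ _)); rewrite ltrD.
have cl : cauchy_rep l.
  move=> e e0; have e4 : 0 < e / 2 / 2 by rewrite !divr_gt0.
  have [N hN] := inv_small e4; exists N => n m Nn Nm.
  rewrite -rkhs_lift_sub.
  have -> : rkhs_lift (l n) - rkhs_lift (l m) =
    (phi n - phi m) + ((phi m - rkhs_lift (l m)) - (phi n - rkhs_lift (l n))).
    by rewrite opprB addrA subrKA [RHS]addrC subrKA.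
  apply: (le_lt_trans (ler_normD _ _)); rewrite (splitr e) ltrD//.
    by apply: (lt_trans (close _ _)); rewrite (splitr (e / 2)) ltrD ?hN.
  apply: (le_lt_trans (ler_normB _ _)); rewrite (splitr (e / 2)) ltrD//.
    exact: lt_trans (hl _) (hN _ Nm).
  exact: lt_trans (hl _) (hN _ Nn).
have /choice[f hf] x : exists c, conv (fun n => g (l n) [:: (1, x)]) c.
  apply: complex_cauchy => e e0; have s1 : 0 < sn [:: (1, x)] + 1 by rewrite ltr_wpDl.
  have e1 : 0 < e / (sn [:: (1, x)] + 1) by rewrite divr_gt0.
  have [N hN] := cl _ e1; exists N => n m Nn Nm; rewrite -gBl.
  apply: (le_lt_trans (gcs _ _)).
  apply: (@le_lt_trans _ _ (e / (sn [:: (1, x)] + 1) * sn [:: (1, x)])).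
    by rewrite ler_wpM2r// ltW// hN.
  by rewrite mulrAC ltr_pdivrMr// ltr_pM2l// ltrDl.
have rf : rep l f by [].
pose f' : rkhs := Rkhs (asboolT (ex_intro (fun u => rep u _) _ rf)).
apply/cvg_ex; exists f'; apply/cvgrPdist_lt => e e0.
have e4 : 0 < e / 2 / 2 by rewrite !divr_gt0.
have e2 : 0 < e / 2 by rewrite divr_gt0.
have [N hN] := inv_small e4; have [M hM] := rkhs_lift_approx (f := f') rf e2.
pose n := maxn N M; apply: (@filterS _ F _ _ _ _ (Fphi n)) => h.
rewrite -ball_normE/= => hh.
have -> : f' - h = (f' - rkhs_lift (l n)) + ((phi n - h) - (phi n - rkhs_lift (l n))).
  by rewrite opprB [(phi n - h) + _]addrC !subrKA.
apply: (le_lt_trans (ler_normD _ _)); rewrite (splitr e) ltrD//.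
  by apply: hM; exact: leq_maxr.
have hn := hN n (leq_maxl _ _).
apply: (le_lt_trans (ler_normB _ _)); rewrite (splitr (e / 2)) ltrD//.
  exact: lt_trans hh hn.
exact: lt_trans (hl _) hn.
Qed.

HB.instance Definition _ := Uniform_isComplete.Build rkhs rkhs_complete.

HB.instance Definition _ := bilinear_isBilinear.Build C rkhs rkhs C *%R
  (Num.conj \; *%R) rkhs_inner (rkhs_inner_linearl, rkhs_inner_linearr).

HB.instance Definition _ := isHermitianSesquilinear.Build C rkhs false Num.conj
  rkhs_inner rkhs_inner_herm.

Let sqr_norm_rkhs f : `|f| ^+ 2 = rkhs_inner f f.
Proof. by rewrite norm_rkhs rkhs_normK. Qed.

Let rkhs_inner_gt0 f : f != 0 -> 0 < rkhs_inner f f.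
Proof. by move=> f0; rewrite -sqr_norm_rkhs exprn_gt0// normr_gt0. Qed.

HB.instance Definition _ := isDotProduct.Build C rkhs rkhs_inner rkhs_inner_gt0.

Definition rkhs_point x : rkhs := rkhs_lift [:: (1, x)].

Let rkhs_liftE l : rkhs_lift l = lcomb rkhs_point l.
Proof.
elim: l => [|p l ih].
  by rewrite lcomb_nil; apply/val_inj/funext => x; rewrite /= /g /gram big_nil.
rewrite /lcomb big_cons -/(lcomb _ _) -ih; apply/val_inj/funext => x /=.
rewrite -[p :: l]cat1s gDl; congr (_ + _).
by rewrite -[RHS]gZl /lscale/= mulr1; case: p {ih}.
Qed.

Let rkhs_lift_total f e : 0 < e -> exists l, `|f - lcomb rkhs_point l| < e.
Proof.
move=> e0; have [N /(_ N (leqnn _)) hN] := rkhs_lift_approx (rkhs_repP f) e0.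
by exists (rkhs_rep f N); rewrite -rkhs_liftE.
Qed.

Let rkhs_point_inner x y : rkhs_inner (rkhs_point x) (rkhs_point y) = k x y.
Proof.
rewrite rkhs_eval /ev big_seq1/= rmorph1 mul1r /g /gram !big_seq1/=.
by rewrite rmorph1 !mul1r.
Qed.

Let rat_dense (a e : C) : 0 < e -> exists q : rat * rat,
  `|a - ((ratr q.1 : R) +i* ratr q.2)%C| < e.
Proof.
move=> /complex_gt0E[-> e0]; have e20 : 0 < complex.Re e / 2 by rewrite divr_gt0.
have approx (t : R) : exists q : rat, `|t - ratr q| < complex.Re e / 2.
  have [|q /andP[]] := @rat_in_itvoo _ (t - complex.Re e / 2) (t + complex.Re e / 2).
    by rewrite ltrD2l gtrN.
  rewrite !bnd_simp => h1 h2; exists q.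
  by rewrite ltr_distlC; apply/andP; split.
have [q1 h1] := approx (complex.Re a); have [q2 h2] := approx (complex.Im a).
exists (q1, q2); apply: (le_lt_trans (norm_le_Re_Im _)).
rewrite ltcR (splitr (complex.Re e)); move: h1 h2; case: a => a b /= *.
by rewrite ltrD.
Qed.

Let rkhs_separable : exists2 D : set rkhs, countable D & dense D.
Proof.
have [D hD] := ker_sep k.
have hD' x e : 0 < e -> exists n, `|rkhs_point x - rkhs_point (D n)| < e.
  move=> e0; have [n hn] := hD x _ (exprn_gt0 2 e0); exists n.
  rewrite -(@ltr_pXn2r _ 2) ?nnegrE ?(ltW e0)//; move: hn; congr (_ < _).
  rewrite sqr_norm_rkhs.
  have -> : rkhs_inner (rkhs_point x - rkhs_point (D n))
     (rkhs_point x - rkhs_point (D n)) =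
     rkhs_inner (rkhs_point x) (rkhs_point x) - rkhs_inner (rkhs_point x) (rkhs_point (D n))
     - rkhs_inner (rkhs_point (D n)) (rkhs_point x)
     + rkhs_inner (rkhs_point (D n)) (rkhs_point (D n)).
    by rewrite linearBl !linearBr/=; ring.
  by rewrite !rkhs_point_inner.
(* Combinations with Gaussian rational coefficients of the countably many points given by
   [ker_sep]. *)
pose q (s : seq ((rat * rat) * nat)) : rkhs :=
  \sum_(p <- s) ((ratr p.1.1 : R) +i* ratr p.1.2)%C *: rkhs_point (D p.2).
exists (range q); first exact: (sub_countable (card_image_le q _) (countableP _)).
have appr l e : 0 < e -> exists s, `|lcomb rkhs_point l - q s| < e.
  elim: l e => [|p l ih] e e0.
    by exists [::]; rewrite lcomb_nil /q big_nil subrr normr0.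
  have e2 : 0 < e / 2 by rewrite divr_gt0.
  have e4 : 0 < e / 2 / 2 by rewrite !divr_gt0.
  have [s hs] := ih _ e2.
  have p1 : 0 < `|p.1| + 1 by rewrite ltr_wpDl.
  have [n hn] := hD' p.2 _ (divr_gt0 e4 p1).
  have d1 : 0 < `|rkhs_point (D n)| + 1 by rewrite ltr_wpDl.
  have [r hr] := rat_dense p.1 (divr_gt0 e4 d1).
  exists ((r, n) :: s); rewrite /lcomb /q !big_cons -/(lcomb _ _) -/(q s)/=.
  set c := (_ +i* _)%C in hr *.
  rewrite opprD addrACA; apply: (le_lt_trans (ler_normD _ _)).
  rewrite (splitr e) ltrD//.
  have -> : p.1 *: rkhs_point p.2 - c *: rkhs_point (D n) =
    p.1 *: (rkhs_point p.2 - rkhs_point (D n)) + (p.1 - c) *: rkhs_point (D n).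
    by rewrite scalerBr scalerBl addrA subrK.
  apply: (le_lt_trans (ler_normD _ _)); rewrite !normrZ.
  rewrite (splitr (e / 2)) ltr_leD//.
    apply: (@le_lt_trans _ _ (`|p.1| * (e / 2 / 2 / (`|p.1| + 1)))).
      by rewrite ler_wpM2l// ltW.
    by rewrite mulrA ltr_pdivrMr// mulrC ltr_pM2l// ltrDl.
  apply: (@le_trans _ _ (e / 2 / 2 / (`|rkhs_point (D n)| + 1) * `|rkhs_point (D n)|)).
    by rewrite ler_wpM2r// ltW.
  by rewrite mulrAC ler_pdivrMr// ler_wpM2l ?(ltW e4)// lerDl.
move=> O [f Of]; rewrite openE => /(_ _ Of).
rewrite /interior -nbhs_ballE => -[e /= e0 eO].
have e20 : 0 < e / 2 by rewrite divr_gt0.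
have [l hl] := rkhs_lift_total f e20; have [s hs] := appr l _ e20.
exists (q s); split; last by exists s.
apply: eO; rewrite -ball_normE/=.
have -> : f - q s = (f - lcomb rkhs_point l) + (lcomb rkhs_point l - q s) by rewrite addrA subrK.
by apply: (le_lt_trans (ler_normD _ _)); rewrite (splitr e) ltrD.
Qed.

HB.instance Definition _ := isHilbert.Build R rkhs sqr_norm_rkhs rkhs_separable.

Lemma kernel_representation : exists (K : hilbertType R) (v : X -> K),
  (forall x y, inner (v x) (v y) = k x y) /\ total v.
Proof.
exists rkhs, rkhs_point; split; first exact: rkhs_point_inner.
by move=> f e; exact: rkhs_lift_total.
Qed.

End Rkhs.

(** * Path integrals and Cauchy's formula on the disc *)

Section ComplexPaths.
Context (R : realType).
Local Notation C := R[i].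
Local Notation mu := (@lebesgue_measure R).
Local Notation Re := (@complex.Re R).
Local Notation Im := (@complex.Im R).
Implicit Types (phi psi G H : R -> C) (x a b : R) (c v : C).

(** Componentwise, so that the mean value theorem and the fundamental theorem of calculus are
    applied to real functions only. *)
Definition path_derive G x v :=
  is_derive x 1 (Re \o G) (Re v) /\ is_derive x 1 (Im \o G) (Im v).

Definition path_cont phi x := forall e : C, 0 < e ->
  exists d : R, 0 < d /\ forall y, `|y - x| < d -> `|phi y - phi x| < e.

Lemma ReM c v : Re (c * v) = Re c * Re v - Im c * Im v.
Proof. by case: c v => [? ?] [? ?]. Qed.

Lemma ImM c v : Im (c * v) = Re c * Im v + Im c * Re v.
Proof. by case: c v => [? ?] [? ?]. Qed.

Lemma ReD c v : Re (c + v) = Re c + Re v.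
Proof. by case: c v => [? ?] [? ?]. Qed.

Lemma ImD c v : Im (c + v) = Im c + Im v.
Proof. by case: c v => [? ?] [? ?]. Qed.

Lemma path_derive_linear c G H x v v' : path_derive G x v -> path_derive H x v' ->
  path_derive (fun y => c * G y + H y) x (c * v + v').
Proof.
move=> [G1 G2] [H1 H2]; split.
  have -> : Re \o (fun y => c * G y + H y) =
     (Re c *: (Re \o G) - Im c *: (Im \o G) + (Re \o H)) :> (R -> R).
    by apply/funext => y /=; rewrite ReD ReM.
  rewrite ReD ReM.
  have h := is_deriveD (is_deriveB (is_deriveZ (Re c) G1) (is_deriveZ (Im c) G2)) H1.
  exact: (is_derive_eq h).
have -> : Im \o (fun y => c * G y + H y) =
   (Re c *: (Im \o G) + Im c *: (Re \o G) + (Im \o H)) :> (R -> R).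
  by apply/funext => y /=; rewrite ImD ImM.
rewrite ImD ImM.
have h := is_deriveD (is_deriveD (is_deriveZ (Re c) G2) (is_deriveZ (Im c) G1)) H2.
exact: (is_derive_eq h).
Qed.

Lemma path_derive_cst c x : path_derive (fun=> c) x 0.
Proof. by split; exact: is_derive_cst. Qed.

Lemma path_deriveZ c G x v : path_derive G x v ->
  path_derive (fun y => c * G y) x (c * v).
Proof.
move=> dG; have := path_derive_linear c dG (path_derive_cst 0 x).
by rewrite addr0; under [X in path_derive X]funext do rewrite addr0.
Qed.

Lemma path_derive_real (f : R -> R) x (d : R) : is_derive x 1 f d ->
  path_derive (fun y => (f y)%:C%C) x d%:C%C.
Proof. by move=> df; split => //=; exact: is_derive_cst. Qed.

(** The mean value theorem fails for complex values; it is applied to the real part of [u G], where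
    the unit number [u] rotates the increment of [G] onto the positive axis. *)
Lemma path_derive_bound G phi a b (M : C) : a <= b ->
  (forall x, a <= x <= b -> path_derive G x (phi x)) ->
  (forall x, a <= x <= b -> `|phi x| <= M) ->
  `|G b - G a| <= M * (b - a)%:C%C.
Proof.
move=> ab dG bM; set D := G b - G a.
have M0 : 0 <= M by apply: le_trans (bM a _); rewrite ?normr_ge0 ?lexx.
have [->|D0] := eqVneq D 0; first by rewrite normr0 mulr_ge0// ler0c subr_ge0.
pose u := D^* / `|D|.
have nD : `|D| != 0 by rewrite normr_eq0.
have uD : u * D = `|D| by rewrite /u mulrAC [D^* * D]mulrC -normCK expr2 mulfK.
have nu : `|u| = 1 by rewrite normrM norm_conjC normfV normr_id divff.
have du x : a <= x <= b -> is_derive x 1 (Re \o (fun y => u * G y)) (Re (u * phi x)).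
  by move=> /dG dx; exact: (path_deriveZ u dx).1.
have [||t tab] := @MVT_segment R (Re \o (fun y => u * G y)) (fun x => Re (u * phi x)) a b ab.
- move=> x; rewrite in_itv/= => /andP[ax xb]; apply: du; by rewrite !ltW.
- apply: derivable_within_continuous => x; rewrite in_itv/= => xab.
  by have := du _ xab; case.
move=> /=; rewrite -[Re (u * G b) - _]/(_ + - _).
have -> : Re (u * G b) - Re (u * G a) = Re (u * D).
  by rewrite /D mulrBr; case: (u * G b) (u * G a) => [? ?] [? ?].
rewrite uD => h.
have -> : `|D| = (Re (`|D|))%:C%C by rewrite RRe_real// normr_real.
rewrite h rmorphM/= ler_wpM2r// ?ler0c ?subr_ge0//.
apply: (@le_trans _ _ `|(u * phi t)|); last first.
  by rewrite normrM nu mul1r bM//; rewrite in_itv in tab.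
by apply: le_trans (normc_ge_Re _); rewrite lecR ler_norm.
Qed.

Lemma path_cont_Re phi x : path_cont phi x -> {for x, continuous (Re \o phi)}.
Proof.
move=> cp; apply/cvgrPdist_lt => e e0.
have [|d [d0 hd]] := cp e%:C%C; first by rewrite ltcR.
near=> y; rewrite -ltcR; apply: (@le_lt_trans _ _ `|phi y - phi x|).
  rewrite distrC; apply: le_trans (normc_ge_Re _).
  by rewrite /=; case: (phi y) (phi x) => [? ?] [? ?].
by apply: hd; rewrite distrC; near: y; exact: cvgr_dist_lt.
Unshelve. all: by end_near. Qed.

Lemma path_cont_Im phi x : path_cont phi x -> {for x, continuous (Im \o phi)}.
Proof.
move=> cp; apply/cvgrPdist_lt => e e0.
have [|d [d0 hd]] := cp e%:C%C; first by rewrite ltcR.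
near=> y; rewrite -ltcR; apply: (@le_lt_trans _ _ `|phi y - phi x|).
  rewrite distrC; apply: le_trans (normc_ge_Im _).
  by rewrite /=; case: (phi y) (phi x) => [? ?] [? ?].
by apply: hd; rewrite distrC; near: y; exact: cvgr_dist_lt.
Unshelve. all: by end_near. Qed.

Lemma real_primitive (f : R -> R) (m : R) : continuous f ->
  exists F : R -> R, forall x, m < x -> is_derive x 1 F (f x).
Proof.
move=> cf; exists (fun x => \int[mu]_(t in [set` `[m, x]]) (f t))%R => x mx.
have [||||d df] := @continuous_FTC1_closed R f m x (x + 1).
- by rewrite ltrDl.
- apply: continuous_compact_integrable; first exact: segment_compact.
  exact: continuous_subspaceT.
- exact: mx.
- exact: cf.
by apply: DeriveDef; [exact: d|rewrite -derive1E; exact: df].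
Qed.

Lemma path_primitive phi m : (forall x, path_cont phi x) ->
  exists G, forall x, m < x -> path_derive G x (phi x).
Proof.
move=> cp.
have [F hF] := real_primitive m (fun x => path_cont_Re (cp x)).
have [F' hF'] := real_primitive m (fun x => path_cont_Im (cp x)).
by exists (fun x => F x +i* F' x)%C => x mx; split; [exact: hF|exact: hF'].
Qed.

(** The increment of an arbitrary primitive, with default [0] if there is none. Linearity,
    additivity and conjugation thus reduce to rules for derivatives, and [path_intE] gives
    independence of the primitive. *)
Definition path_int phi a b : C := xget 0 [set v |
  exists G, (forall x, a <= x <= b -> path_derive G x (phi x)) /\ v = G b - G a].

Lemma path_intE phi G a b : a <= b ->
  (forall x, a <= x <= b -> path_derive G x (phi x)) ->
  path_int phi a b = G b - G a.
Proof.
move=> ab dG; rewrite /path_int; case: xgetP => [v _ [H [dH ->]]|]; last first.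
  by move=> /(_ (G b - G a)) []; exists G.
apply/eqP; rewrite -subr_eq0 -normr_le0.
have -> : H b - H a - (G b - G a) =
   (-1 * G b + H b) - (-1 * G a + H a) by ring.
rewrite -[leRHS](mul0r (b - a)%:C%C).
apply: (@path_derive_bound (fun y => -1 * G y + H y) (fun y => -1 * phi y + phi y)) => // x xab.
  by apply: path_derive_linear; [exact: dG|exact: dH].
by rewrite mulN1r addNr normr0.
Qed.

Lemma path_int_ex phi a : (forall x, path_cont phi x) ->
  exists G, (forall x, a <= x -> path_derive G x (phi x)) /\
    forall x y, a <= x -> x <= y -> path_int phi x y = G y - G x.
Proof.
(* Starting left of [a] makes the derivative two-sided at [a] itself. *)
move=> /(path_primitive (a - 1))[G hG].
have hG' x : a <= x -> path_derive G x (phi x).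
  by move=> ax; apply: hG; apply: lt_le_trans ax; rewrite gtrBl.
exists G; split => // x y ax xy; apply: path_intE => // z /andP[xz _].
by apply: hG'; exact: le_trans ax xz.
Qed.

Lemma path_int_chasles phi a b x : (forall x, path_cont phi x) -> a <= b -> b <= x ->
  path_int phi a x = path_int phi a b + path_int phi b x.
Proof.
move=> cp ab bx; have [G [_ hG]] := path_int_ex a cp.
by rewrite !hG ?lexx// ?(le_trans ab bx)//; ring.
Qed.

Lemma path_int_linear c phi psi a b : a <= b ->
  (forall x, path_cont phi x) -> (forall x, path_cont psi x) ->
  path_int (fun x => c * phi x + psi x) a b = c * path_int phi a b + path_int psi a b.
Proof.
move=> ab cp cq; have [G [dG hG]] := path_int_ex a cp.
have [H [dH hH]] := path_int_ex a cq; rewrite hG// hH//.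
rewrite (@path_intE _ (fun x => c * G x + H x))//; first by ring.
by move=> x /andP[ax _]; apply: path_derive_linear; [exact: dG|exact: dH].
Qed.

Lemma path_int_bound phi a b (M : C) : a <= b -> (forall x, path_cont phi x) ->
  (forall x, a <= x <= b -> `|phi x| <= M) -> `|path_int phi a b| <= M * (b - a)%:C%C.
Proof.
move=> ab cp bM; have [G [dG ->]] := path_int_ex a cp => //.
by apply: path_derive_bound bM => // x /andP[ax _]; exact: dG.
Qed.

Lemma eq_path_int phi psi a b : (forall x, a <= x <= b -> phi x = psi x) ->
  path_int phi a b = path_int psi a b.
Proof.
move=> e; rewrite /path_int; congr xget; apply/seteqP.
split=> v [G [dG ->]]; exists G; split => // x xab.
  by rewrite -e//; exact: dG.
by rewrite e//; exact: dG.
Qed.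

Lemma path_int_conj phi a b : a <= b -> (forall x, path_cont phi x) ->
  path_int (fun x => (phi x)^*) a b = (path_int phi a b)^*.
Proof.
move=> ab cp; have [G [dG ->]] := path_int_ex a cp => //.
rewrite (@path_intE _ (fun x => (G x)^*)) ?rmorphB//.
move=> x /andP[/dG [d1 d2] _]; split.
  have -> : Re \o (fun x0 => (G x0)^*) = Re \o G by apply/funext => y /=; case: (G y).
  by case: (phi x) d1.
have -> : Im \o (fun x0 => (G x0)^*) = - (Im \o G).
  by apply/funext => y; rewrite -[RHS]/(- Im (G y)) /=; case: (G y).
have -> : Im (phi x)^* = - Im (phi x) by case: (phi x).
exact: is_deriveN.
Qed.

Lemma path_int_ge0 phi a b : a <= b -> (forall x, path_cont phi x) ->
  (forall x, 0 <= phi x) -> 0 <= path_int phi a b.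
Proof.
move=> ab cp p0; have [G [dG ->]] := path_int_ex a cp => //.
have im : Im (G b - G a) = 0.
  have := path_int_conj ab cp; have [G' [_ hG']] := path_int_ex a cp.
  under eq_path_int => x _.
    have -> : (phi x)^* = phi x by apply: CrealP; rewrite ger0_real.
    over.
  rewrite (path_intE ab (G := G)) => [/esym/CrealP|x /andP[]]; last by move=> /dG.
  by move=> /RIm_real; rewrite -[RHS]/(0%:C%C) => /complexI.
have [||t tab h] := @MVT_segment R (Re \o G) (Re \o phi) a b ab.
- by move=> x; rewrite in_itv/= => /andP[ax _]; exact: (dG _ (ltW ax)).1.
- apply: derivable_within_continuous => x; rewrite in_itv/= => /andP[ax _].
  by have := (dG _ ax).1; case.
have -> : G b - G a = (Re (G b) - Re (G a))%:C%C.
  rewrite [LHS]complexE im mulr0 addr0; congr (_ %:C%C).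
  by case: (G b) (G a) => [? ?] [? ?].
rewrite ler0c; move: h => /= ->; rewrite mulr_ge0 ?subr_ge0//.
have := p0 t; rewrite -{1}(RRe_real (ger0_real (p0 t))) ler0c //.
Qed.

Lemma path_derive_cont G x v : path_derive G x v -> path_cont G x.
Proof.
move=> [[d1 _] [d2 _]] e /complex_gt0E[-> e0].
have e20 : 0 < Re e / 2 by rewrite divr_gt0.
have c1 : {for x, continuous (Re \o G)}.
  by apply: differentiable_continuous; apply/derivable1_diffP; exact: d1.
have c2 : {for x, continuous (Im \o G)}.
  by apply: differentiable_continuous; apply/derivable1_diffP; exact: d2.
move/cvgrPdist_lt : c1 => /(_ _ e20)/nbhs_ballP[d /= d0 hd].
move/cvgrPdist_lt : c2 => /(_ _ e20)/nbhs_ballP[d' /= d'0 hd'].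
exists (Num.min d d'); split; first by rewrite lt_min d0.
move=> y; rewrite lt_min => /andP[yd yd'].
have yb r : `|y - x| < r -> ball x r y by rewrite -ball_normE/= distrC.
apply: (le_lt_trans (norm_le_Re_Im _)); rewrite ltcR (splitr (Re e)).
have := hd _ (yb _ yd); have := hd' _ (yb _ yd'); rewrite /=.
by case: (G y) (G x) => [? ?] [? ?] /= *; rewrite ltrD// distrC.
Qed.

Lemma path_contM phi psi x : path_cont phi x -> path_cont psi x ->
  path_cont (fun y => phi y * psi y) x.
Proof.
move=> cp cq e e0.
pose A : C := `|phi x|; pose B : C := `|psi x|.
have A0 : 0 <= A := normr_ge0 _; have B0 : 0 <= B := normr_ge0 _.
have K0 : 0 < A + B + 1 by rewrite ltr_wpDl// addr_ge0.
pose r := e / (A + B + 1 + e).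
have Ke : 0 < A + B + 1 + e by rewrite addr_gt0.
have r0 : 0 < r by rewrite divr_gt0.
have r1 : r <= 1 by rewrite ler_pdivrMr// mul1r lerDr ltW.
have rK : r * (A + B + 1) < e by rewrite /r mulrAC ltr_pdivrMr// ltr_pM2l// ltrDl.
have [d [d0 hd]] := cp _ r0; have [d' [d'0 hd']] := cq _ r0.
exists (Num.min d d'); split; first by rewrite lt_min d0.
move=> y; rewrite lt_min => /andP[/hd h1 /hd' h2].
have -> : phi y * psi y - phi x * psi x =
   (phi y - phi x) * (psi y - psi x) + phi x * (psi y - psi x) + psi x * (phi y - phi x).
  by ring.
apply: le_lt_trans rK.
have -> : r * (A + B + 1) = r * 1 + A * r + B * r by ring.
apply: (le_trans (ler_normD _ _)); rewrite lerD//.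
  apply: (le_trans (ler_normD _ _)); rewrite lerD// normrM; last by rewrite ler_wpM2l// ltW.
  by rewrite ler_pM ?(ltW h1)//; apply: le_trans (ltW h2) r1.
by rewrite normrM ler_wpM2l// ltW.
Qed.

Lemma path_contD phi psi x : path_cont phi x -> path_cont psi x ->
  path_cont (fun y => phi y + psi y) x.
Proof.
move=> cp cq e e0; have e20 : 0 < e / 2 by rewrite divr_gt0.
have [d [d0 hd]] := cp _ e20; have [d' [d'0 hd']] := cq _ e20.
exists (Num.min d d'); split; first by rewrite lt_min d0.
move=> y; rewrite lt_min => /andP[/hd h1 /hd' h2].
by rewrite opprD addrACA (le_lt_trans (ler_normD _ _))// (splitr e) ltrD.
Qed.

Lemma path_cont_cst c x : path_cont (fun=> c) x.
Proof. by move=> e e0; exists 1; split => // y _; rewrite subrr normr0. Qed.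

Lemma path_cont_conj phi x : path_cont phi x -> path_cont (fun y => (phi y)^*) x.
Proof.
move=> cp e /cp[d [d0 hd]]; exists d; split => // y /hd.
by rewrite -rmorphB norm_conjC.
Qed.

Lemma path_contV phi x : phi x != 0 -> path_cont phi x ->
  path_cont (fun y => (phi y)^-1) x.
Proof.
move=> p0 cp e e0; pose A : C := `|phi x|.
have A0 : 0 < A by rewrite normr_gt0.
have A2 : 0 < A / 2 by rewrite divr_gt0.
have r0 : 0 < e * (A / 2) * A by rewrite mulr_gt0// mulr_gt0.
have [d [d0 hd]] := cp _ A2; have [d' [d'0 hd']] := cp _ r0.
exists (Num.min d d'); split; first by rewrite lt_min d0.
move=> y; rewrite lt_min => /andP[/hd h1 /hd' h2].
have low : A / 2 < `|phi y|.
  rewrite -(ltrD2r (A / 2)) -splitr; apply: (@le_lt_trans _ _ (`|phi y| + `|phi y - phi x|)).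
    rewrite /A -[in leLHS](subKr (phi y) (phi x)).
    exact: ler_normB.
  by rewrite ltrD2l.
have y0 : phi y != 0 by rewrite -normr_gt0; exact: lt_trans low.
have -> : (phi y)^-1 - (phi x)^-1 = - (phi y - phi x) / (phi y * phi x) by field; rewrite y0 p0.
rewrite normrM normrN normfV normrM ltr_pdivrMr ?mulr_gt0 ?normr_gt0//.
apply: (lt_le_trans h2); rewrite -mulrA ler_wpM2l ?(ltW e0)//.
by apply: ler_pM; rewrite ?(ltW A2) ?(ltW A0) ?(ltW low).
Qed.

End ComplexPaths.

(** * Goursat's subdivision argument *)

Section Bisection.
Context (R : realType).
Local Notation C := R[i].

Lemma half_small (u d : R) : 0 <= u -> 0 < d -> exists N, forall n, (N <= n)%N -> u / 2 ^+ n < d.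
Proof.
move=> u0 d0; have u1 : 0 < u + 1 by rewrite ltr_wpDl.
have h1 : (0 : C) <= 2^-1 by rewrite invr_ge0.
have h2 : (2^-1 : C) < 1 by rewrite invf_lt1// ltr1n.
have h3 : 0 < (d / (u + 1))%:C%C :> C by rewrite ltcR divr_gt0.
have [N hN] := geom_small h1 h2 h3; exists N => n /hN.
have -> : (2^-1 : C) ^+ n = ((2^-1) ^+ n : R)%:C%C.
  by rewrite rmorphXn/= fmorphV/= rmorph_nat.
rewrite ltcR ltr_pdivlMr// exprVn => h.
apply: le_lt_trans h; rewrite mulrC ler_wpM2l ?invr_ge0 ?exprn_ge0//.
by rewrite lerDl.
Qed.

(* Goursat's argument: an additive function of rectangles that is [o] of the
   squared diameter vanishes. *)
Lemma bisection (I : R -> R -> R -> R -> C) :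
  (forall x y z s t, x <= y -> y <= z -> s <= t ->
     I x z s t = I x y s t + I y z s t) ->
  (forall x y r s t, x <= y -> r <= s -> s <= t ->
     I x y r t = I x y r s + I x y s t) ->
  (forall x0 y0 (e : C), 0 < e -> exists d : R, 0 < d /\
     forall x1 x2 y1 y2, x1 <= x0 <= x2 -> y1 <= y0 <= y2 ->
       x2 - x1 < d -> y2 - y1 < d ->
       `|I x1 x2 y1 y2| <= e * ((x2 - x1 + (y2 - y1)) ^+ 2)%:C%C) ->
  forall a b c d, a <= b -> c <= d -> I a b c d = 0.
Proof.
move=> H1 H2 loc a b c d ab cd.
apply: (@small_eq0 R (R[i]^o) _ ((b - a + (d - c)) ^+ 2)%:C%C) => e e0.
rewrite mulrC; apply: contrapT => bad.
pose u n : R := (b - a) / 2 ^+ n; pose v n : R := (d - c) / 2 ^+ n.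
have u0 n : 0 <= u n by rewrite divr_ge0 ?exprn_ge0// subr_ge0.
have v0 n : 0 <= v n by rewrite divr_ge0 ?exprn_ge0// subr_ge0.
have n2 n : (2 : R) ^+ n != 0 by rewrite expf_neq0// pnatr_eq0.
have uS n : u n = u n.+1 + u n.+1 by rewrite /u exprS; field.
have vS n : v n = v n.+1 + v n.+1 by rewrite /v exprS; field.
(* A rectangle of generation [n] with lower left corner [p]. The bound scales with the square of the
   half-perimeter, so four good quarters add up exactly to the bound for the whole. *)
pose Bad n (p : R * R) := ~ (`|I p.1 (p.1 + u n) p.2 (p.2 + v n)| <=
   e * ((u n + v n) ^+ 2)%:C%C).
have step (np : nat * (R * R)) : exists q : R * R, Bad np.1 np.2 ->
    [/\ Bad np.1.+1 q, np.2.1 <= q.1, q.1 + u np.1.+1 <= np.2.1 + u np.1,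
        np.2.2 <= q.2 & q.2 + v np.1.+1 <= np.2.2 + v np.1].
  case: np => n [x y] /=; apply: contrapT => hno.
  have good x' y' : x <= x' -> x' + u n.+1 <= x + u n -> y <= y' ->
      y' + v n.+1 <= y + v n ->
      `|I x' (x' + u n.+1) y' (y' + v n.+1)| <= e * ((u n.+1 + v n.+1) ^+ 2)%:C%C.
    move=> h1 h2 h3 h4; apply: contrapT => bad'; apply: hno.
    by exists (x', y').
  (* If no quarter is bad the rectangle is good, so the implication to be proved has a false premise
     and any witness serves. *)
  apply: hno; exists (x, y) => hb; exfalso; apply: hb => /=.
  have xu : x <= x + u n.+1 by rewrite lerDl.
  have yv : y <= y + v n.+1 by rewrite lerDl.
  have xu' : x + u n.+1 <= x + u n by rewrite lerD2l (uS n) lerDl.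
  have yv' : y + v n.+1 <= y + v n by rewrite lerD2l (vS n) lerDl.
  rewrite (H1 _ (x + u n.+1))// ?(le_trans yv)//.
  rewrite (H2 x _ _ (y + v n.+1))// (H2 (x + u n.+1) _ _ (y + v n.+1))//.
  have ex : x + u n = x + u n.+1 + u n.+1 by rewrite (uS n) addrA.
  have ey : y + v n = y + v n.+1 + v n.+1 by rewrite (vS n) addrA.
  have xu2 : x + u n.+1 + u n.+1 <= x + u n by rewrite ex.
  have yv2 : y + v n.+1 + v n.+1 <= y + v n by rewrite ey.
  have g1 := good x y (lexx _) xu' (lexx _) yv'.
  have g2 := good x (y + v n.+1) (lexx _) xu' yv yv2.
  have g3 := good (x + u n.+1) y xu xu2 (lexx _) yv'.
  have g4 := good (x + u n.+1) (y + v n.+1) xu xu2 yv yv2.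
  rewrite ex ey.
  have -> : e * ((u n + v n) ^+ 2)%:C%C = e * ((u n.+1 + v n.+1) ^+ 2)%:C%C +
     e * ((u n.+1 + v n.+1) ^+ 2)%:C%C + (e * ((u n.+1 + v n.+1) ^+ 2)%:C%C +
     e * ((u n.+1 + v n.+1) ^+ 2)%:C%C).
    have -> : (u n + v n) ^+ 2 = (u n.+1 + v n.+1) ^+ 2 *+ 4.
      by rewrite (uS n) (vS n); ring.
    by rewrite rmorphMn/=; ring.
  apply: (le_trans (ler_normD _ _)); rewrite lerD//.
    by apply: (le_trans (ler_normD _ _)); rewrite lerD.
  by apply: (le_trans (ler_normD _ _)); rewrite lerD.
have [nx hnx] := choice step.
pose s := fix s n := if n is m.+1 then nx (m, s m) else (a, c).
have sb n : Bad n (s n).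
  elim: n => [|n ih]; last by have [] := hnx (n, s n) ih.
  by rewrite /Bad /= /u /v !expr0 !divr1 !subrKC.
have s1 n : (s n).1 <= (s n.+1).1 by have [] := hnx (n, s n) (sb n).
have s1' n : (s n.+1).1 + u n.+1 <= (s n).1 + u n by have [] := hnx (n, s n) (sb n).
have s2 n : (s n).2 <= (s n.+1).2 by have [] := hnx (n, s n) (sb n).
have s2' n : (s n.+1).2 + v n.+1 <= (s n).2 + v n by have [] := hnx (n, s n) (sb n).
have nested (l w : nat -> R) : (forall n, l n <= l n.+1) ->
    (forall n, l n.+1 + w n.+1 <= l n + w n) -> (forall n, 0 <= w n) ->
    exists x0, forall n, l n <= x0 <= l n + w n.
  move=> lS wS w0.
  have lm n m : (n <= m)%N -> l n <= l m.
    by move=> /subnKC <-; elim: (m - n)%N => [|j ih]; rewrite ?addn0// addnS (le_trans ih).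
  have wm n m : (n <= m)%N -> l m + w m <= l n + w n.
    by move=> /subnKC <-; elim: (m - n)%N => [|j ih]; rewrite ?addn0// addnS (le_trans _ ih).
  have ub n : ubound (range l) (l n + w n).
    move=> _ [m _ <-]; have [mn|nm] := leqP m n.
      by apply: (le_trans (lm _ _ mn)); rewrite lerDl.
    by apply: le_trans (wm _ _ (ltnW nm)); rewrite lerDl.
  exists (sup (range l)) => n; apply/andP; split.
    apply: ub_le_sup; last by exists n.
    by exists (l 0%N + w 0%N); exact: ub.
  by apply: ge_sup; [exists (l 0%N), 0%N|exact: ub].
have [x0 hx] := nested (fun n => (s n).1) u s1 s1' u0.
have [y0 hy] := nested (fun n => (s n).2) v s2 s2' v0.
have [dl [dl0 hl]] := loc x0 y0 e e0.
have [|N hN] := @half_small (b - a) dl _ dl0; first by rewrite subr_ge0.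
have [|M hM] := @half_small (d - c) dl _ dl0; first by rewrite subr_ge0.
have := hl _ _ _ _ (hx (maxn N M)) (hy (maxn N M)).
rewrite ![_ + u _ - _]addrAC ![_ + v _ - _]addrAC !subrr !add0r.
move=> /(_ (hN _ (leq_maxl _ _)) (hM _ (leq_maxr _ _))) h.
exact: (sb (maxn N M) h).
Qed.

End Bisection.

(** * Complex derivatives and exponentials on the circle *)

Section CauchyFormula.
Context (R : realType).
Local Notation C := R[i].
Local Notation Re := (@complex.Re R).
Local Notation Im := (@complex.Im R).
Implicit Types (f g : C -> C) (z w D : C).

Definition complex_derive f z D := forall e : C, 0 < e ->
  exists d : C, 0 < d /\ forall w, `|w - z| < d ->
    `|f w - f z - D * (w - z)| <= e * `|w - z|.

Definition disc_holomorphic f := forall z, `|z| < 1 -> exists D, complex_derive f z D.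

Lemma complex_derive_lip f z D : complex_derive f z D ->
  exists d : C, 0 < d /\ forall w, `|w - z| < d -> `|f w - f z| <= (`|D| + 1) * `|w - z|.
Proof.
move=> /(_ _ ltr01)[d [d0 hd]]; exists d; split => // w /hd h.
rewrite -[f w - f z](subrK (D * (w - z))) mulrDl addrC.
by apply: (le_trans (ler_normD _ _)); rewrite normrM lerD2l.
Qed.

Lemma path_cont_comp f (phi : R -> C) x D : complex_derive f (phi x) D ->
  path_cont phi x -> path_cont (fun y => f (phi y)) x.
Proof.
move=> /complex_derive_lip[d [d0 hd]] cp e e0.
have D1 : 0 < `|D| + 1 by rewrite ltr_wpDl.
(* This [r] lies below both [d] and [e / (|D| + 1)]. *)
pose r := d * e / (d * (`|D| + 1) + e).
have dr : 0 < d * (`|D| + 1) + e by rewrite addr_gt0// mulr_gt0.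
have r0 : 0 < r by rewrite divr_gt0// mulr_gt0.
have rd : r < d.
  by rewrite /r ltr_pdivrMr// ltr_pM2l// ltrDr mulr_gt0.
have re : (`|D| + 1) * r < e.
  rewrite /r mulrA ltr_pdivrMr//.
  have -> : (`|D| + 1) * (d * e) = e * (d * (`|D| + 1)) by ring.
  by rewrite ltr_pM2l// ltrDl.
have [s [s0 hs]] := cp _ r0; exists s; split => // y /hs h.
apply: (le_lt_trans (hd _ (lt_trans h rd))).
by apply: le_lt_trans re; rewrite ler_wpM2l ?(ltW D1)// ltW.
Qed.

Definition cexp (x : R) : C := (cos x +i* sin x)%C.

Lemma cexpD x y : cexp (x + y) = cexp x * cexp y.
Proof.
rewrite /cexp cosD sinD; apply/eqP; rewrite eq_complex/= eqxx/=.
by rewrite addrC.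
Qed.

Lemma cexp0 : cexp 0 = 1.
Proof. by rewrite /cexp cos0 sin0. Qed.

Lemma cexp_conj x : (cexp x)^* = cexp (- x).
Proof. by rewrite /cexp cosN sinN. Qed.

Lemma norm_cexp x : `|cexp x| = 1.
Proof. by rewrite normc_def/= cos2Dsin2 sqrtr1. Qed.

Lemma cexp_neq0 x : cexp x != 0.
Proof. by rewrite -normr_gt0 norm_cexp. Qed.

Lemma cexpN x : cexp (- x) = (cexp x)^-1.
Proof.
apply: (mulIf (cexp_neq0 x)); rewrite mulVf ?cexp_neq0//.
by rewrite -cexpD addNr cexp0.
Qed.

Lemma cexpX x n : cexp (x *+ n) = cexp x ^+ n.
Proof. by elim: n => [|n ih]; rewrite ?cexp0// mulrS exprS cexpD ih. Qed.

Lemma path_derive_cexp (m x : R) :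
  path_derive (fun y => cexp (m * y)) x ('i%C * m%:C%C * cexp (m * x)).
Proof.
have d1 : is_derive x 1 (fun y : R => m * y) m.
  by have := is_deriveZ m (is_derive_id x (1 : R)); rewrite /GRing.scale/= mulr1.
split.
  have h : is_derive x 1 (cos \o (fun y : R => m * y)) (- sin (m * x) * m).
    exact: (is_derive1_comp (is_derive_cos _) d1).
  apply: (is_derive_eq h); rewrite /=; ring.
have h : is_derive x 1 (sin \o (fun y : R => m * y)) (cos (m * x) * m).
  exact: (is_derive1_comp (is_derive_sin _) d1).
apply: (is_derive_eq h); rewrite /=; ring.
Qed.

Lemma path_cont_cexp (m x : R) : path_cont (fun y => cexp (m * y)) x.
Proof. exact: path_derive_cont (path_derive_cexp m x). Qed.

Let T : R := pi *+ 2.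

Let T0 : 0 <= T. Proof. by rewrite mulrn_wge0// pi_ge0. Qed.

Let T_gt0 : 0 < T. Proof. by rewrite mulrn_wgt0// pi_gt0. Qed.

Lemma cexp_period (n : int) x : cexp (n%:~R * (x + T)) = cexp (n%:~R * x).
Proof.
have cexpT : cexp T = 1 by rewrite /cexp cos2pi sin2pi.
have cT (m : nat) : cexp (m%:R * T) = 1.
  by rewrite mulr_natl cexpX cexpT expr1n.
rewrite mulrDr cexpD; suff -> : cexp (n%:~R * T) = 1 by rewrite mulr1.
case: n => m; first exact: cT.
by rewrite NegzE mulrNz mulNr cexpN -pmulrn cT invr1.
Qed.

Lemma path_int_cexp (n : int) :
  path_int (fun x => cexp (n%:~R * x)) 0 T = if n == 0 then T%:C%C else 0.
Proof.
have [->|n0] := eqVneq n 0.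
  rewrite (@path_intE _ _ (fun x => x%:C%C))//; first by rewrite -rmorphB subr0.
  move=> x _; rewrite mul0r cexp0.
  by apply: path_derive_real; exact: is_derive_id.
have nR : ((n%:~R : R)%:C%C : C) != 0.
  by rewrite -[0]/(0%:C%C) (inj_eq (@complexI _)) intr_eq0.
pose c : C := ('i%C * (n%:~R)%:C%C)^-1.
have i0 : 'i%C * (n%:~R)%:C%C != 0 :> C by rewrite mulf_neq0// complexiE neq0Ci.
rewrite (@path_intE _ _ (fun x => c * cexp (n%:~R * x)))//.
  have := cexp_period n 0; rewrite add0r => ->; by rewrite subrr.
move=> x _; have := path_deriveZ c (path_derive_cexp n%:~R x).
by rewrite mulrA mulVf// mul1r.
Qed.

End CauchyFormula.

(** * Cauchy's formula by contraction of the circle to a point *)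

Section CauchyFormula.
Context (R : realType).
Local Notation C := R[i].
Local Notation T := (pi *+ 2 : R).
Implicit Types (f g : C -> C) (z w D : C).

Let T0 : 0 <= T. Proof. by rewrite mulrn_wge0// pi_ge0. Qed.

Section Kernel.
Context (a : C) (r : R).
Hypotheses (ar : `|a| < r%:C%C) (r1 : r < 1).

Let r0 : 0 < r. Proof. by rewrite -ltcR; exact: (le_lt_trans (normr_ge0 a) ar). Qed.

Let ww (t : R) : C := r%:C%C * cexp t - a.
Let ww' (t : R) : C := r%:C%C * ('i%C * cexp t).

Definition cauchy_weight (t : R) : C := ww' t / ww t.

(* The circle is contracted to [a] along [Phi s t = a + tau s *: ww t]. The form
   [f w dw / (w - a)] pulls back to [f (Phi s t) (alpha s ds + cauchy_weight t dt)],
   where [alpha = tau' / tau], and the limit [s -> +oo] gives the formula. *)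
Let tau (s : R) : R := (1 + s ^+ 2)^-1.
Let tau' (s : R) : R := - (2 * s) / (1 + s ^+ 2) ^+ 2.
Let alpha (s : R) : R := - (2 * s) / (1 + s ^+ 2).

Let norm_rE t : `|r%:C%C * cexp t : C| = r%:C%C.
Proof. by rewrite normrM norm_cexp mulr1 norm_real_complex gtr0_norm. Qed.

Let ww_low t : r%:C%C - `|a| <= `|ww t|.
Proof. by rewrite -{1}(norm_rE t); exact: lerB_dist. Qed.

Let ra0 : 0 < r%:C%C - `|a|. Proof. by rewrite subr_gt0. Qed.

Let ww0 t : ww t != 0.
Proof. by rewrite -normr_gt0; apply: lt_le_trans (ww_low t). Qed.

Let ww_le t : `|ww t| <= 2.
Proof.
apply: (le_trans (ler_normB _ _)); rewrite norm_rE -[2]/(1 + 1) lerD//.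
  by rewrite -[1]/(1%:C%C) lecR ltW.
by apply: ltW; apply: lt_trans ar _; rewrite -[1]/(1%:C%C) ltcR.
Qed.

Let dww t : path_derive ww t (ww' t).
Proof.
have d1 : path_derive (fun y => cexp y) t ('i%C * cexp t : C).
  have := path_derive_cexp 1 t; rewrite mulr1 mul1r.
  by under [X in path_derive X]funext do rewrite mul1r.
have := path_derive_linear r%:C%C d1 (path_derive_cst (- a) t).
by rewrite addr0.
Qed.

Let dww' t : path_cont ww' t.
Proof.
have c : path_cont (fun y => cexp y : C) t.
  have := path_cont_cexp 1 t.
  by under [X in path_cont X]funext do rewrite mul1r.
apply: path_contM; first exact: path_cont_cst.
by apply: path_contM => //; exact: path_cont_cst.
Qed.

Lemma cauchy_weight_cont t : path_cont cauchy_weight t.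
Proof.
apply: path_contM => //; apply: path_contV => //.
exact: path_derive_cont (dww t).
Qed.

Let B : C := r%:C%C / (r%:C%C - `|a|).

Let B0 : 0 <= B. Proof. by rewrite divr_ge0 ?ler0c ?ltW. Qed.

Lemma cauchy_weight_le t : `|cauchy_weight t| <= r%:C%C / (r%:C%C - `|a|).
Proof.
rewrite normrM normfV /ww' !normrM norm_iC mul1r norm_cexp mulr1.
rewrite norm_real_complex gtr0_norm// ler_wpM2l ?ler0c ?(ltW r0)//.
by rewrite lef_pV2 ?posrE// normr_gt0.
Qed.

Let s2 (s : R) : 0 < 1 + s ^+ 2. Proof. by rewrite ltr_pwDl// sqr_ge0. Qed.
Let s2n (s : R) : 1 + s ^+ 2 != 0. Proof. by rewrite gt_eqF. Qed.

Let dtau (s : R) : is_derive s 1 tau (tau' s).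
Proof.
have h1 : is_derive s 1 (fun s : R => 1 + s ^+ 2) (2 * s).
  have h := is_deriveD (is_derive_cst (1 : R) s (1 : R)) (is_deriveX 2 (is_derive_id s (1 : R))).
  by apply: (is_derive_eq h); rewrite add0r expr1 /GRing.scale/= mulr1.
have h := @is_deriveV R (fun s : R => 1 + s ^+ 2) s _ 1 (s2n s) h1.
by apply: (is_derive_eq h); rewrite /tau' /GRing.scale/= mulNr mulNr mulrC.
Qed.

Let tau_alpha s : tau' s = alpha s * tau s.
Proof. by rewrite /tau' /alpha /tau expr2 invfM mulrA. Qed.

Let alpha_le s : `|alpha s| <= 1.
Proof.
rewrite /alpha mulNr normrN normf_div (gtr0_norm (s2 s)) ler_pdivrMr// mul1r.
have h1 := sqr_ge0 (1 + s); have h2 := sqr_ge0 (1 - s).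
by rewrite ler_norml; apply/andP; split; nra.
Qed.

Let tau01 s : 0 < tau s <= 1.
Proof.
by rewrite invr_gt0 s2/= invf_le1// lerDl sqr_ge0.
Qed.

Let ctau s : path_cont (fun s => (tau s)%:C%C : C) s.
Proof. exact: path_derive_cont (path_derive_real (dtau s)). Qed.

Let calpha s : path_cont (fun s => (alpha s)%:C%C : C) s.
Proof.
have dalpha : derivable alpha s 1.
  have h1 : derivable (fun s : R => - (2 * s)) s 1.
    by apply: derivableN; apply: derivableM => //.
  have h2 : derivable tau s 1 by have := dtau s; case.
  exact: (derivableM h1 h2).
by apply: path_derive_cont (path_derive_real (DeriveDef dalpha erefl)).
Qed.

Let lip_tau x y : `|tau x - tau y| <= `|x - y|.
Proof.
wlog yx : x y / y <= x => [hw|].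
  have [|/ltW xy] := leP y x; first exact: hw.
  by rewrite distrC [leRHS]distrC; exact: hw.
have := @path_derive_bound R (fun s => (tau s)%:C%C) (fun s => (tau' s)%:C%C) y x 1 yx.
rewrite mul1r -rmorphB norm_real_complex lecR (ger0_norm (_ : 0 <= x - y)) ?subr_ge0//.
apply=> z _; first exact: path_derive_real (dtau z).
rewrite norm_real_complex -[1]/(1%:C%C) lecR tau_alpha normrM.
rewrite mulr_ile1 ?normr_ge0 ?alpha_le//.
by have /andP[h1 h2] := tau01 z; rewrite gtr0_norm.
Qed.

Let lip_ww x y : `|ww x - ww y| <= `|x - y|%:C%C.
Proof.
wlog yx : x y / y <= x => [hw|].
  have [|/ltW xy] := leP y x; first exact: hw.
  by rewrite distrC [X in X%:C%C]distrC; exact: hw.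
have := @path_derive_bound R ww ww' y x 1 yx.
rewrite mul1r (ger0_norm (_ : 0 <= x - y)) ?subr_ge0//; apply=> z _; first exact: dww.
by rewrite /ww' !normrM norm_iC mul1r norm_cexp mulr1 norm_real_complex gtr0_norm// -[1]/(1%:C%C) lecR ltW.
Qed.

(** A convex combination of [a] and a point of the circle, hence inside the disc. It never reaches
    [a], because [tau] is positive; the coefficients [alpha] and [cauchy_weight] of the form
    therefore stay bounded. *)
Let Phi (s t : R) : C := a + (tau s)%:C%C * ww t.

Let Phi_disc s t : `|Phi s t| < 1.
Proof.
have -> : Phi s t = (1 - tau s)%:C%C * a + (tau s)%:C%C * (r%:C%C * cexp t).
  by rewrite /Phi /ww rmorphB rmorph1; ring.
have /andP[t0 t1] := tau01 s.
apply: (@le_lt_trans _ _ ((1 - tau s)%:C%C * r%:C%C + (tau s)%:C%C * r%:C%C)).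
  apply: (le_trans (ler_normD _ _)).
  rewrite !normrM norm_cexp mulr1 !norm_real_complex (gtr0_norm r0) (gtr0_norm t0).
  rewrite lerD2r (ger0_norm (_ : 0 <= 1 - tau s)) ?subr_ge0//.
  by rewrite ler_wpM2l ?ler0c ?subr_ge0// ltW.
by rewrite -mulrDl -rmorphD subrK mul1r -[1]/(1%:C%C) ltcR.
Qed.

Let Phi_lip s t s0 t0 : `|Phi s t - Phi s0 t0| <= (2 * (`|s - s0| + `|t - t0|))%:C%C.
Proof.
have -> : Phi s t - Phi s0 t0 =
   (tau s - tau s0)%:C%C * ww t + (tau s0)%:C%C * (ww t - ww t0).
  by rewrite /Phi rmorphB; ring.
apply: (le_trans (ler_normD _ _)); rewrite [2 * _]mulrDr [leRHS]rmorphD lerD// normrM norm_real_complex.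
  rewrite mulrC rmorphM/= rmorph_nat; apply: ler_pM => //; first by rewrite ler0c.
  by rewrite lecR lip_tau.
have /andP[u0 u1] := tau01 s0; rewrite (gtr0_norm u0).
apply: (le_trans (ler_wpM2l _ (lip_ww t t0))); first by rewrite ler0c ltW.
by rewrite -rmorphM/= lecR ler_wpM2r// (le_trans u1)// ler1n.
Qed.

Let cPhi1 t s : path_cont (Phi ^~ t) s.
Proof.
apply: path_contD; first exact: path_cont_cst.
by apply: path_contM => //; exact: path_cont_cst.
Qed.

Let cPhi2 s t : path_cont (Phi s) t.
Proof.
apply: path_contD; first exact: path_cont_cst.
apply: path_contM; first exact: path_cont_cst.
exact: path_derive_cont (dww t).
Qed.

(** The integral of [h (alpha ds + cauchy_weight dt)] around the boundary of the rectangle of all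
    [(s, t)] with [a1 <= s <= a2] and [b1 <= t <= b2]. *)
Let form (h : R -> R -> C) (a1 a2 b1 b2 : R) : C :=
  path_int (fun s => h s b1 * (alpha s)%:C%C) a1 a2 +
  path_int (fun t => h a2 t * cauchy_weight t) b1 b2 -
  path_int (fun s => h s b2 * (alpha s)%:C%C) a1 a2 -
  path_int (fun t => h a1 t * cauchy_weight t) b1 b2.

Let cont2 (h : R -> R -> C) :=
  (forall t s, path_cont (h ^~ t) s) /\ (forall s t, path_cont (h s) t).

Let cont2_1 h t : cont2 h -> forall s, path_cont (fun s => h s t * (alpha s)%:C%C) s.
Proof. by move=> ch s; apply: path_contM => //; exact: ch.1. Qed.

Let cont2_2 h s : cont2 h -> forall t, path_cont (fun t => h s t * cauchy_weight t) t.
Proof. by move=> ch t; apply: path_contM; [exact: ch.2|exact: cauchy_weight_cont]. Qed.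

Let form_add1 h (x y z s t : R) : cont2 h -> x <= y -> y <= z -> s <= t ->
  form h x z s t = form h x y s t + form h y z s t.
Proof.
move=> ch xy yz st; rewrite /form.
by rewrite !(path_int_chasles (cont2_1 _ ch) xy yz); ring.
Qed.

Let form_add2 h (x y r' s t : R) : cont2 h -> x <= y -> r' <= s -> s <= t ->
  form h x y r' t = form h x y r' s + form h x y s t.
Proof.
move=> ch xy rs st; rewrite /form.
by rewrite !(path_int_chasles (cont2_2 _ ch) rs st); ring.
Qed.

Let cont2_linear c h h' : cont2 h -> cont2 h' -> cont2 (fun u v => c * h u v + h' u v).
Proof.
move=> [h1 h2] [h1' h2']; split=> [t s|s t].
  by apply: path_contD; [apply: path_contM; [exact: path_cont_cst|exact: h1]|exact: h1'].
by apply: path_contD; [apply: path_contM; [exact: path_cont_cst|exact: h2]|exact: h2'].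
Qed.

Let cont2_cst c : cont2 (fun _ _ => c).
Proof. by split=> *; exact: path_cont_cst. Qed.

Let form_linear c h h' (x y s t : R) : x <= y -> s <= t -> cont2 h -> cont2 h' ->
  form (fun u v => c * h u v + h' u v) x y s t = c * form h x y s t + form h' x y s t.
Proof.
move=> xy st ch ch'; rewrite /form.
have e1 v : path_int (fun u => (c * h u v + h' u v) * (alpha u)%:C%C) x y =
    c * path_int (fun u => h u v * (alpha u)%:C%C) x y +
    path_int (fun u => h' u v * (alpha u)%:C%C) x y.
  rewrite -path_int_linear//; [|exact: cont2_1|exact: cont2_1].
  by apply: eq_path_int => u _; ring.
have e2 u : path_int (fun v => (c * h u v + h' u v) * cauchy_weight v) s t =
    c * path_int (fun v => h u v * cauchy_weight v) s t +
    path_int (fun v => h' u v * cauchy_weight v) s t.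
  rewrite -path_int_linear//; [|exact: cont2_2|exact: cont2_2].
  by apply: eq_path_int => v _; ring.
by rewrite !e1 !e2; ring.
Qed.

Let cont2_tw : cont2 (fun s t => (tau s)%:C%C * ww t).
Proof.
split=> [t s|s t]; apply: path_contM; [exact: ctau|exact: path_cont_cst|exact: path_cont_cst|].
exact: path_derive_cont (dww t).
Qed.

Let form_cst c (x y s t : R) : form (fun _ _ => c) x y s t = 0.
Proof. by rewrite /form; ring. Qed.

(** Multiplying the form by [tau ww] makes it exact, with primitive [tau ww]. Together with
    [form_cst], affine functions of [Phi] integrate to [0], which is what Goursat's argument
    subtracts. *)
Let form_tw (x y s t : R) : x <= y -> s <= t ->
  form (fun s t => (tau s)%:C%C * ww t) x y s t = 0.
Proof.
move=> xy st; rewrite /form.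
have e1 v : path_int (fun u => (tau u)%:C%C * ww v * (alpha u)%:C%C) x y =
    ww v * (tau y)%:C%C - ww v * (tau x)%:C%C.
  apply: (@path_intE _ _ (fun u => ww v * (tau u)%:C%C)) => // u _.
  have := path_deriveZ (ww v) (path_derive_real (dtau u)).
  by congr path_derive; rewrite tau_alpha rmorphM/=; ring.
have e2 u : path_int (fun v => (tau u)%:C%C * ww v * cauchy_weight v) s t =
    (tau u)%:C%C * ww t - (tau u)%:C%C * ww s.
  apply: (@path_intE _ _ (fun v => (tau u)%:C%C * ww v)) => // v _.
  have := path_deriveZ (tau u)%:C%C (dww v).
  by congr path_derive; rewrite /cauchy_weight -mulrA; congr (_ * _); rewrite mulrCA mulfV ?mulr1.
by rewrite !e1 !e2; ring.
Qed.

Let form_bound h (x y s t : R) (e : C) : x <= y -> s <= t -> cont2 h ->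
  (forall u v, x <= u <= y -> s <= v <= t -> `|h u v| <= e) ->
  `|form h x y s t| <= 2 * e * (1 + B) * (y - x + (t - s))%:C%C.
Proof.
move=> xy st ch he.
have e0 : 0 <= e by apply: le_trans (normr_ge0 _) (he x s _ _); rewrite lexx.
have b1 v : s <= v <= t -> `|path_int (fun u => h u v * (alpha u)%:C%C) x y| <= e * (y - x)%:C%C.
  move=> hv; apply: path_int_bound => //; first exact: cont2_1.
  move=> u hu; rewrite normrM -[leRHS]mulr1; apply: ler_pM => //; first exact: he.
  by rewrite norm_real_complex -[1]/(1%:C%C) lecR.
have b2 u : x <= u <= y -> `|path_int (fun v => h u v * cauchy_weight v) s t| <= e * B * (t - s)%:C%C.
  move=> hu; apply: path_int_bound => //; first exact: cont2_2.
  move=> v hv; rewrite normrM; apply: ler_pM => //; first exact: he.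
  exact: cauchy_weight_le.
rewrite /form.
apply: (@le_trans _ _ (e * (y - x)%:C%C + e * B * (t - s)%:C%C + e * (y - x)%:C%C + e * B * (t - s)%:C%C)).
  apply: (le_trans (ler_normB _ _)); rewrite lerD ?b2 ?lexx//.
  apply: (le_trans (ler_normB _ _)); rewrite lerD ?b1 ?lexx ?andbT//.
  by apply: (le_trans (ler_normD _ _)); rewrite lerD ?b1 ?b2 ?lexx ?andbT.
have -> : (y - x + (t - s))%:C%C = (y - x)%:C%C + (t - s)%:C%C :> C by exact: rmorphD.
rewrite -subr_ge0.
have -> : 2 * e * (1 + B) * ((y - x)%:C%C + (t - s)%:C%C) -
  (e * (y - x)%:C%C + e * B * (t - s)%:C%C + e * (y - x)%:C%C + e * B * (t - s)%:C%C) =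
  2 * (e * B * (y - x)%:C%C) + 2 * (e * (t - s)%:C%C) by ring.
have hx : 0 <= (y - x)%:C%C :> C by rewrite ler0c subr_ge0.
have ht : 0 <= (t - s)%:C%C :> C by rewrite ler0c subr_ge0.
by rewrite addr_ge0// mulr_ge0// ?(mulr_ge0 (mulr_ge0 e0 B0) hx) ?(mulr_ge0 e0 ht).
Qed.

(** All boundary integrals vanish by [bisection], and by periodicity the sides [t = 0] and [t = T]
    cancel. So the integral over the loop does not depend on [s], and large [s] compares it with
    [f a] times the total weight. That weight is left unevaluated here; [int_w] computes it by a
    geometric expansion. *)
Lemma cauchy_formula f : disc_holomorphic f ->
  path_int (fun t => f (r%:C%C * cexp t) * cauchy_weight t) 0 T =
  f a * path_int cauchy_weight 0 T.
Proof.
move=> hf.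
pose P s t := f (Phi s t).
have cP : cont2 P.
  split=> [t s|s t]; have [D hD] := hf _ (Phi_disc s t).
    exact: (@path_cont_comp R f (Phi ^~ t) s D hD (cPhi1 t s)).
  exact: (@path_cont_comp R f (Phi s) t D hD (cPhi2 s t)).
have zero x y s t : x <= y -> s <= t -> form P x y s t = 0.
  apply: bisection.
  - by move=> *; exact: form_add1.
  - by move=> *; exact: form_add2.
  move=> s0 t0 e e0; have [D hD] := hf _ (Phi_disc s0 t0).
  (* [form_bound] contributes [2 (1 + B) L] and [Phi_lip] a factor [2 L]; the product with
     [e / (4 (1 + B))] is exactly [e L^2]. *)
  have B1 : 0 < 4 * (1 + B) by rewrite mulr_gt0// ltr_pwDl.
  have [d [d0 hd]] := hD _ (divr_gt0 e0 B1).
  have [dE dd0] := complex_gt0E d0.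
  exists (complex.Re d / 4); split; first by rewrite divr_gt0.
  move=> x1 x2 y1 y2 /andP[x1s sx2] /andP[y1t ty2] dx dy.
  have x12 := le_trans x1s sx2; have y12 := le_trans y1t ty2.
  (* The first-order expansion of [f] at [Phi s0 t0], evaluated at [Phi s t] and arranged as a
     combination of [1] and [tau ww] so that its boundary integral vanishes by linearity. *)
  pose aff s t : C := (f (Phi s0 t0) + D * (a - Phi s0 t0)) * 1 +
    (D * ((tau s)%:C%C * ww t) + 0).
  pose eta s t := -1 * aff s t + P s t.
  have caff1 : cont2 (fun s t => D * ((tau s)%:C%C * ww t) + 0).
    exact: (cont2_linear _ cont2_tw (cont2_cst 0)).
  have caff : cont2 aff by exact: (cont2_linear _ (cont2_cst 1) caff1).
  have ceta : cont2 eta by exact: cont2_linear.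
  have -> : form P x1 x2 y1 y2 = form eta x1 x2 y1 y2.
    rewrite /eta form_linear// /aff (form_linear _ x12 y12 (cont2_cst 1) caff1).
    rewrite (form_linear _ x12 y12 cont2_tw (cont2_cst 0)).
    by rewrite form_tw// !form_cst !mulr0 !addr0 mulr0 add0r.
  pose L := x2 - x1 + (y2 - y1).
  have L0 : 0 <= L by rewrite addr_ge0// subr_ge0.
  have he u v : x1 <= u <= x2 -> y1 <= v <= y2 ->
     `|eta u v| <= e / (4 * (1 + B)) * (2 * L)%:C%C.
    move=> /andP[xu ux] /andP[yv vy].
    have near : `|Phi u v - Phi s0 t0| <= (2 * L)%:C%C.
      apply: (le_trans (Phi_lip _ _ _ _)); rewrite lecR ler_pM2l//.
      have au : `|u - s0| <= x2 - x1 by rewrite ler_norml; apply/andP; split; lra.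
      have av : `|v - t0| <= y2 - y1 by rewrite ler_norml; apply/andP; split; lra.
      by rewrite lerD.
    have -> : eta u v = f (Phi u v) - f (Phi s0 t0) - D * (Phi u v - Phi s0 t0).
      have e1 : (tau u)%:C%C * ww v = Phi u v - a by rewrite /Phi addrC addKr.
      by rewrite /eta /aff /P e1; move: (Phi u v) (Phi s0 t0) => p q; ring.
    have := hd (Phi u v); rewrite dE => /(_ _)/le_trans; apply.
      by apply: (le_lt_trans near); rewrite ltcR /L; lra.
    by rewrite ler_wpM2l// divr_ge0 ?(ltW e0) ?(ltW B1).
  have := form_bound x12 y12 ceta he => /le_trans; apply.
  rewrite -/L le_eqVlt; apply/orP; left; apply/eqP.
  rewrite rmorphM rmorphXn rmorph_nat/=.
  have : 1 + B != 0 by rewrite gt_eqF// ltr_pwDl.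
  by move: B (L%:C%C) => b l bn; field.
have PT s : P s T = P s 0.
  rewrite /P /Phi /ww; congr (f (_ + _ * (_ * _ - _))).
  by have := cexp_period 1 (0 : R); rewrite mulr1z !mul1r add0r.
pose J s := path_int (fun t => P s t * cauchy_weight t) 0 T.
have Jcst s : 0 <= s -> J 0 = J s.
  move=> s0; have := zero 0 s 0 T s0 T0; rewrite /form.
  have -> : path_int (fun u => P u T * (alpha u)%:C%C) 0 s = path_int (fun u => P u 0 * (alpha u)%:C%C) 0 s.
    by apply: eq_path_int => u _; rewrite PT.
  rewrite -/(J s) -/(J 0) => /eqP.
  rewrite [_ + J s]addrC addrK subr_eq0 => /eqP->//.
have -> : path_int (fun t => f (r%:C%C * cexp t) * cauchy_weight t) 0 T = J 0.
  apply: eq_path_int => t _; rewrite /P /Phi /tau expr0n addr0 invr1 mul1r /ww.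
  by rewrite subrKC.
apply/eqP; rewrite -subr_eq0; apply/eqP.
apply: (@small_eq0 R (R[i]^o) _ (B * T%:C%C)) => e e0.
have a1 : `|a| < 1 by apply: lt_trans ar _; rewrite -[1]/(1%:C%C) ltcR.
have [D hD] := hf _ a1; have [d [d0 hd]] := complex_derive_lip hD.
have D1 : 0 < `|D| + 1 by rewrite ltr_wpDl.
have eD : 0 < e / (`|D| + 1) by rewrite divr_gt0.
have [dE dd0] := complex_gt0E d0; have [eE ee0] := complex_gt0E eD.
(* Since [|Phi s t - a| <= 4 tau s], having [tau s < m] brings the loop within both radii;
   [s = 1 + m^-1] achieves it because [1 + s^2 >= s > m^-1]. *)
pose m := Num.min (complex.Re d) (complex.Re (e / (`|D| + 1))) / 4.
have m0 : 0 < m by rewrite divr_gt0// lt_min dd0.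
pose s := 1 + m^-1.
have s0 : 0 <= s by rewrite addr_ge0// invr_ge0 ltW.
have ts : tau s < m.
  rewrite /tau invf_plt ?posrE//; apply: (@lt_le_trans _ _ s).
    by rewrite /s ltrDr.
  have : 1 <= s by rewrite lerDl invr_ge0 ltW.
  nra.
have close t : `|Phi s t - a| < d /\ `|Phi s t - a| < e / (`|D| + 1).
  have h : `|Phi s t - a| <= (4 * tau s)%:C%C.
    rewrite /Phi addrC addKr normrM norm_real_complex mulrC rmorphM/=.
    have /andP[u0 _] := tau01 s; rewrite (gtr0_norm u0); apply: ler_pM => //.
      by rewrite ler0c ltW.
    by apply: (le_trans (ww_le t)); rewrite rmorph_nat ler_nat.
  have hm : (4 * tau s)%:C%C < (m * 4)%:C%C :> C by rewrite ltcR mulrC ltr_pM2r.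
  rewrite /m mulfVK ?pnatr_eq0// in hm.
  split; apply: (le_lt_trans h); apply: (lt_le_trans hm).
    by rewrite [leRHS]dE lecR ge_min lexx.
  by rewrite [leRHS]eE lecR ge_min lexx orbT.
rewrite (Jcst s)// -mulN1r mulrA [-1 * f a]mulN1r.
have -> : J s + - f a * path_int cauchy_weight 0 T =
   path_int (fun t => - f a * cauchy_weight t + P s t * cauchy_weight t) 0 T.
  rewrite path_int_linear//; [by rewrite addrC|exact: cauchy_weight_cont|].
  by apply: cont2_2.
have -> : B * T%:C%C * e = e * B * (T - 0)%:C%C by rewrite subr0; ring.
apply: path_int_bound => //.
  move=> t; apply: path_contD; last by apply: cont2_2.
  by apply: path_contM; [exact: path_cont_cst|exact: cauchy_weight_cont].
move=> t _; rewrite -mulrDl normrM addrC; apply: ler_pM => //; last exact: cauchy_weight_le.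
have [h1 h2] := close t; apply: (le_trans (hd _ h1)).
by rewrite -ler_pdivlMl// mulrC ltW.
Qed.

End Kernel.
End CauchyFormula.

(** * Derivatives relative to a set, and holomorphy in the disc *)

Section DiscCalculus.
Context (R : realType).
Local Notation C := R[i].
Implicit Types (f g : C -> C) (z w D : C).

(** The order of [R[i]] is partial; the parallel sum [a b / (a + b)] stands in for a minimum. *)
Lemma common_radius (a b : C) : 0 < a -> 0 < b -> exists c, [/\ 0 < c, c <= a & c <= b].
Proof.
move=> a0 b0; have ab : 0 < a + b by rewrite addr_gt0.
exists (a * b / (a + b)); split; first by rewrite divr_gt0// mulr_gt0.
  by rewrite ler_pdivrMr// ler_pM2l// lerDr ltW.
by rewrite ler_pdivrMr// mulrC ler_pM2l// lerDl ltW.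
Qed.

(** The set [Z] is there for points of the negative axis, where the resolvent is compared only with
    its values above the axis and on it. *)
Definition derive_in (Z : C -> Prop) f z D := forall e : C, 0 < e ->
  exists d : C, 0 < d /\ forall w, Z w -> `|w - z| < d ->
    `|f w - f z - D * (w - z)| <= e * `|w - z|.

Lemma complex_derive_in f z D : complex_derive f z D <-> derive_in (fun=> True) f z D.
Proof.
by split=> h e /h[d [d0 hd]]; exists d; split => // w; [move=> _|move=> wd]; apply: hd.
Qed.

Lemma derive_in_lip Z f z D : derive_in Z f z D ->
  exists d : C, 0 < d /\ forall w, Z w -> `|w - z| < d ->
    `|f w - f z| <= (`|D| + 1) * `|w - z|.
Proof.
move=> /(_ _ ltr01)[d [d0 hd]]; exists d; split => // w Zw /(hd _ Zw) h.
rewrite -[f w - f z](subrK (D * (w - z))) mulrDl addrC.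
by apply: (le_trans (ler_normD _ _)); rewrite normrM lerD2l.
Qed.

Lemma derive_inM Z f g z D E : derive_in Z f z D -> derive_in Z g z E ->
  derive_in Z (fun w => f w * g w) z (D * g z + f z * E).
Proof.
move=> fD gE e e0; have [d1 [d10 h1]] := derive_in_lip fD.
have [d2 [d20 h2]] := derive_in_lip gE.
pose c : C := `|g z| + `|f z| + (`|D| + 1) * (`|E| + 1).
have D0 : 0 < `|D| + 1 by rewrite ltr_wpDl.
have E0 : 0 < `|E| + 1 by rewrite ltr_wpDl.
have c0 : 0 < c by rewrite ltr_wpDl ?addr_ge0// mulr_gt0.
have ec : 0 < e / c by rewrite divr_gt0.
have [d3 [d30 h3]] := fD _ ec; have [d4 [d40 h4]] := gE _ ec.
have [d5 [d50 l1 l2]] := common_radius d10 d20.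
have [d6 [d60 l3 l4]] := common_radius d30 d40.
have [d7 [d70 l5 l6]] := common_radius d50 d60.
have [d [d0 l7 l8]] := common_radius d70 ec.
exists d; split => // w Zw wd.
have w7 := lt_le_trans wd l7; have w5 := lt_le_trans w7 l5; have w6 := lt_le_trans w7 l6.
have {}h1 := h1 _ Zw (lt_le_trans w5 l1); have {}h2 := h2 _ Zw (lt_le_trans w5 l2).
have {}h3 := h3 _ Zw (lt_le_trans w6 l3); have {}h4 := h4 _ Zw (lt_le_trans w6 l4).
have we := ltW (lt_le_trans wd l8).
have -> : f w * g w - f z * g z - (D * g z + f z * E) * (w - z) =
  g z * (f w - f z - D * (w - z)) + f z * (g w - g z - E * (w - z)) +
  (f w - f z) * (g w - g z) by ring.
have -> : e * `|w - z| = `|g z| * (e / c * `|w - z|) + `|f z| * (e / c * `|w - z|) +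
    ((`|D| + 1) * `|w - z|) * ((`|E| + 1) * (e / c)).
  have -> : e * `|w - z| = e / c * c * `|w - z| by rewrite mulfVK// gt_eqF.
  by rewrite /c; ring.
apply: (le_trans (ler_normD _ _)); apply: lerD; last first.
  rewrite normrM; apply: ler_pM => //; apply: (le_trans h2).
  by rewrite ler_wpM2l// ltW.
apply: (le_trans (ler_normD _ _)); rewrite !normrM.
by apply: lerD; rewrite ler_wpM2l.
Qed.

Lemma derive_in_linear Z f g z D E c : derive_in Z f z D -> derive_in Z g z E ->
  derive_in Z (fun w => c * f w + g w) z (c * D + E).
Proof.
move=> hD hE e e0; have c1 : 0 < `|c| + 1 by rewrite ltr_wpDl.
have e1 : 0 < e / (`|c| + 1) by rewrite divr_gt0.
have [d1 [d10 h1]] := hD _ e1; have [d2 [d20 h2]] := hE _ e1.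
have [d [d0 l1 l2]] := common_radius d10 d20.
exists d; split => // w Zw wd.
have -> : c * f w + g w - (c * f z + g z) - (c * D + E) * (w - z) =
  c * (f w - f z - D * (w - z)) + (g w - g z - E * (w - z)) by ring.
have -> : e * `|w - z| =
    `|c| * (e / (`|c| + 1) * `|w - z|) + e / (`|c| + 1) * `|w - z|.
  rewrite -{1}[e](@mulfVK _ (`|c| + 1)) ?gt_eqF//; ring.
apply: (le_trans (ler_normD _ _)); rewrite normrM; apply: lerD.
  by rewrite ler_wpM2l// h1// (lt_le_trans wd l1).
by rewrite h2// (lt_le_trans wd l2).
Qed.

Lemma derive_in_cst Z c z : derive_in Z (fun=> c) z 0.
Proof.
move=> e e0; exists 1; split => // w _ _.
by rewrite subrr mul0r subrr normr0 mulr_ge0// ltW.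
Qed.

Lemma derive_in_inv Z a z : z != a -> derive_in Z (fun w => (w - a)^-1) z (- (z - a)^-1 ^+ 2).
Proof.
rewrite -subr_eq0 => s0; pose s := (z - a)^-1; move=> e e0.
have n0 : 0 < `|z - a| / 2 by rewrite divr_gt0// normr_gt0.
have s30 : 0 < 2 * `|s| ^+ 3 by rewrite mulr_gt0// exprn_gt0// normr_gt0 invr_eq0.
have [d [d0 l1 l2]] := common_radius n0 (divr_gt0 e0 s30).
exists d; split => // w _ wd.
have h : `|z - a| / 2 <= `|w - a|.
  have -> : `|z - a| / 2 = `|z - a| - `|z - a| / 2 by field.
  rewrite lerBlDr -(@lerD2r _ (- `|w - z|)) -addrA; apply: (@le_trans _ _ `|w - a|).
    rewrite lerBlDr; have -> : z - a = (w - a) - (w - z) by rewrite opprB [RHS]addrC subrKA.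
    exact: ler_normB.
  rewrite lerDl subr_ge0; apply: ltW; exact: lt_le_trans wd l1.
have w0 : w - a != 0 by rewrite -normr_gt0 (lt_le_trans n0).
have -> : (w - a)^-1 - (z - a)^-1 - - (z - a)^-1 ^+ 2 * (w - z) =
    (w - z) * (w - z) * s * s * (w - a)^-1.
  by rewrite /s; field; rewrite s0 w0.
have sw : `|(w - a)^-1| <= 2 * `|s|.
  by rewrite /s !normfV -[2]invrK -invfM lef_pV2 ?posrE ?normr_gt0// mulrC.
rewrite !normrM -!mulrA [leRHS]mulrC ler_wpM2l//.
apply: (@le_trans _ _ (e / (2 * `|s| ^+ 3) * (`|s| * (`|s| * (2 * `|s|))))).
  apply: ler_pM; rewrite ?mulr_ge0//.
    by apply: ltW; exact: lt_le_trans wd l2.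
  by rewrite ler_wpM2l// ler_wpM2l.
have -> : `|s| * (`|s| * (2 * `|s|)) = 2 * `|s| ^+ 3 by ring.
by rewrite mulfVK// gt_eqF.
Qed.

Lemma eq_derive_in Z f g z D r : 0 < r -> f z = g z ->
  (forall w, Z w -> `|w - z| < r -> f w = g w) -> derive_in Z f z D -> derive_in Z g z D.
Proof.
move=> r0 fgz fg hD e e0; have [d1 [d10 h1]] := hD _ e0.
have [d [d0 l1 l2]] := common_radius d10 r0; exists d; split => // w Zw wd.
by rewrite -fgz -fg// ?h1// (lt_le_trans wd).
Qed.

Lemma disc_holomorphicM f g : disc_holomorphic f -> disc_holomorphic g ->
  disc_holomorphic (fun z => f z * g z).
Proof.
move=> hf hg z z1; have [D /complex_derive_in hD] := hf _ z1.
have [E /complex_derive_in hE] := hg _ z1.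
by eexists; apply/complex_derive_in; exact: derive_inM hD hE.
Qed.

Lemma disc_holomorphic_linear c f g : disc_holomorphic f -> disc_holomorphic g ->
  disc_holomorphic (fun z => c * f z + g z).
Proof.
move=> hf hg z z1; have [D /complex_derive_in hD] := hf _ z1.
have [E /complex_derive_in hE] := hg _ z1.
by eexists; apply/complex_derive_in; exact: derive_in_linear hD hE.
Qed.

Lemma disc_holomorphic_cst c : disc_holomorphic (fun=> c : C).
Proof. by move=> z _; exists 0; apply/complex_derive_in; exact: derive_in_cst. Qed.

Lemma disc_holomorphic_id : disc_holomorphic (id : C -> C).
Proof.
move=> z _; exists 1 => e e0; exists 1; split => // w _.
by rewrite mul1r subrr normr0 mulr_ge0// ltW.
Qed.

Lemma disc_holomorphicD f g : disc_holomorphic f -> disc_holomorphic g ->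
  disc_holomorphic (fun z => f z + g z).
Proof.
move=> hf hg; have := disc_holomorphic_linear 1 hf hg.
by under [X in disc_holomorphic X -> _]funext do rewrite mul1r.
Qed.

Lemma disc_sub1_neq0 z : `|z| < 1 -> 1 - z != 0.
Proof. by rewrite subr_eq0; apply: contraTneq => <-; rewrite normr1 ltxx. Qed.

End DiscCalculus.

(** * Taylor coefficients and Toeplitz kernels *)

Section Taylor.
Context (R : realType).
Local Notation C := R[i].
Local Notation T := (pi *+ 2 : R).
Implicit Types (f g : C -> C) (z w D : C) (r : R).

Let T0 : 0 <= T. Proof. by rewrite mulrn_wge0// pi_ge0. Qed.
Let T_gt0 : 0 < T. Proof. by rewrite mulrn_wgt0// pi_gt0. Qed.
Let TC : (T%:C%C : C) != 0.
Proof. by rewrite -[0]/(0%:C%C) (inj_eq (@complexI _)) gt_eqF. Qed.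

Lemma norm_posC r : 0 < r -> `|r%:C%C : C| = r%:C%C.
Proof. by move=> r0; rewrite norm_real_complex gtr0_norm. Qed.

Definition cx (n : int) (t : R) : C := cexp (n%:~R * t).

Let cx_cont n t : path_cont (cx n) t.
Proof. exact: path_cont_cexp. Qed.

Let cxD m n t : cx (m + n) t = cx m t * cx n t.
Proof. by rewrite /cx intrD mulrDl cexpD. Qed.

Let cx0 t : cx 0 t = 1.
Proof. by rewrite /cx mul0r cexp0. Qed.

Let norm_cx n t : `|cx n t| = 1.
Proof. exact: norm_cexp. Qed.

Let cx_conj n t : (cx n t)^* = cx (- n) t.
Proof. by rewrite cexp_conj /cx intrN mulNr. Qed.

Let cxN n t : cx (- n) t = (cx n t)^-1.
Proof. by rewrite /cx intrN mulNr cexpN. Qed.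

Let cexp_cx t : cexp t = cx 1 t.
Proof. by rewrite /cx mul1r. Qed.

Let int_cx n : path_int (cx n) 0 T = if n == 0 then T%:C%C else 0.
Proof. exact: path_int_cexp. Qed.

Definition circle r (t : R) : C := r%:C%C * cexp t.

Lemma norm_circle r t : 0 <= r -> `|circle r t| = r%:C%C.
Proof. by move=> r0; rewrite normrM norm_cexp mulr1 norm_real_complex ger0_norm. Qed.

Let circle_disc r t : 0 < r < 1 -> `|circle r t| < 1.
Proof. by move=> /andP[r0 r1]; rewrite norm_circle ?ltW// -[1]/(1%:C%C) ltcR. Qed.

Let circle_cont r t : path_cont (circle r) t.
Proof.
apply: path_contM; first exact: path_cont_cst.
have := @path_cont_cexp R 1 t.
by under [X in path_cont X]funext do rewrite mul1r.
Qed.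

Let holo_cont f r t : disc_holomorphic f -> 0 < r < 1 ->
  path_cont (fun t => f (circle r t)) t.
Proof.
move=> hf hr; have [D hD] := hf _ (circle_disc t hr).
exact: (@path_cont_comp _ f (circle r) t D hD (circle_cont r t)).
Qed.

Let path_bound (phi : R -> C) : (forall t, path_cont phi t) ->
  exists M : C, 0 <= M /\ forall t, 0 <= t <= T -> `|phi t| <= M.
Proof.
move=> cp; pose h (t : R) := complex.Re (phi t * (phi t)^*).
have ch : continuous h.
  move=> t; apply: (@path_cont_Re R (fun t => phi t * (phi t)^*)).
  by apply: path_contM => //; exact: path_cont_conj.
have [|c _ hc] := @EVT_max R h 0 T T0; first exact: continuous_subspaceT.
have hE t : (h t)%:C%C = `|phi t| ^+ 2.
  by rewrite normCK RRe_real// -normCK rpredX// normr_real.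
exists (1 + (h c)%:C%C); split=> [|t tT].
  by rewrite hE addr_ge0// exprn_ge0.
have : `|phi t| ^+ 2 <= (h c)%:C%C by rewrite -hE lecR hc.
move=> h1; apply: (@le_trans _ _ (1 + `|phi t| ^+ 2)); last by rewrite lerD2l.
rewrite -subr_ge0.
have -> : 1 + `|phi t| ^+ 2 - `|phi t| =
   (`|phi t| - 2^-1) ^+ 2 + (2^-1 ^+ 2 + 2^-1).
  by field.
apply: addr_ge0; last by rewrite addr_ge0 ?exprn_ge0 ?invr_ge0.
by rewrite real_exprn_even_ge0// rpredB// ?normr_real// ger0_real// invr_ge0.
Qed.

Lemma path_int_sum I (s : seq I) (c : I -> C) (phi : I -> R -> C) (a b : R) : a <= b ->
  (forall i t, path_cont (phi i) t) ->
  path_int (fun t => \sum_(i <- s) c i * phi i t) a b =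
  \sum_(i <- s) c i * path_int (phi i) a b /\
  (forall t, path_cont (fun t => \sum_(i <- s) c i * phi i t) t).
Proof.
move=> ab cp; elim: s => [|i s [ih ihc]].
  have e : (fun t : R => \sum_(i <- [::]) c i * phi i t) = (fun=> 0).
    by apply/funext => t; rewrite big_nil.
  rewrite e; split; last by move=> t; exact: path_cont_cst.
  rewrite big_nil (@path_intE _ _ (fun=> 0))// ?subrr//.
  by move=> t _; exact: path_derive_cst.
have e : (fun t : R => \sum_(j <- i :: s) c j * phi j t) =
   (fun t => c i * phi i t + \sum_(j <- s) c j * phi j t).
  by apply/funext => t; rewrite big_cons.
rewrite e; split.
  by rewrite path_int_linear// big_cons ih.
move=> t; apply: path_contD => //.
by apply: path_contM => //; exact: path_cont_cst.
Qed.

Section Expansion.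
Context (a : C) (r : R).
Hypotheses (ar : `|a| < r%:C%C) (r1 : r < 1).
Let w := cauchy_weight a r.
Let B : C := r%:C%C / (r%:C%C - `|a|).
Let b : C := a / r%:C%C.

Let r0 : 0 < r. Proof. by rewrite -ltcR; exact: (le_lt_trans (normr_ge0 a) ar). Qed.
Let rC0 : (r%:C%C : C) != 0.
Proof. by rewrite -[0]/(0%:C%C) (inj_eq (@complexI _)) gt_eqF. Qed.

Let B0 : 0 <= B.
Proof. by rewrite divr_ge0 ?ler0c ?(ltW r0)// subr_ge0 ltW. Qed.

Let nb : `|b| = `|a| / r%:C%C.
Proof. by rewrite normf_div norm_posC. Qed.

Let b1 : `|b| < 1.
Proof. by rewrite nb ltr_pdivrMr ?mul1r// ltcR. Qed.

(** The weight is ['i / (1 - b exp (- i t))]; this is the recursion of its geometric series. *)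
Let w_rec t : w t = 'i%C + b * (cx (-1) t * w t).
Proof.
have wn : r%:C%C * cexp t - a != 0.
  rewrite subr_eq0; apply/eqP => h; move: ar; rewrite -h -/(circle r t).
  by rewrite norm_circle ?(ltW r0)// ltxx.
rewrite /w /cauchy_weight /b cxN -cexp_cx.
by have := cexp_neq0 t; move: (cexp t) wn => E wn E0; field; rewrite E0 wn rC0.
Qed.

Let wc t : path_cont w t. Proof. exact: cauchy_weight_cont. Qed.

Let expand_step (h : R -> C) : (forall t, path_cont h t) ->
  path_int (fun t => h t * w t) 0 T =
  'i%C * path_int h 0 T + b * path_int (fun t => (h t * cx (-1) t) * w t) 0 T.
Proof.
move=> ch.
have ch' t : path_cont (fun t => (h t * cx (-1) t) * w t) t.
  by apply: path_contM => //; exact: path_contM.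
have c0 t : path_cont (fun=> 0 : C) t by exact: path_cont_cst.
have z : path_int (fun=> 0 : C) 0 T = 0.
  by rewrite (@path_intE _ _ (fun=> 0))// ?subrr// => t _; exact: path_derive_cst.
have e : path_int (fun t => b * ((h t * cx (-1) t) * w t) + 0) 0 T =
   b * path_int (fun t => (h t * cx (-1) t) * w t) 0 T.
  by rewrite path_int_linear// z addr0.
rewrite -e -path_int_linear//.
  by apply: eq_path_int => t _; rewrite {1}w_rec; ring.
move=> t; apply: path_contD => //; apply: path_contM => //; exact: path_cont_cst.
Qed.

Let expand (g : R -> C) N : (forall t, path_cont g t) ->
  path_int (fun t => g t * w t) 0 T =
  'i%C * \sum_(n < N) b ^+ n * path_int (fun t => g t * cx (- n%:Z) t) 0 T +
  b ^+ N * path_int (fun t => (g t * cx (- N%:Z) t) * w t) 0 T.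
Proof.
move=> cg; elim: N => [|N ->].
  rewrite big_ord0 mulr0 add0r expr0 mul1r; apply: eq_path_int => t _.
  by rewrite oppr0 cx0 mulr1.
rewrite big_ord_recr/= expand_step; last by move=> t; exact: path_contM.
rewrite exprSr mulrDr mulrDr -!addrA; congr (_ + _); rewrite mulrCA; congr (_ + _).
rewrite -mulrA; congr (_ * (_ * _)).
by apply: eq_path_int => t _; rewrite -[g t * _ * _]mulrA -cxD -opprD addrC -intS.
Qed.

Let rem_bound (g : R -> C) M N : (forall t, path_cont g t) ->
  (forall t, 0 <= t <= T -> `|g t| <= M) ->
  `|b ^+ N * path_int (fun t => (g t * cx (- N%:Z) t) * w t) 0 T| <=
  `|b| ^+ N * (M * B * T%:C%C).
Proof.
move=> cg gM; rewrite normrM normrX ler_wpM2l ?exprn_ge0//.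
rewrite -[X in _ * X%:C%C]subr0; apply: path_int_bound => //.
  by move=> t; apply: path_contM => //; exact: path_contM.
move=> t tT; rewrite normrM (normrM (g t)) norm_cx mulr1; apply: ler_pM => //; first exact: gM.
exact: cauchy_weight_le.
Qed.

Let small_rem (x K : C) : 0 <= K -> (forall N, `|x| <= `|b| ^+ N.+1 * K) -> x = 0.
Proof.
move=> K0 h; apply: (@small_eq0 R (R[i]^o) _ K) => e e0.
have [N /(_ N.+1 (leqnSn _)) hN] := geom_small (normr_ge0 b) b1 e0.
by apply: (le_trans (h N)); rewrite mulrC ler_wpM2l// ltW.
Qed.

(** In the expansion of the weight all exponentials but the constant one have integral [0], and the
    remainder tends to [0]. *)
Let int_w : path_int w 0 T = 'i%C * T%:C%C.
Proof.
apply/eqP; rewrite -subr_eq0; apply/eqP.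
apply: (@small_rem _ (1 * B * T%:C%C)); first by rewrite mul1r mulr_ge0// ler0c.
move=> N; have c1 t : path_cont (fun=> 1 : C) t by exact: path_cont_cst.
have := @rem_bound (fun=> 1) 1 N.+1 c1; set x := b ^+ _ * _ => hx.
suff -> : path_int w 0 T - 'i%C * T%:C%C = x by apply: hx => t _; rewrite normr1.
have -> : path_int w 0 T = path_int (fun t => 1 * w t) 0 T.
  by apply: eq_path_int => t _; rewrite mul1r.
rewrite (expand N.+1 c1) -/x big_ord_recl big1 => [|i _].
  rewrite addr0 expr0 mul1r.
  have -> : path_int (fun t => 1 * cx (- 0%:Z) t) 0 T = T%:C%C.
    by rewrite -[RHS](int_cx 0); apply: eq_path_int => t _; rewrite mul1r.
  by rewrite addrC addKr.
have -> : path_int (fun t => 1 * cx (- (lift ord0 i)%:Z) t) 0 T = 0.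
  have := int_cx (- (lift ord0 i)%:Z); rewrite oppr_eq0/= => <-.
  by apply: eq_path_int => t _; rewrite mul1r.
by rewrite mulr0.
Qed.

(** Cauchy's formula divided by the total weight: the geometric expansion of the weight becomes the
    Taylor polynomial at [a], with Fourier coefficients on the circle of radius [r]. *)
Lemma taylor_remainder f M N : disc_holomorphic f ->
  (forall t, 0 <= t <= T -> `|f (circle r t)| <= M) ->
  `|f a - \sum_(n < N) b ^+ n *
      (T%:C%C^-1 * path_int (fun t => f (circle r t) * cx (- n%:Z) t) 0 T)| <=
  `|b| ^+ N * (M * B).
Proof.
move=> hf fM; have rr : 0 < r < 1 by rewrite r0.
have cf t := holo_cont t hf rr.
have i0 : 'i%C != 0 :> C by rewrite complexiE neq0Ci.
have := cauchy_formula ar r1 hf; rewrite -/w int_w (expand N cf) => h.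
have := rem_bound N cf fM; set x := b ^+ N * _ in h *.
have -> : \sum_(n < N) b ^+ n *
      (T%:C%C^-1 * path_int (fun t => f (circle r t) * cx (- n%:Z) t) 0 T) =
   T%:C%C^-1 * \sum_(n < N) b ^+ n * path_int (fun t => f (circle r t) * cx (- n%:Z) t) 0 T.
  by rewrite mulr_sumr; apply: eq_bigr => n _; rewrite mulrCA.
move: h; set S := \sum_(n < N) _ => h hx.
have -> : f a - T%:C%C^-1 * S = ('i%C * T%:C%C)^-1 * x.
  apply: (mulIf (mulf_neq0 i0 TC)); rewrite mulrBl -h.
  by have := TC; move: (T%:C%C : C) => t t0; field; rewrite i0 t0.
rewrite normrM normfV normrM norm_iC mul1r norm_posC//.
by rewrite mulrC ler_pdivrMr ?ltcR//; apply: (le_trans hx); rewrite !mulrA.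
Qed.

End Expansion.

Definition fourier f r (n : int) : C :=
  T%:C%C^-1 * path_int (fun t => f (circle r t) * cx (- n) t) 0 T.

(** Read off on the circle of radius one half; [fourier_taylor] shows that every radius in the disc
    gives the same value. *)
Definition taylor f (n : nat) : C := fourier f 2^-1 n * 2 ^+ n.

Lemma disc_holomorphic_mulX f : disc_holomorphic f ->
  disc_holomorphic (fun z => z * f z).
Proof. by move=> hf; exact: (disc_holomorphicM (@disc_holomorphic_id R) hf). Qed.

(** Cauchy's formula at [a = 0] for [z ^+ n.+1 * f z], which vanishes there; at [a = 0] the weight
    is the constant ['i]. *)
Lemma fourier_neg f r n : disc_holomorphic f -> 0 < r < 1 -> fourier f r (Negz n) = 0.
Proof.
move=> hf /andP[r0 r1].
have hX m : disc_holomorphic (fun z => z ^+ m * f z).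
  elim: m => [|m ih].
    by under [X in disc_holomorphic X]funext do rewrite expr0 mul1r.
  have := disc_holomorphic_mulX ih.
  by under [X in disc_holomorphic X -> _]funext do rewrite mulrA -exprS.
have rC0 : (r%:C%C : C) != 0 by rewrite -[0]/(0%:C%C) (inj_eq (@complexI _)) gt_eqF.
have ar : `|0 : C| < r%:C%C by rewrite normr0 ltcR.
have := cauchy_formula ar r1 (hX n.+1); rewrite expr0n/= mul0r mul0r => h.
have cf t : path_cont (fun t => f (circle r t) * cx (n.+1)%:Z t) t.
  by apply: path_contM => //; apply: holo_cont; rewrite ?r0.
have e : path_int (fun t => (circle r t) ^+ n.+1 * f (circle r t) * cauchy_weight 0 r t) 0 T =
  path_int (fun t => ('i%C * r%:C%C ^+ n.+1) * (f (circle r t) * cx (n.+1)%:Z t) + 0) 0 T.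
  apply: eq_path_int => t _; rewrite addr0 /cauchy_weight subr0.
  rewrite /cx -[_%:~R * t]/(n.+1%:R * t) mulr_natl cexpX /circle exprMn.
  have := cexp_neq0 t; move: (cexp t) (f _) => E v E0; field.
  by rewrite E0 rC0.
have c0 t : path_cont (fun=> 0 : C) t by exact: path_cont_cst.
have z : path_int (fun=> 0 : C) 0 T = 0.
  by rewrite (@path_intE _ _ (fun=> 0))// ?subrr// => t _; exact: path_derive_cst.
move: h; rewrite -/(circle r _) e path_int_linear// z addr0 => /eqP.
rewrite mulf_eq0 mulf_eq0 expf_eq0 (negbTE rC0) andbF orbF complexiE (negbTE (neq0Ci _))/=.
by move=> /eqP h; rewrite /fourier NegzE opprK h mulr0.
Qed.

(** On the inner circle [f] is uniformly close to its Taylor polynomial computed on the outer one,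
    and orthogonality of the exponentials retains only the term of index [m]. *)
Lemma fourier_radius f r1 r2 (m : nat) : disc_holomorphic f -> 0 < r1 -> r1 < r2 -> r2 < 1 ->
  fourier f r1 m = (r1 / r2)%:C%C ^+ m * fourier f r2 m.
Proof.
move=> hf r10 r12 r21; have r20 := lt_trans r10 r12.
have rr1 : 0 < r1 < 1 by rewrite r10 (lt_trans r12).
have rr2 : 0 < r2 < 1 by rewrite r20.
have [M [M0 hM]] := path_bound (fun t => holo_cont t hf rr2).
pose q : C := (r1 / r2)%:C%C.
have q0 : 0 <= q by rewrite ler0c divr_ge0// ltW.
have q1 : q < 1 by rewrite -[1]/(1%:C%C) ltcR ltr_pdivrMr// mul1r.
pose B : C := r2%:C%C / (r2%:C%C - r1%:C%C).
have B0 : 0 <= B by rewrite divr_ge0 ?ler0c ?(ltW r20)// subr_ge0 lecR ltW.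
have r2C : (r2%:C%C : C) != 0 by rewrite -[0]/(0%:C%C) (inj_eq (@complexI _)) gt_eqF.
apply/eqP; rewrite -subr_eq0; apply/eqP.
apply: (@small_eq0 R (R[i]^o) _ (M * B)) => e e0.
have [N hN] := geom_small q0 q1 e0.
(* Large enough for the remainder to be small and for the term of index [m] to occur. *)
pose K := maxn N m.+1.
have mK : (m < K)%N by rewrite leq_max leqnn orbT.
pose S t : C := \sum_(n < K) (q ^+ n * fourier f r2 n) * cx (n%:Z - m%:Z) t.
have [intS cS] := @path_int_sum _ (index_enum 'I_K)
  (fun n : 'I_K => q ^+ n * fourier f r2 n) (fun n : 'I_K => cx (n%:Z - m%:Z)) 0 T T0
  (fun n t => cx_cont _ _).
have cf t : path_cont (fun t => f (circle r1 t) * cx (- m%:Z) t) t.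
  by apply: path_contM => //; exact: holo_cont.
have -> : fourier f r1 m - q ^+ m * fourier f r2 m =
   T%:C%C^-1 * path_int (fun t => -1 * S t + f (circle r1 t) * cx (- m%:Z) t) 0 T.
  rewrite path_int_linear// intS (bigD1 (Ordinal mK))//= big1 => [|i im].
    rewrite subrr int_cx eqxx addr0 /fourier.
    by have := TC; move: (T%:C%C : C) (path_int _ 0 T) (path_int _ 0 T) => t A A' t0; field.
  rewrite int_cx subr_eq0 eqz_nat; case: eqP => [h|_]; last by rewrite mulr0.
  by move/eqP: im; case; apply: val_inj.
rewrite normrM normfV norm_posC// mulrC ler_pdivrMr ?ltcR//.
rewrite -[X in _ * X%:C%C]subr0; apply: path_int_bound => //.
  move=> t; apply: path_contD => //; apply: path_contM => //; exact: path_cont_cst.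
move=> t tT.
have ar : `|circle r1 t| < r2%:C%C by rewrite norm_circle ?(ltW r10)// ltcR.
have := taylor_remainder ar r21 K hf hM.
have nb : `|circle r1 t / r2%:C%C| = q.
  by rewrite normf_div norm_circle ?(ltW r10)// norm_posC// /q rmorphM/= fmorphV.
rewrite nb norm_circle ?(ltW r10)// -/B => h.
have -> : -1 * S t + f (circle r1 t) * cx (- m%:Z) t =
  (f (circle r1 t) - \sum_(n < K) (circle r1 t / r2%:C%C) ^+ n *
      (T%:C%C^-1 * path_int (fun t => f (circle r2 t) * cx (- n%:Z) t) 0 T)) * cx (- m%:Z) t.
  rewrite mulrBl addrC mulN1r /S; congr (_ - _); rewrite mulr_suml.
  apply: eq_bigr => n _; rewrite -/(fourier f r2 n) cxD.
  have -> : (circle r1 t / r2%:C%C) ^+ n = q ^+ n * cx n t.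
    rewrite /cx -[_%:~R * t]/(n%:R * t) mulr_natl cexpX -exprMn; congr (_ ^+ _).
    by rewrite /circle /q rmorphM/= fmorphV/= mulrAC.
  by ring.
rewrite normrM norm_cx mulr1; apply: (le_trans h).
by rewrite mulrC; apply: ler_wpM2l; [exact: mulr_ge0|apply: ltW; apply: hN; exact: leq_maxl].
Qed.

Lemma fourier_taylor f r (m : nat) : disc_holomorphic f -> 0 < r < 1 ->
  fourier f r m = taylor f m * r%:C%C ^+ m.
Proof.
move=> hf /andP[r0 r1].
have h0 : (0 : R) < 2^-1 by rewrite invr_gt0.
have h1 : (2^-1 : R) < 1 by rewrite invf_lt1// ltr1n.
have two : ((2^-1 : R)%:C%C : C) = 2^-1 by rewrite fmorphV/= rmorph_nat.
rewrite /taylor; have [rh|hr|->] := ltgtP r 2^-1.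
- rewrite (fourier_radius _ hf r0 rh h1) invrK rmorphM/= rmorph_nat exprMn; ring.
- rewrite (fourier_radius _ hf h0 hr r1) rmorphM/= two fmorphV/= exprMn exprVn exprVn.
  have rC0 : (r%:C%C : C) ^+ m != 0 by rewrite expf_neq0// -[0]/(0%:C%C) (inj_eq (@complexI _)) gt_eqF.
  have n0 : (2 : C) ^+ m != 0 by rewrite expf_neq0// pnatr_eq0.
  by move: (r%:C%C ^+ m : C) ((2 : C) ^+ m) (fourier f r m) rC0 n0 => x y F x0 y0; field; rewrite x0 y0.
rewrite two -mulrA -exprMn divff ?pnatr_eq0// expr1n mulr1 //.
Qed.

Lemma taylor_expansion f z : disc_holomorphic f -> `|z| < 1 ->
  conv (fun N => \sum_(n < N) taylor f n * z ^+ n) (f z).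
Proof.
move=> hf z1; pose r : R := (complex.Re `|z| + 1) / 2.
have zE : `|z| = (complex.Re `|z|)%:C%C by rewrite RRe_real// normr_real.
have z1' : complex.Re `|z| < 1 by rewrite -ltcR -zE.
have z0' : 0 <= complex.Re `|z| by rewrite -ler0c -zE.
have r0 : 0 < r by rewrite /r; lra.
have r1 : r < 1 by rewrite /r; lra.
have rr : 0 < r < 1 by rewrite r0.
have ar : `|z| < r%:C%C by rewrite zE ltcR /r; lra.
have [M [M0 hM]] := path_bound (fun t => holo_cont t hf rr).
pose B : C := r%:C%C / (r%:C%C - `|z|).
have B0 : 0 <= B by rewrite divr_ge0 ?ler0c ?(ltW r0)// subr_ge0 ltW.
have rC0 : (r%:C%C : C) != 0 by rewrite -[0]/(0%:C%C) (inj_eq (@complexI _)) gt_eqF.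
have q1 : `|z / r%:C%C| < 1.
  by rewrite normf_div norm_posC// ltr_pdivrMr ?mul1r// ltcR.
move=> e e0; have MB : 0 < M * B + 1 by rewrite ltr_wpDl// mulr_ge0.
have [N hN] := geom_small (normr_ge0 _) q1 (divr_gt0 e0 MB).
exists N => n Nn; have := taylor_remainder ar r1 n hf hM.
have -> : \sum_(n0 < n) taylor f n0 * z ^+ n0 = \sum_(n < n) (z / r%:C%C) ^+ n *
   (T%:C%C^-1 * path_int (fun t => f (circle r t) * cx (- n%:Z) t) 0 T).
  apply: eq_bigr => i _; rewrite -/(fourier f r i) fourier_taylor//.
  rewrite expr_div_n; have : r%:C%C ^+ i != 0 :> C by rewrite expf_neq0.
  by move: (r%:C%C ^+ i) => ri ri0; field.
move=> h; apply: (le_lt_trans h).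
apply: (@le_lt_trans _ _ (e / (M * B + 1) * (M * B))).
  by apply: ler_wpM2r; [exact: mulr_ge0|apply: ltW; apply: hN].
by rewrite mulrAC ltr_pdivrMr// ltr_pM2l// ltrDl.
Qed.

Definition tcoef f (n : int) : C := if n is Posz m then taylor f m else 0.

Let fourierE f r n : disc_holomorphic f -> 0 < r < 1 ->
  fourier f r n = tcoef f n * r%:C%C ^+ `|n|%N.
Proof.
move=> hf hr; case: n => n; first exact: fourier_taylor.
by rewrite fourier_neg// mul0r.
Qed.

(** * Positive definiteness of the Toeplitz kernel *)

Section Toeplitz.
Context (I : Type) (g : I -> I -> C -> C).
Hypothesis hg : forall x y, disc_holomorphic (g x y).
Hypothesis g_ge0 : forall z, `|z| < 1 -> forall l : seq (C * I),
  0 <= gram (fun x y => g x y z) l l + (gram (fun x y => g x y z) l l)^*.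

(* The [n]-th Fourier coefficient of the real part of [g x y] on the circle. *)
Definition toep (n : int) x y : C := (tcoef (g x y) n + (tcoef (g y x) (- n))^*) / 2.

(** The sum is the mean over the circle of radius [r] of the real part of the Gram form of [g], with
    the entry of index [n] multiplied by [exp (- i n t)]. The powers of [r] are those of the Poisson
    kernel and disappear as [r] tends to [1]. *)
Let toep_radius r (l : seq (C * (int * I))) : 0 < r < 1 ->
  0 <= \sum_(p <- l) \sum_(q <- l) p.1 * q.1^* *
    (toep (p.2.1 - q.2.1) p.2.2 q.2.2 * r%:C%C ^+ `|(p.2.1 - q.2.1)%R|%N).
Proof.
move=> hr.
pose h (p q : C * (int * I)) t := g p.2.2 q.2.2 (circle r t) * cx (- (p.2.1 - q.2.1)) t.
have ch p q t : path_cont (h p q) t by apply: path_contM => //; exact: holo_cont.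
pose S1 p t := \sum_(q <- l) p.1 * q.1^* * h p q t.
have iS1 p : path_int (S1 p) 0 T = \sum_(q <- l) p.1 * q.1^* * path_int (h p q) 0 T /\
    forall t, path_cont (S1 p) t.
  exact: (@path_int_sum _ l (fun q => p.1 * q.1^*) (h p) 0 T T0 (ch p)).
pose S t := \sum_(p <- l) 1 * S1 p t.
have [iS cS] : path_int S 0 T = \sum_(p <- l) 1 * path_int (S1 p) 0 T /\
    forall t, path_cont S t.
  exact: (@path_int_sum _ l (fun=> 1) S1 0 T T0 (fun p => (iS1 p).2)).
have S_ge0 t : 0 <= S t + (S t)^*.
  have := g_ge0 (circle_disc t hr) [seq (p.1 * cx (- p.2.1) t, p.2.2) | p <- l].
  have -> // : gram (fun x y => g x y (circle r t))
      [seq (p.1 * cx (- p.2.1) t, p.2.2) | p <- l]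
      [seq (p.1 * cx (- p.2.1) t, p.2.2) | p <- l] = S t.
  rewrite /gram big_map; apply: eq_bigr => p _; rewrite mul1r big_map.
  apply: eq_bigr => q _ /=; rewrite /h rmorphM/= cx_conj !opprK opprB addrC cxD.
  by ring.
have cSc t : path_cont (fun t => (S t)^*) t by exact: path_cont_conj.
pose Z := path_int S 0 T.
have Z0 : 0 <= Z + Z^*.
  rewrite /Z -path_int_conj// addrC.
  have := path_int_linear 1 T0 cSc cS; rewrite mul1r => <-.
  apply: path_int_ge0 => //.
    by move=> t; apply: path_contD => //; apply: path_contM => //; exact: path_cont_cst.
  by move=> t; rewrite mul1r addrC.
have ZE : T%:C%C^-1 * Z = \sum_(p <- l) \sum_(q <- l) p.1 * q.1^* *
    (tcoef (g p.2.2 q.2.2) (p.2.1 - q.2.1) * r%:C%C ^+ `|(p.2.1 - q.2.1)%R|%N).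
  rewrite /Z iS mulr_sumr; apply: eq_bigr => p _; rewrite mul1r (iS1 p).1 mulr_sumr.
  apply: eq_bigr => q _; rewrite mulrCA; congr (_ * _).
  by rewrite -fourierE.
have Tr : (T%:C%C^-1)^* = T%:C%C^-1 :> C.
  by apply: CrealP; rewrite rpredV ger0_real// ler0c.
have rr k : (r%:C%C ^+ k)^* = r%:C%C ^+ k :> C.
  have /andP[r0 _] := hr.
  by apply: CrealP; rewrite rpredX// ger0_real// ler0c ltW.
have -> : \sum_(p <- l) \sum_(q <- l) p.1 * q.1^* *
    (toep (p.2.1 - q.2.1) p.2.2 q.2.2 * r%:C%C ^+ `|(p.2.1 - q.2.1)%R|%N) =
   2^-1 * (T%:C%C^-1 * (Z + Z^*)).
  have -> : T%:C%C^-1 * (Z + Z^*) = T%:C%C^-1 * Z + (T%:C%C^-1 * Z)^*.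
    by rewrite rmorphM/= Tr mulrDr.
  rewrite ZE [X in _ + X]rmorph_sum/=.
  under [X in _ + X]eq_bigr do rewrite rmorph_sum/=.
  rewrite [X in _ + X]exchange_big/= -big_split/= mulr_sumr.
  apply: eq_bigr => p _; rewrite -big_split/= mulr_sumr.
  apply: eq_bigr => q _; rewrite !rmorphM/= conjCK rr /toep opprB.
  have -> : `|(q.2.1 - p.2.1)%R|%N = `|(p.2.1 - q.2.1)%R|%N by rewrite -abszN opprB.
  by field.
by rewrite mulr_ge0 ?invr_ge0// mulr_ge0// invr_ge0 ler0c.
Qed.

Let conv_sum (J : Type) (s : seq J) (u : J -> nat -> C) (c : J -> C) :
  (forall j, conv (u j) (c j)) -> conv (fun n => \sum_(j <- s) u j n) (\sum_(j <- s) c j).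
Proof.
move=> uc; elim: s => [|j s ih].
  by rewrite big_nil; apply: eq_conv (conv_cst 0) => n; rewrite big_nil.
by rewrite big_cons; apply: eq_conv (convD (uc j) ih) => n; rewrite big_cons.
Qed.

Lemma toeplitz_psd (l : seq (C * (int * I))) :
  0 <= gram (fun a b => toep (a.1 - b.1) a.2 b.2) l l.
Proof.
(* The shift by two keeps [r 0] positive. *)
pose r (j : nat) : R := 1 - j.+2%:R^-1.
have rj j : 0 < r j < 1.
  by rewrite /r subr_gt0 invf_lt1 ?ltr1n// gtrBl invr_gt0 ltr0n.
have cr1 : conv (fun j => (r j)%:C%C) 1.
  move=> e e0; have [N hN] := inv_small e0; exists N => n Nn.
  have -> : 1 - (r n)%:C%C = n.+2%:R^-1 :> C.
    by rewrite /r rmorphB rmorph1 opprB addrC subrK fmorphV/= rmorph_nat.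
  by rewrite ger0_norm ?invr_ge0// hN// (leq_trans Nn).
have crm m : conv (fun j => (r j)%:C%C ^+ m) 1.
  elim: m => [|m ih]; first by apply: eq_conv (conv_cst 1) => n; rewrite expr0.
  move=> e e0; have e20 : 0 < e / 2 by rewrite divr_gt0.
  have [N hN] := ih _ e20; have [M hM] := cr1 _ e20.
  exists (maxn N M) => n; rewrite geq_max => /andP[Nn Mn].
  have -> : 1 - (r n)%:C%C ^+ m.+1 = (1 - (r n)%:C%C ^+ m) + (r n)%:C%C ^+ m * (1 - (r n)%:C%C).
    by rewrite exprSr; ring.
  apply: (le_lt_trans (ler_normD _ _)); rewrite (splitr e) ltrD ?hN//.
  apply: le_lt_trans (hM _ Mn); rewrite normrM normrX.
  have /andP[r0 r1] := rj n; rewrite norm_posC// ler_piMl// exprn_ile1 ?ler0c ?(ltW r0)//.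
  by rewrite -[leRHS]/(1%:C%C) lecR ltW.
have c : conv (fun j => \sum_(p <- l) \sum_(q <- l) p.1 * q.1^* *
    (toep (p.2.1 - q.2.1) p.2.2 q.2.2 * (r j)%:C%C ^+ `|(p.2.1 - q.2.1)%R|%N))
    (gram (fun a b => toep (a.1 - b.1) a.2 b.2) l l).
  apply: conv_sum => p; apply: conv_sum => q.
  have := conv_linear (p.1 * q.1^* * toep (p.2.1 - q.2.1) p.2.2 q.2.2) (crm `|(p.2.1 - q.2.1)%R|%N) (conv_cst 0).
  rewrite mulr1 addr0; apply: eq_conv => n; rewrite addr0; ring.
by apply: (conv_ge0 c) => j; exact: toep_radius.
Qed.

End Toeplitz.

Lemma taylor_linear f g c n : disc_holomorphic f -> disc_holomorphic g ->
  taylor (fun z => c * f z + g z) n = c * taylor f n + taylor g n.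
Proof.
move=> hf hg.
have hr : 0 < (2^-1 : R) < 1 by rewrite invr_gt0 ltr0n invf_lt1 ?ltr1n ?ltr0n.
have cf t : path_cont (fun t => f (circle 2^-1 t) * cx (- n%:Z) t) t.
  by apply: path_contM => //; exact: holo_cont.
have cg t : path_cont (fun t => g (circle 2^-1 t) * cx (- n%:Z) t) t.
  by apply: path_contM => //; exact: holo_cont.
rewrite /taylor /fourier.
have -> : path_int (fun t => (c * f (circle 2^-1 t) + g (circle 2^-1 t)) * cx (- n%:Z) t) 0 T =
   c * path_int (fun t => f (circle 2^-1 t) * cx (- n%:Z) t) 0 T +
   path_int (fun t => g (circle 2^-1 t) * cx (- n%:Z) t) 0 T.
  by rewrite -path_int_linear//; apply: eq_path_int => t _; ring.
ring.
Qed.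

Lemma taylor_mulX f n : disc_holomorphic f -> taylor (fun z => z * f z) n.+1 = taylor f n.
Proof.
move=> hf; have hr : 0 < (2^-1 : R) < 1 by rewrite invr_gt0 ltr0n invf_lt1 ?ltr1n ?ltr0n.
have cf t : path_cont (fun t => f (circle 2^-1 t) * cx (- n%:Z) t) t.
  by apply: path_contM => //; exact: holo_cont.
have c0 t : path_cont (fun=> 0 : C) t by exact: path_cont_cst.
have z : path_int (fun=> 0 : C) 0 T = 0.
  by rewrite (@path_intE _ _ (fun=> 0))// ?subrr// => t _; exact: path_derive_cst.
rewrite /taylor /fourier.
have -> : path_int (fun t => circle 2^-1 t * f (circle 2^-1 t) * cx (- n.+1%:Z) t) 0 T =
   2^-1 * path_int (fun t => f (circle 2^-1 t) * cx (- n%:Z) t) 0 T.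
  have := path_int_linear 2^-1 T0 cf c0; rewrite z addr0 => <-.
  apply: eq_path_int => t _; rewrite addr0 /circle intS opprD cxD (cxN 1) -cexp_cx.
  have -> : ((2^-1 : R)%:C%C : C) = 2^-1 by rewrite fmorphV/= rmorph_nat.
  have := cexp_neq0 t; move: (cexp t) (f _) (cx _ t) => E v c E0; field.
  exact: E0.
by rewrite exprS; move: (path_int _ _ _) ((2 : C) ^+ n) (T%:C%C^-1 : C) => A B t; field.
Qed.

Lemma taylor0 f : disc_holomorphic f -> taylor f 0 = f 0.
Proof.
move=> hf; have c := taylor_expansion hf (_ : `|0| < 1).
apply/esym; apply: (conv_uniq (c _)); first by rewrite normr0.
apply: (@conv_shift _ _ _ 1); apply: eq_conv (conv_cst _) => n.
by rewrite addn1 big_ord_recl expr0 mulr1 big1 ?addr0// => i _; rewrite expr0n mulr0.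
Qed.

End Taylor.

Section TaylorAffine.
Context (R : realType).
Local Notation C := R[i].
Implicit Types (f : C -> C) (z : C).

(** The Fourier coefficient of a constant is the same on all circles, yet by [fourier_radius] it is
    scaled by [2^-(n+1)] between two of them. *)
Lemma taylor_cst (c : C) n : taylor (fun=> c) n.+1 = 0.
Proof.
have h := @fourier_radius R (fun=> c) 4^-1 2^-1 n.+1 (disc_holomorphic_cst c).
have : (4^-1 : R) < 2^-1 by rewrite ltf_pV2 ?posrE ?ltr0n// ltr_nat.
have : (2^-1 : R) < 1 by rewrite invf_lt1 ?ltr0n// ltr1n.
have q0 : (0 < 4^-1 :> R) by rewrite invr_gt0 ltr0n.
move=> a b; have {h a b} := h q0 b a.
rewrite /taylor {1}/fourier -/(fourier (fun=> c) 2^-1 n.+1).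
move: (fourier _ _ _) => x /eqP; rewrite -subr_eq0 -{1}[x]mul1r -mulrBl mulf_eq0.
case/orP => [|/eqP ->]; last by rewrite mul0r.
have -> : (4^-1 / 2^-1 : R) = 2^-1 by field.
rewrite -rmorphXn -[1]/(1%:C%C) -rmorphB -[0]/(0%:C%C) (inj_eq (@complexI _)).
by rewrite gt_eqF// subr_gt0 exprn_ilt1 ?invr_ge0 ?ler0n ?invf_lt1 ?ltr1n ?ltr0n.
Qed.

Lemma taylor_affine f c n : disc_holomorphic f ->
  taylor (fun z => z * f z + c) n.+1 = taylor f n.
Proof.
move=> hf; have := @taylor_linear R (fun z => z * f z) (fun=> c) 1 n.+1
  (disc_holomorphicM (@disc_holomorphic_id R) hf) (disc_holomorphic_cst c).
rewrite taylor_cst addr0 mul1r taylor_mulX// => <-; congr (taylor _ _).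
by apply/funext => z; rewrite mul1r.
Qed.

End TaylorAffine.

(** * Resolvents of inverse Stieltjes families *)

Section RelationResolvents.
Context (R : realType) (H : hilbertType R).
Local Notation C := R[i].
Implicit Types (T : set (H * H)) (F : H -> H) (f g u v : H) (l m a b c : C).

Lemma inv_shiftP T c f u : rel_inv (rel_shift T c) (f, u) <-> T (u, f - c *: u).
Proof.
split=> [[[p1 p2] /= Tp [<- <-]]|Tu]; first by rewrite addrK.
by exists (u, f - c *: u) => //=; rewrite subrK.
Qed.

Lemma inv_shift_graph T c F : rel_inv (rel_shift T c) = graph F <->
  forall f u, T (u, f - c *: u) <-> u = F f.
Proof.
split=> [e f u|e]; first by rewrite -inv_shiftP e.
by apply/seteqP; split=> -[f u]; rewrite ?inv_shiftP e.
Qed.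

Lemma linear_relD T p q : linear_relation T -> T p -> T q -> T (p + q).
Proof. by move=> [_ h] Tp Tq; have := h 1 _ _ Tp Tq; rewrite scale1r. Qed.

Lemma linear_relZ T a p : linear_relation T -> T p -> T (a *: p).
Proof. by move=> [h0 h] Tp; have := h a _ _ Tp h0; rewrite addr0. Qed.

Lemma linear_relB T p q : linear_relation T -> T p -> T q -> T (p - q).
Proof.
by move=> lT Tp Tq; rewrite -scaleN1r; apply: linear_relD => //; exact: linear_relZ.
Qed.

Lemma resolvent_linear T c F : linear_relation T ->
  (forall f u, T (u, f - c *: u) <-> u = F f) -> linear F.
Proof.
move=> lT h a f g; apply/esym; apply/h.
have := lT.2 a (F f, f - c *: F f) (F g, g - c *: F g).
move=> /(_ (proj2 (h _ _) erefl) (proj2 (h _ _) erefl)).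
congr (T _); congr (_, _); rewrite /= scalerBr scalerDr opprD !scalerA [a * c]mulrC.
by rewrite addrACA.
Qed.

Lemma linear_additive (F : H -> H) : linear F -> {morph F : x y / x - y}.
Proof. by move=> lF x y; rewrite -scaleN1r addrC lF scaleN1r addrC. Qed.

Lemma Im_prod (m c : C) : 'Im m * 'Im c = - ((m^* - m) * (c^* - c)) / 4.
Proof.
rewrite !ImE; have := sqrCi C; move: 'i => i ii.
have -> : i * (m^* - m) / 2 * (i * (c^* - c) / 2) = i ^+ 2 * ((m^* - m) * (c^* - c)) / 4 by field.
by rewrite ii mulN1r.
Qed.

Lemma dissipative_surjective T m l F : linear_relation T ->
  (forall f u, T (u, f - m *: u) <-> u = F f) ->
  (forall p, T p -> 0 <= 'Im m * 'Im (inner p.2 p.1)) ->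
  0 < 'Im m * 'Im l -> forall f, exists u, T (u, f - l *: u).
Proof.
move=> lT hF dT ml f; have lF := resolvent_linear lT hF.
have FB := linear_additive lF.
pose S g := g + (m^* - m) *: F g.
have SB : {morph S : x y / x - y}.
  by move=> x y; rewrite /S FB scalerBr opprD addrACA.
have S1 g : `|S g| <= `|g|.
  have Tg : T (F g, g - m *: F g) by apply/hF.
  have := dT _ Tg => /=; set v := g - _; set u := F g => d.
  have gE : g = v + m *: u by rewrite subrK.
  rewrite /S -/u; clear Tg; clearbody u v; rewrite {}gE -addrA -scalerDl [m + _]addrC subrK.
  rewrite -(@ler_pXn2r _ 2) ?nnegrE// -subr_ge0 !norm2D !normrZ norm_conjC !innerZr.
  rewrite !rmorphM/= conjCK.
  have -> : `|v| ^+ 2 + (`|m| * `|u|) ^+ 2 + (m^* * inner v u + m * (inner v u)^*) -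
    (`|v| ^+ 2 + (`|m| * `|u|) ^+ 2 + (m * inner v u + m^* * (inner v u)^*)) =
    4 * (- ((m^* - m) * ((inner v u)^* - inner v u)) / 4) by field.
  by rewrite -Im_prod mulr_ge0.
pose w := (l - m) / (l - m^*).
have lm : `|l - m| ^+ 2 < `|l - m^*| ^+ 2.
  rewrite -subr_gt0 !normCK !rmorphB/= conjCK.
  have -> : (l - m^*) * (l^* - m) - (l - m) * (l^* - m^*) = 4 * (- ((m^* - m) * (l^* - l)) / 4).
    by field.
  by rewrite -Im_prod mulr_gt0.
have lm0 : 0 < `|l - m^*|.
  rewrite normr_gt0; apply: contraTneq lm => ->.
  by rewrite normr0 expr0n/= le_gtF// exprn_ge0.
have w1 : `|w| < 1.
  by rewrite normf_div ltr_pdivrMr// mul1r -(@ltr_pXn2r _ 2) ?nnegrE.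
have [x y||x|g hg] := @neumann R H (fun x => w *: S x) `|w| _ _ w1 _ ((m^* - m) / (m^* - l) *: f).
- by rewrite SB scalerBr.
- by [].
- by rewrite normrZ ler_wpM2l.
have ml' : m^* - m != 0.
  apply: contraTneq ml => h.
  by rewrite Im_prod h mul0r oppr0 mul0r ltxx.
have ml0 : m^* - l != 0 by rewrite -opprB oppr_eq0 -normr_gt0.
have ml1 : l - m^* != 0 by rewrite -normr_gt0.
exists (F g).
have Tg : T (F g, g - m *: F g) by apply/hF.
suff -> : f = g + (l - m) *: F g by rewrite scalerBl -addrA [_ - _ - _]addrAC subrr add0r.
have : ((m^* - l) / (m^* - m)) *: (g - w *: S g) = f.
  rewrite hg scalerA.
  have -> : (m^* - l) / (m^* - m) * ((m^* - m) / (m^* - l)) = 1 by field; rewrite ml0 ml'.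
  by rewrite scale1r.
move=> <-; have -> : g - w *: S g = (1 - w) *: g - (w * (m^* - m)) *: F g.
  by rewrite /S scalerDr scalerA opprD addrA scalerBl scale1r.
rewrite scalerBr !scalerA -scaleNr -[X in _ = X + _]scale1r.
by congr (_ *: _ + _ *: _); rewrite /w; field; rewrite ml1 ml'.
Qed.

(** With [F] a chosen right inverse of [T + a], the equation for [T + b] becomes
    [g - (a - b) F g = f]. The a priori bound makes [F] additive as well as bounded by [c]. *)
Lemma shift_surjective T a b c : linear_relation T ->
  (forall f, exists u, T (u, f - a *: u)) ->
  (forall u v, T (u, v) -> `|u| <= c * `|v + a *: u|) ->
  0 <= c -> `|a - b| * c < 1 ->
  forall f, exists u, T (u, f - b *: u).
Proof.
move=> lT /choice[F hF] bT c0 abc f.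
have FB : {morph F : x y / x - y}.
  move=> x y; apply/eqP; rewrite -subr_eq0 -normr_le0.
  have := linear_relB lT (hF (x - y)) (linear_relB lT (hF x) (hF y)).
  move=> /bT /le_trans; apply; rewrite /=.
  set w := _ + _; suff -> : w = 0 by rewrite normr0 mulr0.
  rewrite /w !scalerBr; move: (a *: F (x - y)) (a *: F x) (a *: F y) => p q r.
  have -> : x - q - (y - r) = (x - y) - (q - r).
    by rewrite !opprB addrACA [RHS]addrACA; congr (_ + _); exact: addrC.
  by rewrite opprB [x - y - p + _]addrC !subrKA subrr.
have [x y||x|g hg] := @neumann R H (fun x => (a - b) *: F x) (`|a - b| * c) _ _ abc _ f.
- by rewrite FB scalerBr.
- by rewrite mulr_ge0.
- by rewrite normrZ -mulrA ler_wpM2l//; have := bT _ _ (hF x); rewrite subrK.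
exists (F g); have := hF g; congr (T _); congr (_, _).
by rewrite -hg scalerBl opprB addrAC addrA subrK addrC.
Qed.

(** If the real part of [l] is at most [0], the nearest point to [l] on the half-line of nonnegative
    numbers is [0]. *)
Lemma sectorial_bound a b l : 0 <= a -> 0 <= b -> l + l^* <= 0 ->
  `|l| * b <= `|a - l * b|.
Proof.
move=> a0 b0 l0; rewrite -(@ler_pXn2r _ 2) ?nnegrE ?mulr_ge0// exprMn -subr_ge0.
have ac : a^* = a by apply: CrealP; exact: ger0_real.
have bc : b^* = b by apply: CrealP; exact: ger0_real.
have -> : `|a - l * b| ^+ 2 - `|l| ^+ 2 * b ^+ 2 = a * a + a * b * (- (l + l^*)).
  by rewrite !normCK rmorphB rmorphM/= ac bc; ring.
by rewrite addr_ge0// mulr_ge0 ?mulr_ge0// oppr_ge0.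
Qed.

Lemma nonpositiveP T : nonpositive T -> forall u v, T (u, v) -> inner v u <= 0.
Proof.
move=> nT u v Tuv; have := nT (u, - v); rewrite innerNl oppr_ge0; apply.
by exists (u, v).
Qed.

Lemma nonpositive_bound T l : nonpositive T -> l + l^* <= 0 ->
  forall u v, T (u, v) -> `|l| * `|u| <= `|v + l *: u|.
Proof.
move=> nT l0 u v Tuv.
have [->|u0] := eqVneq u 0; first by rewrite normr0 mulr0.
have un : 0 < `|u| by rewrite normr_gt0.
rewrite -(ler_pM2r un); apply: le_trans (cauchy_schwarz (v + l *: u) u).
rewrite innerDl innerZl inner_norm -[leRHS]normrN opprD -mulrA -expr2.
by apply: sectorial_bound => //; rewrite ?exprn_ge0// oppr_ge0 (nonpositiveP nT).
Qed.

(** In the imaginary part of [(v + l u, u)] the two contributions have the same sign, so the one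
    from [l] alone is a lower bound. *)
Lemma half_plane_bound T l : (forall p, T p -> 0 <= 'Im l * 'Im (inner p.2 p.1)) ->
  forall u v, T (u, v) -> `|'Im l| * `|u| <= `|v + l *: u|.
Proof.
move=> dT u v Tuv.
have [l0|l0] := eqVneq ('Im l) 0; first by rewrite l0 normr0 mul0r.
have [->|u0] := eqVneq u 0; first by rewrite normr0 mulr0.
have un : 0 < `|u| by rewrite normr_gt0.
have ln : 0 < `|'Im l| by rewrite normr_gt0.
rewrite -(ler_pM2r un); apply: le_trans (cauchy_schwarz (v + l *: u) u).
have im : `|'Im (inner (v + l *: u) u)| <= `|inner (v + l *: u) u|.
  set z := inner _ _; rewrite -(@ler_pXn2r _ 2) ?nnegrE//.
  rewrite (normC2_Re_Im z) real_normK ?Creal_Im// lerDr.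
  by rewrite real_exprn_even_ge0// Creal_Re.
apply: le_trans im; rewrite -(ler_pM2l ln) -normrM.
rewrite innerDl innerZl inner_norm raddfD/= ImMr ?rpredX ?normr_real// mulrDr.
have d := dT _ Tuv; rewrite /= in d.
have -> : `|'Im l| * (`|'Im l| * `|u| * `|u|) = `|'Im l| ^+ 2 * `|u| ^+ 2 by ring.
have h : 0 <= 'Im l * ('Im l * `|u| ^+ 2).
  by rewrite mulrA -expr2; apply: mulr_ge0; [rewrite real_exprn_even_ge0// Creal_Im|exact: exprn_ge0].
rewrite (ger0_norm (addr_ge0 d h)) real_normK ?Creal_Im//.
by rewrite [X in _ <= _ + X]mulrA -expr2 lerDr.
Qed.

End RelationResolvents.

(** * The resolvent of an inverse Stieltjes family *)

Section InverseStieltjes.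
Context (R : realType) (M : hilbertType R) (N : R[i] -> set (M * M)).
Local Notation C := R[i].
Implicit Types (f g u v : M) (l m : C).

(** [Q l] is [- (N l + l)^-1]. The condition [isr_im] yields the positive kernel, [isr_ge0] and
    [isr_bound] govern the sign and the decay on the negative axis, and [isr_derive] is the analytic
    continuation in the weak relative form that is used. *)
Record inverse_stieltjes_resolvent (Q : C -> M -> M) : Prop := {
  isr_graph : forall l, ~~ (0 <= l) ->
    forall f u, N l (u, f - l *: u) <-> u = - Q l f ;
  isr_linear : forall l, ~~ (0 <= l) -> linear (Q l) ;
  isr_adjoint : forall l, 'Im l != 0 ->
    forall f g, inner (Q l f) g = inner f (Q l^* g) ;
  isr_im : forall l, 0 < 'Im l ->
    forall f, 'Im l * `|Q l f| ^+ 2 <= 'Im (inner (Q l f) f) ;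
  isr_ge0 : forall x : C, x < 0 -> forall f, 0 <= inner (Q x f) f ;
  isr_bound : forall x : C, x < 0 -> forall f, `|x| * `|Q x f| <= `|f| ;
  isr_derive : forall l0, (0 < 'Im l0 \/ l0 < 0) -> forall f, exists D : M,
    forall e : C, 0 < e -> exists d : C, 0 < d /\
      forall l, (0 < 'Im l \/ l < 0) -> `|l - l0| < d ->
        `|Q l f - Q l0 f - (l - l0) *: D| <= e * `|l - l0|
}.

Lemma nonreal_off_axis l : 'Im l != 0 -> ~~ (0 <= l).
Proof. by apply: contraNN => /ger0_real/Creal_ImP ->. Qed.

Lemma neg_off_axis (x : C) : x < 0 -> ~~ (0 <= x).
Proof. by move=> x0; rewrite lt_geF. Qed.

Lemma off_axis_cases l : ~~ (0 <= l) -> [\/ 0 < 'Im l, 'Im l < 0 | l < 0].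
Proof.
move=> l0; have [lr|/Creal_ImP/eqP im] := boolP (l \is Num.real).
  by apply: Or33; rewrite real_ltNge.
have [h|h|h] := real_ltgtP (Creal_Im l) (real0 C); [exact: Or32|exact: Or31|].
by rewrite h eqxx in im.
Qed.

Hypothesis hN : inverse_stieltjes_family N.

Let linN l : ~~ (0 <= l) -> linear_relation (N l). Proof. by case: hN => h _ _ _; exact: h. Qed.

Let signN l : 'Im l != 0 -> forall p, N l p -> 0 <= 'Im l * 'Im (inner p.2 p.1).
Proof.
move=> l0; have [_ [h1 h2 _ _] _ _] := hN.
have := off_axis_cases (nonreal_off_axis l0); case=> [lp|ln|lx] p Np.
- by have [_ d _] := h1 _ lp; rewrite mulr_ge0 ?(ltW lp)//; exact: d.
- by have [_ d _] := h2 _ ln; rewrite mulr_le0 ?(ltW ln)//; exact: d.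
- by move: l0; rewrite (Creal_ImP _ (ltr0_real lx)) eqxx.
Qed.

Let nposN (x : C) : x < 0 -> nonpositive (N x). Proof. by case: hN => _ _ h _; exact: h. Qed.

Let contN (b : bool) : exists m F, [/\ if b then 0 < 'Im m else 'Im m < 0,
  forall l, ((if b then 0 < 'Im l else 'Im l < 0) \/ l < 0) ->
    (forall f u, N l (u, f - m *: u) <-> u = F l f) &
  exists U, holomorphic_on U F /\
    forall l, ((if b then 0 < 'Im l else 'Im l < 0) \/ l < 0) -> U l].
Proof.
have [_ _ _ h] := hN.
have [|m mC [U [F [CU hF hg]]]] := h (if b then upper_half_plane else lower_half_plane).
  by case: b; [left|right].
exists m, F; split.
- by case: b mC {h CU hg}.
- by move=> l lC; apply/inv_shift_graph/hg; case: b lC {h mC CU hg} => -[]; [left|right|left|right].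
- by exists U; split => // l lC; apply: CU; case: b lC {h mC hg} => -[]; [left|right|left|right].
Qed.

Let nonreal_surj l : 'Im l != 0 -> forall f, exists u, N l (u, f - l *: u).
Proof.
move=> l0; have lin := linN (nonreal_off_axis l0).
have := off_axis_cases (nonreal_off_axis l0); case=> [lp|ln|lx].
- have [m [F [mp hF _]]] := contN true.
  apply: (dissipative_surjective lin (hF l _)); first by left.
    move=> p Np; have := signN l0 Np.
    by rewrite pmulr_rge0// => ?; rewrite mulr_ge0// ltW.
  exact: mulr_gt0.
- have [m [F [mn hF _]]] := contN false.
  apply: (dissipative_surjective lin (hF l _)); first by left.
    move=> p Np; have := signN l0 Np.
    by rewrite nmulr_rge0// => ?; rewrite mulr_le0// ltW.
  by rewrite nmulr_rgt0.
- by move: l0; rewrite (Creal_ImP _ (ltr0_real lx)) eqxx.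
Qed.

Let neg_surj (x : C) : x < 0 -> forall f, exists u, N x (u, f - x *: u).
Proof.
move=> x0; have lin := linN (neg_off_axis x0).
have xr : x^* = x by apply: CrealP; exact: ltr0_real.
have [m [F [mp hF _]]] := contN true.
(* The resolvent of [N x] is given only at [m], off the real axis. Surjectivity is carried to [a] in
   the same half-plane, and then to [x]: the bound at [a] is [1 / |a|], and [|a - x| = y < |a|]. *)
pose y := - x / 2; pose a := x + 'i * y.
have y0 : 0 < y by rewrite divr_gt0// oppr_gt0.
have yr : y \is Num.real by exact: gtr0_real.
have ima : 'Im a = y by rewrite Im_rect// ltr0_real.
have ac : a^* = x - 'i * y.
  by rewrite /a rmorphD rmorphM/= xr conjCi (CrealP yr) mulNr.
have na : y < `|a|.
  rewrite -(@ltr_pXn2r _ 2) ?nnegrE ?(ltW y0)// normC2_rect// ?ltr0_real//.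
  by rewrite ltrDr real_exprn_even_gt0 ?ltr0_real//= lt_eqF.
have a0 : 0 < `|a| by apply: lt_trans na.
have surja : forall f, exists u, N x (u, f - a *: u).
  apply: (dissipative_surjective lin (hF x _)); first by right.
    move=> [u v] Np; have := nonpositiveP (nposN x0) Np => /ler0_real/Creal_ImP /= ->.
    by rewrite mulr0.
  by rewrite ima mulr_gt0.
apply: (@shift_surjective _ _ _ a x (`|a|^-1) lin surja).
- move=> u v Nuv; rewrite mulrC ler_pdivlMr// mulrC.
  apply: (nonpositive_bound (nposN x0) _ Nuv).
  by rewrite ac /a addrACA subrr addr0 -mulr2n mulrn_wle0// ltW.
- by rewrite invr_ge0.
- rewrite /a addrC addKr normrM normCi mul1r gtr0_norm// ltr_pdivrMr// mul1r.
  exact: na.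
Qed.

Let neg_bound (x : C) u v : x < 0 -> N x (u, v) -> `|x| * `|u| <= `|v + x *: u|.
Proof.
move=> x0 Nuv; apply: (nonpositive_bound (nposN x0) _ Nuv).
by rewrite (CrealP (ltr0_real x0)) -mulr2n mulrn_wle0// ltW.
Qed.

Let surj l : ~~ (0 <= l) -> forall f, exists u, N l (u, f - l *: u).
Proof.
move=> l0; have [h|h|h] := off_axis_cases l0; last exact: neg_surj.
  by apply: nonreal_surj; rewrite gt_eqF.
by apply: nonreal_surj; rewrite lt_eqF.
Qed.

Let kernel_bound l : ~~ (0 <= l) -> exists c : C, 0 < c /\
  forall u v, N l (u, v) -> c * `|u| <= `|v + l *: u|.
Proof.
move=> l0; have [h|h|h] := off_axis_cases l0.
- exists `|'Im l|; rewrite normr_gt0 gt_eqF//; split => //.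
  by apply: half_plane_bound; apply: signN; rewrite gt_eqF.
- exists `|'Im l|; rewrite normr_gt0 lt_eqF//; split => //.
  by apply: half_plane_bound; apply: signN; rewrite lt_eqF.
- exists `|l|; rewrite normr_gt0 lt_eqF//; split => // u v; exact: neg_bound.
Qed.

Let exT : exists T : C -> M -> M, forall l, ~~ (0 <= l) ->
  forall f u, N l (u, f - l *: u) <-> u = T l f.
Proof.
have /choice[T hT] (lf : C * M) : exists u, ~~ (0 <= lf.1) -> N lf.1 (u, lf.2 - lf.1 *: u).
  have [l0|l0] := boolP (0 <= lf.1); first by exists 0.
  by have [u hu] := surj l0 lf.2; exists u.
exists (fun l f => T (l, f)) => l l0 f u; split=> [h|->]; last exact: (hT (l, f)).
have [c [c0 hc]] := kernel_bound l0.
have := hc _ _ (linear_relB (linN l0) h (hT (l, f) l0)).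
rewrite /= opprB scalerBr [f - _ + _]addrC !subrKA subrr.
by rewrite normr0 pmulr_rle0// normr_le0 subr_eq0 => /eqP.
Qed.

Let bounded_ge0 (F : M -> M) : bounded_operator F ->
  exists c : C, 0 <= c /\ forall f, `|F f| <= c * `|f|.
Proof.
move=> [_ [c hc]]; exists `|c|; split => // f; have h := hc f.
by rewrite -[X in _ * X]normr_id -normrM ger0_norm//; exact: le_trans h.
Qed.

Let real_small (d : C) K : 0 <= K -> 0 < d -> d / (K + 1) * K <= d.
Proof.
move=> K0 d0; have K1 : 0 < K + 1 by rewrite ltr_wpDl.
by rewrite mulrAC ler_pdivrMr// ler_wpM2l ?(ltW d0)// lerDl.
Qed.

(** The hypothesis concerns [F l = (N l + m)^-1] with a fixed shift, whereas in [T l = (N l + l)^-1]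
    the shift moves with [l]. The identities [TF] and [FT] between them give in turn a locally
    uniform bound, a Lipschitz estimate and the derivative of [T]. *)
Let diffT (T : C -> M -> M) :
  (forall l, ~~ (0 <= l) -> forall f u, N l (u, f - l *: u) <-> u = T l f) ->
  forall l0, (0 < 'Im l0 \/ l0 < 0) -> forall f, exists D : M,
    forall e : C, 0 < e -> exists d : C, 0 < d /\
      forall l, (0 < 'Im l \/ l < 0) -> `|l - l0| < d ->
        `|T l f - T l0 f - (l - l0) *: D| <= e * `|l - l0|.
Proof.
move=> hT l0 Zl0.
pose Z l := 0 < 'Im l \/ l < 0.
have Zoff l : Z l -> ~~ (0 <= l).
  by case=> h; [apply: nonreal_off_axis; rewrite gt_eqF|exact: neg_off_axis].
have [m [F [mp hF [U [[_ holF] ZU]]]]] := contN true.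
have lT l : Z l -> linear (T l).
  by move=> Zl; exact: (resolvent_linear (linN (Zoff _ Zl)) (hT _ (Zoff _ Zl))).
have TB l : Z l -> {morph T l : x y / x - y} by move=> /lT/linear_additive.
have TD l : Z l -> {morph T l : x y / x + y}.
  by move=> /lT h x y; have := h 1 x y; rewrite !scale1r.
have TZ l : Z l -> forall a x, T l (a *: x) = a *: T l x.
  move=> Zl a x; have := lT _ Zl a x 0; rewrite !addr0 => ->.
  by have := TB _ Zl 0 0; rewrite !subrr => ->; rewrite addr0.
have TF l : Z l -> forall f, T l f = F l (f + (m - l) *: T l f).
  move=> Zl f; apply/(hF _ Zl); rewrite scalerBl addrA addrAC addrK.
  by apply/(hT _ (Zoff _ Zl)).
have FT l : Z l -> forall g, F l g = T l (g + (l - m) *: F l g).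
  move=> Zl g; apply/(hT _ (Zoff _ Zl)); rewrite scalerBl addrA addrAC addrK.
  by apply/(hF _ Zl).
have [bF [D bD hD]] := holF _ (ZU _ Zl0).
have [cF [cF0 hcF]] := bounded_ge0 bF; have [cD [cD0 hcD]] := bounded_ge0 bD.
have [c [c0 hc]] := kernel_bound (Zoff _ Zl0).
have hT0 x : `|T l0 x| <= c^-1 * `|x|.
  have := hc _ _ (proj2 (hT _ (Zoff _ Zl0) x _) erefl).
  by rewrite subrK ler_pdivlMl.
have diffF e : 0 < e -> exists d : C, 0 < d /\ forall l, `|l - l0| < d ->
    forall x, `|F l x - F l0 x - (l - l0) *: D x| <= e * `|l - l0| * `|x|.
  move=> /hD/nbhs_ballP[d /= d0 hd]; exists d; split => // l ld.
  by apply: hd; rewrite -ball_normE/= distrC.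
pose K1 := 1 + cD.
have K10 : 0 <= K1 by rewrite addr_ge0.
have [d1 [d10 hd1]] := diffF 1 ltr01.
have lipF l : `|l - l0| < d1 -> forall x, `|F l x - F l0 x| <= K1 * `|l - l0| * `|x|.
  move=> ld x; rewrite -[F l x - F l0 x](subrK ((l - l0) *: D x)).
  apply: (le_trans (ler_normD _ _)); rewrite /K1 !mulrDl lerD//.
    exact: hd1.
  by rewrite normrZ [cD * _]mulrC -mulrA ler_wpM2l.
pose A := `|l0 - m| + 1.
have A0 : 0 < A by rewrite ltr_wpDl.
pose kap := 1 + `|l0 - m| * c^-1.
have kap0 : 0 < kap by rewrite ltr_pwDl// mulr_ge0// invr_ge0 ltW.
pose K2 := A * K1 + cF.
have K20 : 0 <= K2 by rewrite addr_ge0// mulr_ge0// ltW.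
pose d2 := (2 * kap)^-1 / (K2 + 1).
have K21 : 0 < K2 + 1 by rewrite ltr_wpDl.
have k2 : 0 < (2 * kap)^-1 by rewrite invr_gt0 mulr_gt0.
have d20 : 0 < d2 by rewrite divr_gt0.
pose near l := [/\ `|l - l0| < d1, `|l - l0| < d2 & `|l - l0| < 1].
have Anear l : near l -> `|l - m| <= A.
  case=> _ _ h; rewrite -(subrK l0 l) -addrA; apply: (le_trans (ler_normD _ _)).
  by rewrite /A [leLHS]addrC lerD2l ltW.
pose K := (cF + K1) * (2 * kap).
have K0 : 0 <= K by rewrite mulr_ge0 ?addr_ge0// mulr_ge0// ltW.
(* [1 + (l - m) F l] is compared with its value at [l0], whose inverse is bounded by [kap]; the
   radius [d2] makes the perturbation absorb only half of [|g|]. *)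
have unif l : Z l -> near l -> forall x, `|T l x| <= K * `|x|.
  move=> Zl nl x; have [n1 n2 n3] := nl.
  pose g := x + (m - l) *: T l x.
  have Fg : F l g = T l x by rewrite -TF.
  have xE : x = g + (l - m) *: F l g by rewrite Fg /g -addrA -scalerDl addrA subrK subrr scale0r addr0.
  pose y := g + (l0 - m) *: F l0 g.
  have gy : `|g| <= kap * `|y|.
    have gE : g = y - (l0 - m) *: T l0 y by rewrite -FT// /y addrK.
    rewrite [in leLHS]gE; apply: (le_trans (ler_normB _ _)).
    rewrite normrZ mulrDl mul1r lerD2l -mulrA ler_wpM2l//.
  have xy : `|y - x| <= (2 * kap)^-1 * `|g|.
    have -> : y - x = (l0 - l) *: F l0 g + (l - m) *: (F l0 g - F l g).
      rewrite [in LHS]xE /y opprD addrACA subrr add0r scalerBr addrA -scalerDl.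
      by rewrite addrA subrK.
    apply: (le_trans (ler_normD _ _)); rewrite !normrZ.
    apply: (@le_trans _ _ (`|l - l0| * K2 * `|g|)).
      rewrite /K2 mulrDr mulrDl addrC lerD//.
        apply: (@le_trans _ _ (A * (K1 * `|l - l0| * `|g|))).
          by apply: ler_pM => //; [exact: Anear|rewrite distrC; exact: lipF].
        by rewrite le_eqVlt; apply/orP; left; apply/eqP; ring.
      by rewrite distrC -mulrA ler_wpM2l.
    rewrite ler_wpM2r//; apply: le_trans (real_small K20 k2).
    by rewrite ler_wpM2r// ltW.
  have gx : `|g| <= 2 * kap * `|x|.
    have h : `|g| <= kap * (`|x| + (2 * kap)^-1 * `|g|).
      apply: (le_trans gy); rewrite ler_wpM2l ?(ltW kap0)//.
      by rewrite -[y](subrK x) addrC (le_trans (ler_normD _ _))// lerD2l.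
    have e1 (k a b : C) : k != 0 -> k * (a + (2 * k)^-1 * b) = k * a + b / 2.
      by move=> k0; field.
    move: h; rewrite e1 ?gt_eqF// -subr_ge0.
    have -> : kap * `|x| + `|g| / 2 - `|g| = 2^-1 * (2 * kap * `|x| - `|g|) by field.
    by rewrite pmulr_rge0 ?invr_gt0// subr_ge0.
  rewrite -Fg -[F l g](subrK (F l0 g)); apply: (le_trans (ler_normD _ _)).
  apply: (@le_trans _ _ ((cF + K1) * `|g|)).
    rewrite mulrDl [X in _ <= X]addrC lerD// (le_trans (lipF _ n1 _))// ler_wpM2r//.
    by rewrite ler_piMr// ltW.
  by rewrite /K -mulrA ler_wpM2l// addr_ge0.
(* The vector [g0] is fixed and satisfies [F l0 g0 = u0], so the increment of [T l f] is written
   through that of [F l g0]. *)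
have key l f : Z l -> let u0 := T l0 f in let g0 := f + (m - l0) *: u0 in
   T l f = F l g0 - (l - l0) *: T l u0 - (l - m) *: T l (F l g0 - u0).
  move=> Zl u0 g0.
  have e : g0 + (l - m) *: F l g0 = f + (l - l0) *: u0 + (l - m) *: (F l g0 - u0).
    rewrite /g0 scalerBr addrA [RHS]addrAC; congr (_ + _).
    by rewrite -[RHS]addrA -scalerBl; congr (f + _ *: _); ring.
  have := FT _ Zl g0; rewrite e (TD _ Zl) (TD _ Zl f) !(TZ _ Zl) => h.
  rewrite {1}h; move: ((l - l0) *: T l u0) ((l - m) *: T l _) => a b.
  by rewrite [_ + b - a]addrAC !addrK.
have Fg0 f : F l0 (f + (m - l0) *: T l0 f) = T l0 f by rewrite -TF.
have lipT f : exists Kf : C, 0 <= Kf /\ forall l, Z l -> near l ->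
    `|T l f - T l0 f| <= `|l - l0| * Kf.
  pose u0 := T l0 f; pose g0 := f + (m - l0) *: u0.
  exists (K1 * `|g0| + K * `|u0| + A * (K * (K1 * `|g0|))); split.
    have A0' := ltW A0; apply: addr_ge0; first by apply: addr_ge0; exact: mulr_ge0.
    by apply: mulr_ge0 => //; apply: mulr_ge0 => //; exact: mulr_ge0.
  move=> l Zl nl; have [n1 _ _] := nl.
  have hp : `|F l g0 - u0| <= K1 * `|l - l0| * `|g0| by rewrite /u0 -Fg0; exact: lipF.
  have := key l f Zl => /= ->; rewrite -/u0 -/g0.
  have -> : F l g0 - (l - l0) *: T l u0 - (l - m) *: T l (F l g0 - u0) - u0 =
    (F l g0 - u0) - (l - l0) *: T l u0 - (l - m) *: T l (F l g0 - u0).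
    by rewrite addrAC [F l g0 - _ - u0]addrAC.
  apply: (le_trans (ler_normB _ _)); rewrite mulrDr lerD//.
    apply: (le_trans (ler_normB _ _)); rewrite mulrDr lerD//.
      by rewrite mulrCA mulrA.
    by rewrite normrZ ler_wpM2l// unif.
  rewrite normrZ; apply: (@le_trans _ _ (A * (K * (K1 * `|l - l0| * `|g0|)))).
    apply: ler_pM => //; first exact: Anear.
    by apply: (le_trans (unif _ Zl nl _)); rewrite ler_wpM2l.
  by rewrite le_eqVlt; apply/orP; left; apply/eqP; ring.
move=> f; pose u0 := T l0 f; pose g0 := f + (m - l0) *: u0; pose y := D g0.
have [Ku [Ku0 hKu]] := lipT u0; have [Ky [Ky0 hKy]] := lipT y.
(* The formal derivative of [key] at [l0], where [y] is the derivative of [F l g0]. *)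
exists (y - T l0 u0 - (l0 - m) *: T l0 y) => e e0.
pose P := `|g0| * (1 + A * K).
have P0 : 0 <= P by rewrite mulr_ge0// addr_ge0// mulr_ge0// ltW.
pose B := Ku + A * Ky + `|T l0 y|.
have B0 : 0 <= B by rewrite !addr_ge0// mulr_ge0// ltW.
have e20 : 0 < e / 2 by rewrite divr_gt0.
have P1 : 0 < P + 1 by rewrite ltr_wpDl.
have B1 : 0 < B + 1 by rewrite ltr_wpDl.
have [d3 [d30 hd3]] := diffF _ (divr_gt0 e20 P1).
have eB : 0 < e / 2 / (B + 1) by rewrite divr_gt0.
have min2 (a b : C) : 0 < a -> 0 < b -> exists d : C, [/\ 0 < d, d <= a & d <= b].
  move=> /complex_gt0E[-> a0] /complex_gt0E[-> b0].
  exists (Num.min (complex.Re a) (complex.Re b))%:C%C.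
  by rewrite ltcR lt_min a0 b0 !lecR !ge_min !lexx orbT.
have [e1 [e10 e1a e1b]] := min2 _ _ d10 d20.
have [e2 [e20' e2a e2b]] := min2 _ _ d30 eB.
have [e3 [e30 e3a e3b]] := min2 _ _ e10 e20'.
have [e4 [e40 e4a e4b]] := min2 _ _ e30 ltr01.
exists e4; split => // l Zl ld.
have nl : near l.
  split; last exact: (lt_le_trans ld).
    by apply: (lt_le_trans ld); apply: (le_trans e4a); exact: le_trans e3a e1a.
  by apply: (lt_le_trans ld); apply: (le_trans e4a); exact: le_trans e3a e1b.
have ld3 : `|l - l0| < d3.
  by apply: (lt_le_trans ld); apply: (le_trans e4a); exact: le_trans e3b e2a.
have ldB : `|l - l0| <= e / 2 / (B + 1).
  by apply: ltW; apply: (lt_le_trans ld); apply: (le_trans e4a); exact: le_trans e3b e2b.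
pose r := F l g0 - u0 - (l - l0) *: y.
have hr : `|r| <= e / 2 / (P + 1) * `|l - l0| * `|g0|.
  by rewrite /r /u0 -Fg0; exact: hd3.
have Fr : F l g0 - u0 = (l - l0) *: y + r by rewrite /r [RHS]addrC subrK.
have -> : T l f - T l0 f - (l - l0) *: (y - T l0 u0 - (l0 - m) *: T l0 y) =
  r - (l - m) *: T l r - ((l - l0) *: (T l u0 - T l0 u0)
    + (l - l0) *: ((l - m) *: (T l y - T l0 y) + (l - l0) *: T l0 y)).
  have := key l f Zl => /= ->; rewrite -/u0 -/g0 Fr (TD _ Zl) (TZ _ Zl).
  have -> : F l g0 = (l - l0) *: y + r + u0 by rewrite -Fr subrK.
  by apply: inner_eq => z; rewrite !(innerBl, innerDl, innerZl); ring.
rewrite (_ : e * `|l - l0| = e / 2 * `|l - l0| + e / 2 * `|l - l0|); last by field.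
apply: (le_trans (ler_normB _ _)); rewrite lerD//.
  apply: (@le_trans _ _ (e / 2 / (P + 1) * P * `|l - l0|)); last first.
    by rewrite ler_wpM2r// real_small.
  apply: (le_trans (ler_normB _ _)).
  have -> : e / 2 / (P + 1) * P * `|l - l0| = e / 2 / (P + 1) * `|l - l0| * `|g0| +
     A * (K * (e / 2 / (P + 1) * `|l - l0| * `|g0|)).
    by rewrite {2}/P; ring.
  rewrite lerD// normrZ; apply: ler_pM => //; first exact: Anear.
  by apply: (le_trans (unif _ Zl nl _)); rewrite ler_wpM2l.
apply: (@le_trans _ _ (e / 2 / (B + 1) * B * `|l - l0|)); last first.
  by rewrite ler_wpM2r// real_small.
apply: (@le_trans _ _ (`|l - l0| * B * `|l - l0|)); last first.
  by rewrite ler_wpM2r// ler_wpM2r.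
rewrite -scalerDr normrZ -mulrA ler_wpM2l//.
have -> : B * `|l - l0| = `|l - l0| * Ku + (A * (`|l - l0| * Ky) + `|l - l0| * `|T l0 y|).
  by rewrite /B; ring.
apply: (le_trans (ler_normD _ _)); rewrite lerD//; first exact: (hKu _ Zl nl).
apply: (le_trans (ler_normD _ _)); rewrite !normrZ lerD//.
by apply: ler_pM => //; [exact: Anear|exact: (hKy _ Zl nl)].
Qed.

Lemma inverse_stieltjes_resolvent_exists : exists Q, inverse_stieltjes_resolvent Q.
Proof.
have [T hT] := exT.
have lT l : ~~ (0 <= l) -> linear (T l).
  by move=> l0; exact: (resolvent_linear (linN l0) (hT _ l0)).
have Tin l : ~~ (0 <= l) -> forall f, N l (T l f, f - l *: T l f).
  by move=> l0 f; apply/(hT _ l0).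
exists (fun l f => - T l f); split.
- by move=> l l0 f u; rewrite opprK; exact: hT.
- by move=> l /lT h a x y; rewrite h opprD scalerN.
- move=> l l0 f g; have lc : 'Im l^* != 0 by rewrite Im_conj oppr_eq0.
  have [_ [_ _ adj _] _ _] := hN.
  have lr : l \isn't Num.real by apply: contra l0 => /Creal_ImP ->.
  have := Tin _ (nonreal_off_axis lc) g; rewrite -adj// => /(_ _ (Tin _ (nonreal_off_axis l0) f)).
  rewrite /= innerBl innerBr innerZl innerZr conjCK => h.
  rewrite innerNl innerNr; congr (- _).
  by apply/esym; move: h => /(congr1 (+%R^~ (l * inner (T l f) (T l^* g)))); rewrite !subrK.
- move=> l lp f; have l0 : 'Im l != 0 by rewrite gt_eqF.
  have := signN l0 (Tin _ (nonreal_off_axis l0) f).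
  rewrite pmulr_rge0// innerBl innerZl inner_norm raddfB/= ImMr ?rpredX ?normr_real//.
  rewrite subr_ge0 normrN => /le_trans; apply.
  by rewrite innerNl raddfN/= [inner (T l f) f]innerC Im_conj opprK.
- move=> x x0 f; have := nonpositiveP (nposN x0) (Tin _ (neg_off_axis x0) f).
  rewrite innerBl innerZl inner_norm => h.
  have e : inner f (T x f) <= 0.
    rewrite -[inner f _](subrK (x * `|T x f| ^+ 2)).
    by apply: (le_trans (lerD h (_ : _ <= 0))); rewrite ?addr0// nmulr_rle0// exprn_ge0.
  rewrite innerNl oppr_ge0 innerC.
  by rewrite (CrealP (ler0_real e)).
- move=> x x0 f; have := neg_bound x0 (Tin _ (neg_off_axis x0) f).
  by rewrite subrK normrN.
- move=> l0 Zl0 f; have [D hD] := diffT hT Zl0 f.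
  exists (- D) => e /hD[d [d0 hd]]; exists d; split => // l Zl ld.
  by rewrite scalerN -!opprD normrN; exact: hd.
Qed.

End InverseStieltjes.

(** * Uniqueness *)

Section Approximation.
Context (R : realType) (H : hilbertType R) (X : Type) (v : X -> H).
Local Notation C := R[i].

Definition approximable (h : H) := forall e : C, 0 < e -> exists l, `|h - lcomb v l| < e.

Lemma approximable_linear (a : C) h g : approximable h -> approximable g -> approximable (a *: h + g).
Proof.
move=> ah ag e e0; have a1 : 0 < `|a| + 1 by rewrite ltr_wpDl.
have e1 : 0 < e / (`|a| + 1) by rewrite divr_gt0.
have [l hl] := ah _ e1; have [k hk] := ag _ e1.
exists (lscale a l ++ k); rewrite lcomb_cat lcomb_scale opprD addrACA -scalerBr.
apply: (le_lt_trans (ler_normD _ _)); rewrite normrZ.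
apply: (@lt_le_trans _ _ (`|a| * (e / (`|a| + 1)) + e / (`|a| + 1))).
  by rewrite ler_ltD// ler_wpM2l// ltW.
by rewrite -[X in _ + X]mul1r -mulrDl mulrC mulfVK// gt_eqF.
Qed.

Lemma approximable_gen x : approximable (v x).
Proof. by move=> e e0; exists [:: (1, x)]; rewrite lcomb1 subrr normr0. Qed.

Lemma approximable0 : approximable 0.
Proof. by move=> e e0; exists [::]; rewrite lcomb_nil subrr normr0. Qed.

Lemma approximable_closed h :
  (forall e : C, 0 < e -> exists g, approximable g /\ `|h - g| < e) -> approximable h.
Proof.
move=> ah e e0; have e2 : 0 < e / 2 by rewrite divr_gt0.
have [g [ag hg]] := ah _ e2; have [l hl] := ag _ e2; exists l.
have -> : h - lcomb v l = (h - g) + (g - lcomb v l) by rewrite subrKA.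
by apply: (le_lt_trans (ler_normD _ _)); rewrite (splitr e) ltrD.
Qed.

End Approximation.

Section Selfadjoint.
Context (R : realType) (H : hilbertType R) (A : set (H * H)).
Local Notation C := R[i].
Hypotheses (lA : linear_relation A) (sA : selfadjoint A).

Lemma selfadjoint_sym p q : A p -> A q -> inner p.2 q.1 = inner p.1 q.2.
Proof. by move=> Ap; rewrite {1}sA => /(_ _ Ap). Qed.

Lemma selfadjoint_in k : (forall h, A h -> inner h.2 k.1 = inner h.1 k.2) -> A k.
Proof. by move=> h; rewrite sA. Qed.

Lemma selfadjoint_Im p : A p -> 'Im (inner p.2 p.1) = 0.
Proof.
move=> Ap; apply/Creal_ImP/CrealP; rewrite -innerC.
by rewrite (selfadjoint_sym Ap Ap).
Qed.

Lemma selfadjoint_bound (l : C) u g : A (u, g + l *: u) -> `|'Im l| * `|u| <= `|g|.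
Proof.
move=> Au; have := @half_plane_bound _ _ A (- l) _ _ _ Au.
rewrite raddfN/= normrN scaleNr addrK; apply.
by move=> p /selfadjoint_Im ->; rewrite mulr0.
Qed.

(** The difference [w - u] solves the equation at [m] with right side [(m - l) u]. For [m = l] this
    is uniqueness of the resolvent vector; otherwise it is continuity in the parameter. *)
Lemma selfadjoint_near (l m : C) u w g : A (u, g + l *: u) -> A (w, g + m *: w) ->
  `|'Im m| * `|w - u| <= `|m - l| * `|u|.
Proof.
move=> Au Aw; rewrite -[leRHS]normrZ; apply: selfadjoint_bound.
have := linear_relB lA Aw Au; congr (A _); congr (_, _) => /=.
by apply: inner_eq => z; rewrite !(innerBl, innerDl, innerNl, innerZl); ring.
Qed.

End Selfadjoint.

Section OrthogonalSums.
Context (R : realType) (M K : hilbertType R).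
Local Notation inl := (@hsum_inl R M K).

Lemma hsum_innerE (x y : hsum M K) : inner x y = inner x.1 y.1 + inner x.2 y.2.
Proof. by []. Qed.

Lemma inner_inl (x : hsum M K) f : inner x (inl f) = inner x.1 f.
Proof. by rewrite hsum_innerE inner0r addr0. Qed.

End OrthogonalSums.

Section Uniqueness.
Context (R : realType) (M : hilbertType R) (N : R[i] -> set (M * M)).
Local Notation C := R[i].
Variable Q : C -> M -> M.
Hypothesis hQ : inverse_stieltjes_resolvent N Q.
Implicit Types (f g : M) (l m : C).

Lemma model_graph l : ~~ (0 <= l) ->
  rel_opp (rel_inv (rel_shift (N l) l)) = graph (Q l).
Proof.
move=> l0; apply/seteqP; split=> -[f u].
  move=> [[f' u'] /inv_shiftP/(isr_graph hQ l0) -> [<- <-]].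
  by rewrite /graph/= opprK.
rewrite /graph/= => ->; exists (f, - Q l f) => /=; last by rewrite opprK.
by apply/inv_shiftP/(isr_graph hQ l0).
Qed.

Let Im_i : 'Im ('i : C) = 1. Proof. exact: Im_i. Qed.
Let i0 : 'Im ('i : C) != 0. Proof. by rewrite Im_i oner_eq0. Qed.

Section Model.
Context (K : hilbertType R) (A : set (hsum M K * hsum M K)).
Hypothesis mA : is_minimal_model N A.
Local Notation H := (hsum M K).
Local Notation inl := (@hsum_inl R M K).

Lemma model_linear : linear_relation A. Proof. by case: mA. Qed.
Lemma model_selfadjoint : selfadjoint A. Proof. by case: mA. Qed.

Lemma model_resolvent_ex : exists r : C -> M -> H, forall l, 'Im l != 0 ->
  forall f, A (r l f, inl f + l *: r l f) /\ (r l f).1 = Q l f.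
Proof.
have [_ _ _ _ cA] := mA.
have /choice[r hr] (lf : C * M) : exists h : H, 'Im lf.1 != 0 ->
    A (h, inl lf.2 + lf.1 *: h) /\ h.1 = Q lf.1 lf.2.
  have [l0|l0] := eqVneq ('Im lf.1) 0; first by exists 0.
  have := cA _ (nonreal_off_axis l0); rewrite model_graph ?nonreal_off_axis//.
  move=> /seteqP[_ /(_ (lf.2, Q lf.1 lf.2) erefl)] [k /=].
  move=> /inv_shiftP; rewrite scaleNr opprK => Ak.
  by exists (Q lf.1 lf.2, k).
by exists (fun l f => r (l, f)) => l l0 f; exact: (hr (l, f)).
Qed.

Definition model_resolvent := projT1 (cid model_resolvent_ex).
Local Notation r := model_resolvent.

Lemma model_resolventP l f : 'Im l != 0 -> A (r l f, inl f + l *: r l f).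
Proof. by move=> l0; have [] := projT2 (cid model_resolvent_ex) l l0 f. Qed.

Lemma model_resolvent_fst l f : 'Im l != 0 -> (r l f).1 = Q l f.
Proof. by move=> l0; have [] := projT2 (cid model_resolvent_ex) l l0 f. Qed.

(* The point ['i] is left out because [model_core] applies [(A - 'i)^-1] to these
   vectors; the omitted ones are limits of the others. *)
Definition model_gen (x : M + C * M) : H :=
  match x with
  | Datatypes.inl f => inl f
  | inr (l, f) => if ('Im l != 0) && (l != 'i) then r l f else 0
  end.

Lemma model_resolvent_near l f (t : C) : 'Im l != 0 -> 0 < t ->
  `|'Im l| * `|r (l + t) f - r l f| <= t * `|r l f|.
Proof.
move=> l0 t0; have lt : 'Im (l + t) = 'Im l.
  by rewrite raddfD/= (Creal_ImP _ (gtr0_real t0)) addr0.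
have := selfadjoint_near model_linear model_selfadjoint (model_resolventP f l0)
   (model_resolventP f (_ : 'Im (l + t) != 0)).
by rewrite lt (addrAC l) subrr add0r (gtr0_norm t0); exact.
Qed.

Lemma model_approximable l f : 'Im l != 0 -> approximable model_gen (r l f).
Proof.
move=> l0; have [li|li] := eqVneq l 'i; last first.
  have := approximable_gen model_gen (inr (l, f)); by rewrite /= l0 li.
apply: approximable_closed => e e0.
have d0 : 0 < `|r l f| + 1 by rewrite ltr_wpDl.
pose t := e / (`|r l f| + 1); have t0 : 0 < t by rewrite divr_gt0.
exists (r (l + t) f); split.
  have := approximable_gen model_gen (inr (l + t, f)) => /=.
  rewrite raddfD/= (Creal_ImP _ (gtr0_real t0)) addr0 l0/= li.
  by rewrite -subr_eq0 (addrAC 'i) subrr add0r gt_eqF.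
have := model_resolvent_near f l0 t0; rewrite {1}li Im_i normr1 mul1r distrC => h.
by apply: (le_lt_trans h); rewrite /t mulrAC ltr_pdivrMr// ltr_pM2l// ltrDl.
Qed.

Lemma model_total : total model_gen.
Proof.
have [_ _ _ minA _] := mA.
move=> h; apply: approximable_closed => e e0.
have : closure (linear_span [set x | exists (l : R[i]) (f g : M) (h : hsum M K),
      [/\ l \isn't Num.real, resolvent A l (inl g, h) & x = inl f + h]]) h.
  by move: minA; rewrite /minimal => ->.
move=> /(_ (ball h e)); case; first exact: nbhsx_ballx.
move=> y [[n [a [s [hs ->]]]] hy]; exists (\sum_i a i *: s i); split; last first.
  by move: hy; rewrite -ball_normE.
apply: (big_ind (approximable model_gen)).
- exact: approximable0.
- by move=> x y' ax ay; have := approximable_linear 1 ax ay; rewrite scale1r.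
move=> i _; have [l [f [g [h' [lr Ah ->]]]]] := hs i.
have l0 : 'Im l != 0 by apply/negP => /eqP/Creal_ImP h0; rewrite h0 in lr.
have -> : h' = r l g.
  move/inv_shiftP: Ah; rewrite scaleNr opprK => Ah.
  have := selfadjoint_near model_linear model_selfadjoint (model_resolventP g l0) Ah.
  by rewrite subrr normr0 mul0r pmulr_rle0 ?normr_gt0// normr_le0 subr_eq0 => /eqP.
have af : approximable model_gen (inl f) := approximable_gen model_gen (Datatypes.inl f).
have := approximable_linear (a i) (approximable_linear 1 af (model_approximable g l0)) (approximable0 _).
by rewrite scale1r addr0.
Qed.

End Model.
End Uniqueness.

Lemma selfadjoint_closed (R : realType) (H : hilbertType R) (A : set (H * H)) k : selfadjoint A ->
  (forall e : R[i], 0 < e -> exists h, [/\ A h, `|k.1 - h.1| <= e & `|k.2 - h.2| <= e]) -> A k.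
Proof.
move=> sA kA; apply: (selfadjoint_in sA) => h Ah; apply/eqP; rewrite -subr_eq0; apply/eqP.
apply: (@small_eq0 R (R[i]^o) _ (`|h.2| + `|h.1|)) => e e0; have [p [Ap p1 p2]] := kA e e0.
have -> : inner h.2 k.1 - inner h.1 k.2 = inner h.2 (k.1 - p.1) - inner h.1 (k.2 - p.2).
  by rewrite !innerBr (selfadjoint_sym sA Ah Ap); ring.
rewrite mulrDl; apply: (le_trans (ler_normB _ _)); apply: lerD.
  by apply: (le_trans (cauchy_schwarz _ _)); rewrite ler_wpM2l.
by apply: (le_trans (cauchy_schwarz _ _)); rewrite ler_wpM2l.
Qed.

(** * The unitary between two models *)

Section ModelGram.
Context (R : realType) (M : hilbertType R) (N : R[i] -> set (M * M)).
Local Notation C := R[i].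
Variable Q : C -> M -> M.
Hypothesis hQ : inverse_stieltjes_resolvent N Q.
Implicit Types (f g : M) (l m : C).

Let i0 : 'Im ('i : C) != 0. Proof. by rewrite Im_i oner_eq0. Qed.

Let Im_shift l (t : C) : 0 < t -> 'Im (l + t) = 'Im l.
Proof. by move=> t0; rewrite raddfD/= (Creal_ImP _ (gtr0_real t0)) addr0. Qed.

Section Core.
Context (K : hilbertType R) (A : set (hsum M K * hsum M K)).
Hypothesis mA : is_minimal_model N A.
Local Notation r := (model_resolvent hQ mA).
Local Notation inl := (@hsum_inl R M K).

Lemma model_inner l m f g : 'Im l != 0 -> 'Im m != 0 ->
  (l - m^*) * inner (r l f) (r m g) = inner (Q l f) g - inner f (Q m g).
Proof.
move=> l0 m0; have h := selfadjoint_sym (model_selfadjoint mA)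
  (model_resolventP hQ mA f l0) (model_resolventP hQ mA g m0).
rewrite /= innerDl innerDr innerZl innerZr inner_inl model_resolvent_fst// in h.
rewrite (innerC (inl f)) inner_inl model_resolvent_fst// -innerC in h.
have -> : inner (Q l f) g = inner f (Q m g) + l * inner (r l f) (r m g) - m^* * inner (r l f) (r m g).
  by rewrite h addrK.
by ring.
Qed.

(** The vectors [(A - 'i)^-1] applied to [model_gen], made explicit by the resolvent identity so
    that the unitary can be evaluated on them. *)
Definition model_core (x : M + C * M) : hsum M K :=
  match x with
  | Datatypes.inl f => r 'i f
  | inr (l, f) =>
    if ('Im l != 0) && (l != 'i) then (l - 'i)^-1 *: (r l f - r 'i f) else 0
  end.

Lemma model_coreP x : A (model_core x, model_gen hQ mA x + 'i *: model_core x).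
Proof.
have lA := model_linear mA.
case: x => [f|[l f]]; first exact: model_resolventP.
rewrite /model_core /model_gen; case: ifP => [/andP[l0 li]|_]; last first.
  by rewrite scaler0 addr0; case: lA.
have := linear_relZ (l - 'i)^-1 lA (linear_relB lA (model_resolventP hQ mA f l0)
  (model_resolventP hQ mA f i0)).
congr (A _); congr (_, _) => /=; apply: inner_eq => z.
rewrite !(innerBl, innerDl, innerNl, innerZl); field.
by rewrite subr_eq0.
Qed.

Lemma model_core_lcomb s :
  A (lcomb model_core s, lcomb (model_gen hQ mA) s + 'i *: lcomb model_core s).
Proof.
elim: s => [|[a x] s ih]; first by rewrite !lcomb_nil scaler0 addr0; case: (model_linear mA).
have := (model_linear mA).2 a _ _ (model_coreP x) ih.
congr (A _); rewrite /lcomb !big_cons; congr (_, _) => /=; apply: inner_eq => z.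
by rewrite !(innerDl, innerZl); ring.
Qed.

End Core.


Section Transfer.
Context (K1 K2 : hilbertType R).
Context (A1 : set (hsum M K1 * hsum M K1)) (A2 : set (hsum M K2 * hsum M K2)).
Hypotheses (mA1 : is_minimal_model N A1) (mA2 : is_minimal_model N A2).
Local Notation r1 := (model_resolvent hQ mA1).
Local Notation r2 := (model_resolvent hQ mA2).
Local Notation gen1 := (model_gen hQ mA1).
Local Notation gen2 := (model_gen hQ mA2).
Local Notation core1 := (model_core mA1).
Local Notation core2 := (model_core mA2).

(** [model_inner] is void when [l = m^*]. That case is the limit of [l + t] with [t] real, a shift
    which leaves the imaginary part, and so the resolvent bound, unchanged. *)
Lemma model_inner_eq l m f g : 'Im l != 0 -> 'Im m != 0 ->
  inner (r1 l f) (r1 m g) = inner (r2 l f) (r2 m g).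
Proof.
move=> l0 m0.
have off l' : 'Im l' != 0 -> l' != m^* ->
    inner (r1 l' f) (r1 m g) = inner (r2 l' f) (r2 m g).
  move=> l'0; rewrite -subr_eq0 => lm; apply: (mulfI lm).
  by rewrite !model_inner.
have [lm|] := eqVneq l m^*; last exact: off.
have ln : 0 < `|'Im l| by rewrite normr_gt0.
apply/eqP; rewrite -subr_eq0; apply/eqP.
apply: (@small_eq0 R (R[i]^o) _ ((`|r1 l f| * `|r1 m g| + `|r2 l f| * `|r2 m g|) / `|'Im l|)) => t t0.
have lt0 : 'Im (l + t) != 0 by rewrite Im_shift.
have := off (l + t) lt0; rewrite -subr_eq0 {1}lm addrAC subrr add0r gt_eqF// => /(_ isT) e.
have -> : inner (r1 l f) (r1 m g) - inner (r2 l f) (r2 m g) =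
    inner (r2 (l + t) f - r2 l f) (r2 m g) - inner (r1 (l + t) f - r1 l f) (r1 m g).
  by rewrite !innerBl e; ring.
rewrite mulrAC ler_pdivlMr// mulrC.
rewrite -[X in X * _]normr_id -normrM mulrBr; apply: (le_trans (ler_normB _ _)).
rewrite addrC mulrDl !normrM !normr_id.
have bnd K A (mA : @is_minimal_model R M K N A) (r := model_resolvent hQ mA) :
    `|'Im l| * `|inner (r (l + t) f - r l f) (r m g)| <= `|r l f| * `|r m g| * t.
  apply: (@le_trans _ _ (`|'Im l| * (`|r (l + t) f - r l f| * `|r m g|))).
    by rewrite ler_wpM2l// cauchy_schwarz.
  rewrite mulrA [leRHS]mulrAC [_ * t]mulrC ler_wpM2r//.
  exact: model_resolvent_near.
by apply: lerD; apply: bnd.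
Qed.

Lemma model_gen_gram x y : inner (gen1 x) (gen1 y) = inner (gen2 x) (gen2 y).
Proof.
case: x => [f|[l f]]; case: y => [g|[m g]] /=.
- by rewrite !inner_inl.
- case: ifP => [/andP[m0 _]|_]; last by rewrite !inner0r.
  by rewrite innerC inner_inl model_resolvent_fst// [RHS]innerC inner_inl model_resolvent_fst.
- case: ifP => [/andP[l0 _]|_]; last by rewrite !inner0l.
  by rewrite !inner_inl !model_resolvent_fst.
case: ifP => [/andP[l0 _]|_]; last by rewrite !inner0l.
case: ifP => [/andP[m0 _]|_]; last by rewrite !inner0r.
exact: model_inner_eq.
Qed.

(** [A1] is the closure of the combinations of the pairs [(core1, gen1 + 'i core1)], because their
    images under [A1 - 'i] are total; [W] carries them to the corresponding pairs of [A2]. *)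
Lemma model_equivalence : unitarily_equivalent A1 A2.
Proof.
have [W [isoW sW gW]] := gram_unitary model_gen_gram (model_total hQ mA1) (model_total hQ mA2).
have iW x y : inner (W x) (W y) = inner x y := isoW x y.
have nW x : `|W x| = `|x| by apply/eqP; rewrite -(@eqrXn2 _ 2)// -!inner_norm iW.
have Winl f : W (hsum_inl K1 f) = hsum_inl K2 f := gW (Datatypes.inl f).
have Wr l f : 'Im l != 0 -> l != 'i -> W (r1 l f) = r2 l f.
  by move=> l0 li; have := gW (inr (l, f)); rewrite /= l0 li.
have Wri f : W (r1 'i f) = r2 'i f.
  apply/eqP; rewrite -subr_eq0; apply/eqP.
  apply: (@small_eq0 _ _ _ (`|r1 'i f| + `|r2 'i f|)) => t t0.
  have -> : W (r1 'i f) - r2 'i f =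
      (r2 ('i + t) f - r2 'i f) - W (r1 ('i + t) f - r1 'i f).
    rewrite linearB (Wr ('i + t)) ?Im_shift//; first by rewrite opprB [RHS]addrC subrKA.
    by rewrite -subr_eq0 addrAC subrr add0r gt_eqF.
  apply: (le_trans (ler_normB _ _)); rewrite nW addrC mulrDl.
  have bnd K A (mA : @is_minimal_model R M K N A) (r := model_resolvent hQ mA) :
      `|r ('i + t) f - r 'i f| <= `|r 'i f| * t.
    by have := model_resolvent_near hQ mA f i0 t0; rewrite Im_i normr1 mul1r mulrC.
  by apply: lerD; apply: bnd.
have Wcore x : W (core1 x) = core2 x.
  case: x => [f|[l f]]; first exact: Wri.
  rewrite /model_core; case: ifP => [/andP[l0 li]|_]; last exact: linear0.
  by rewrite linearZ linearB /= Wri Wr.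
have Wlc X (v1 : X -> hsum M K1) (v2 : X -> hsum M K2) : (forall x, W (v1 x) = v2 x) ->
    forall s, W (lcomb v1 s) = lcomb v2 s.
  move=> v12 s; rewrite /lcomb linear_sum; apply: eq_bigr => p _.
  by rewrite linearZ v12.
have WA p : A1 p -> A2 (W p.1, W p.2).
  move=> Ap; apply: (selfadjoint_closed (model_selfadjoint mA2)) => e e0.
  have e2 : 0 < e / 2 by rewrite divr_gt0.
  have [s hs] := model_total hQ mA1 (p.2 - 'i *: p.1) e2.
  have := model_core_lcomb mA2 s; rewrite -!(Wlc _ _ _ Wcore) -!(Wlc _ _ _ gW) => As.
  have h1 : `|p.1 - lcomb core1 s| <= e / 2.
    have := linear_relB (model_linear mA1) Ap (model_core_lcomb mA1 s).
    move=> /= As1; apply: le_trans (ltW hs).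
    have := @selfadjoint_bound _ _ _ (model_selfadjoint mA1) 'i (p.1 - lcomb core1 s)
      (p.2 - 'i *: p.1 - lcomb gen1 s).
    rewrite Im_i normr1 mul1r; apply.
    move: As1; congr (A1 _); congr (_, _); apply: inner_eq => z.
    by rewrite !(innerBl, innerDl, innerNl, innerZl); ring.
  exists (W (lcomb core1 s), W (lcomb gen1 s) + 'i *: W (lcomb core1 s)).
  have le2 : e / 2 <= e by rewrite ler_pdivrMr// ler_peMr ?(ltW e0)// ler1n.
  split=> //=; first by rewrite -linearB nW (le_trans h1).
  rewrite -linearZ -linearD -linearB nW.
  have -> : p.2 - (lcomb gen1 s + 'i *: lcomb core1 s) =
     (p.2 - 'i *: p.1 - lcomb gen1 s) + 'i *: (p.1 - lcomb core1 s).
    by apply: inner_eq => z; rewrite !(innerBl, innerDl, innerNl, innerZl); ring.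
  apply: (le_trans (ler_normD _ _)); rewrite normrZ normCi mul1r (splitr e).
  by apply: lerD => //; exact: ltW.
(* The converse needs no second approximation: [W] preserves inner products and [A1] contains
   everything symmetric to it. *)
have AW p : A2 (W p.1, W p.2) -> A1 p.
  move=> Ap; apply: (selfadjoint_in (model_selfadjoint mA1)) => h Ah.
  by rewrite -!iW; exact: (selfadjoint_sym (model_selfadjoint mA2) (WA _ Ah) Ap).
pose j k : hsum M K1 := (0, k); pose V k := (W (j k)).2.
have jl : linear j by move=> a x y; rewrite /j; congr pair; rewrite /= scaler0 addr0.
(* [W] fixes [M], hence maps its orthogonal complement into the orthogonal complement. *)
have W0 k : (W (j k)).1 = 0.
  apply: inner_eq => f; rewrite -inner_inl -Winl iW.
  exact: (inner_inl (j k) f).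
have WV h : W h = (h.1, V h.2).
  have -> : W h = hsum_inl K2 h.1 + W (j h.2).
    rewrite -Winl -linearD; congr (W _); case: h => f k.
    by rewrite /hsum_inl /j; congr pair; rewrite /= ?addr0 ?add0r.
  rewrite [W (j _)]surjective_pairing W0 /hsum_inl -/(V _); congr pair => /=.
    by rewrite addr0.
  by rewrite add0r.
have lV : linear V by move=> a x y; rewrite /V jl linearP.
pose Vl : {linear K1 -> K2} := HB.pack V (GRing.isLinear.Build C K1 K2 *:%R V lV).
exists Vl; split.
- move=> x y; have := iW (j x) (j y); rewrite !WV !hsum_innerE /= !inner0l !add0r.
  exact.
- move=> k _; have [h] := sW (0, k); rewrite WV => -[_ hk].
  by exists h.2.
apply/seteqP; split=> [p Ap|_ [p Ap <-]]; last by have := WA _ Ap; rewrite !WV.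
have [h1 e1] := sW p.1; have [h2 e2] := sW p.2.
exists (h1, h2); first by apply: AW => /=; rewrite e1 e2 -surjective_pairing.
by rewrite /= [LHS]surjective_pairing/= -!WV e1 e2 -surjective_pairing.
Qed.

End Transfer.
End ModelGram.

(** * The dilation space *)

Section Embedding.
Context (R : realType).
Local Notation C := R[i].

Lemma separable_seq (H : hilbertType R) :
  exists D : nat -> H, forall x (e : C), 0 < e -> exists n, `|x - D n| < e.
Proof.
have [D /pfcard_geP[D0|[s]] dD] := @separable R H.
  have [||x []] := dD setT; last by rewrite D0.
    by exists 0.
  exact: openT.
exists s => x e e0; have [||y [xy Dy]] := dD (ball x e); first by exists x; exact: ballxx.
  exact: ball_open.
have [n _ sn] := surj (f := s) Dy; exists n.
by rewrite sn; move: xy; rewrite -ball_normE.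
Qed.

(** [P] is the adjoint of [J] and [w h] the component of [h] orthogonal to the range of [J]. The
    complement [K] is the space represented by the Gram kernel of [w], and [h |-> (P h, v h)]
    preserves inner products. *)
Lemma hsum_embedding (M H : hilbertType R) (J : M -> H) : linear J ->
  (forall f g, inner (J f) (J g) = inner f g) ->
  exists (K : hilbertType R) (T : {linear H -> hsum M K}),
    [/\ forall x y, inner (T x) (T y) = inner x y, forall k, exists h, T h = k &
      forall f, T (J f) = hsum_inl K f].
Proof.
move=> lJ iJ.
have JB f g : J (f - g) = J f - J g by rewrite -scaleN1r addrC lJ scaleN1r addrC.
have nJ f : `|J f| = `|f| by apply/eqP; rewrite -(@eqrXn2 _ 2)// -!inner_norm iJ.
have /choice[P hP] h : exists u : M, forall g, inner u g = inner h (J g).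
  have [||u hu] := @riesz R M (fun g => inner (J g) h) `|h|.
  - by move=> a x y; rewrite lJ innerDl innerZl.
  - by move=> x; rewrite mulrC -(nJ x); exact: cauchy_schwarz.
  by exists u => g; rewrite innerC -hu -innerC.
have PJ f : P (J f) = f by apply: inner_eq => g; rewrite hP iJ.
pose w h : H := h - J (P h).
have ww h h' : inner (w h) (w h') = inner h h' - inner (P h) (P h').
  rewrite /w innerBl !innerBr iJ -hP (innerC (J _)) -hP -innerC.
  by ring.
have wB h h' : w h - w h' = w (h - h').
  have PB : P (h - h') = P h - P h'.
    by apply: inner_eq => g; rewrite innerBl !hP innerBl.
  by apply: inner_eq => x; rewrite /w PB JB !innerBl; ring.
have k_conj h h' : inner (w h) (w h') = (inner (w h') (w h))^* by rewrite -innerC.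
have k_psd l : 0 <= gram (fun h h' => inner (w h) (w h')) l l.
  by rewrite -gram_inner inner_norm exprn_ge0.
have k_sep : exists D : nat -> H, forall x (e : C), 0 < e -> exists n,
    inner (w x) (w x) - inner (w x) (w (D n)) - inner (w (D n)) (w x) +
      inner (w (D n)) (w (D n)) < e.
  have [D hD] := separable_seq H; exists D => x e e0.
  have s0 : 0 < sqrtC e by rewrite sqrtC_gt0.
  have [n hn] := hD x _ s0; exists n.
  have -> : inner (w x) (w x) - inner (w x) (w (D n)) - inner (w (D n)) (w x) +
      inner (w (D n)) (w (D n)) = inner (w (x - D n)) (w (x - D n)).
    by rewrite -wB innerBl !innerBr; ring.
  rewrite ww !inner_norm; apply: (@le_lt_trans _ _ (`|x - D n| ^+ 2)).
    by rewrite gerBl exprn_ge0.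
  by rewrite -[ltRHS]sqrtCK ltr_pXn2r ?nnegrE// ltW.
have [K [v [vk tv]]] := @kernel_representation R H (PKernel k_conj k_psd k_sep).
have v0 f : v (J f) = 0.
  apply/eqP; rewrite -normr_eq0 -sqrf_eq0 -inner_norm vk /= /w PJ subrr.
  by rewrite inner0l.
pose v2 h : hsum M K := (P h, v h).
have v2_gram x y : inner (id x) (id y) = inner (v2 x) (v2 y).
  by rewrite hsum_innerE vk /= ww /=; ring.
have t1 : total (id : H -> H).
  by move=> h e e0; exists [:: (1, h)]; rewrite lcomb1 subrr normr0.
have inl2 f : approximable v2 (hsum_inl K f).
  have := approximable_gen v2 (J f); congr (approximable _ _).
  by rewrite /v2 PJ v0.
have t2 : total v2.
  case=> f k; have -> : (f, k) = 1 *: hsum_inl K f + (0, k) :> hsum M K.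
    by rewrite scale1r /hsum_inl; congr pair; rewrite /= ?addr0 ?add0r.
  apply: approximable_linear; first exact: inl2.
  move=> e e0; have [l hl] := tv k e e0.
  have : approximable v2 ((0, lcomb v l) : hsum M K).
    elim: l {hl} => [|[a h] l ih]; first by rewrite lcomb_nil; exact: approximable0.
    have := approximable_linear a (approximable_linear (-1) (inl2 (P h)) (approximable_gen v2 h)) ih.
    congr (approximable _ _); rewrite /v2 /hsum_inl scaleN1r.
    congr pair; first by rewrite /= addNr scaler0 addr0.
    by rewrite /= oppr0 add0r /lcomb big_cons.
  have e1 : 0 < e - `|k - lcomb v l| by rewrite subr_gt0.
  move=> /(_ _ e1)[l' hl']; exists l'.
  have -> : (0, k) - lcomb v2 l' =
      ((0, k) - (0, lcomb v l)) + ((0, lcomb v l) - lcomb v2 l') :> hsum M K by rewrite subrKA.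
  apply: (le_lt_trans (ler_normD _ _)); rewrite -ltrBrDl.
  have -> : `|((0, k) - (0, lcomb v l) : hsum M K)| = `|k - lcomb v l|.
    apply/eqP; rewrite -(@eqrXn2 _ 2)// -!inner_norm hsum_innerE /= subrr inner0l add0r.
    exact: eqxx.
  exact: hl'.
have [T [iT sT vT]] := gram_unitary v2_gram t1 t2.
exists K, T; split=> //.
by move=> f; rewrite (vT (J f)) /v2 PJ v0.
Qed.

End Embedding.

(** * The Cayley transform of the disc *)

Section Cayley.
Context (R : realType).
Local Notation C := R[i].
Implicit Types (z w l : C).

Definition cayley z : C := 'i * (2 * (1 - z)^-1 - 1).

Lemma cayley_Im z : `|z| < 1 ->
  'Im (cayley z) = (1 - `|z| ^+ 2) * `|(1 - z)^-1| ^+ 2.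
Proof.
move=> /disc_sub1_neq0 nz; have nz' : 1 - z^* != 0.
  by have := nz; rewrite -conjC_eq0 rmorphB rmorph1.
have cs : (cayley z)^* = - 'i * (2 / (1 - z^*) - 1).
  by rewrite /cayley !(rmorphM, rmorphB, fmorphV, rmorph1, rmorph_nat)/= conjCi.
rewrite normfV exprVn ImE cs !normCK rmorphB rmorph1 /cayley.
have -> : 'i * (- 'i * (2 / (1 - z^*) - 1) - 'i * (2 / (1 - z) - 1)) / 2 =
  - 'i ^+ 2 * ((2 / (1 - z^*) - 1) + (2 / (1 - z) - 1)) / 2 by ring.
rewrite sqrCi; field.
by rewrite nz nz'.
Qed.

Lemma cayley_Im_gt0 z : `|z| < 1 -> 0 < 'Im (cayley z).
Proof.
move=> z1; rewrite cayley_Im// mulr_gt0//.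
  by rewrite subr_gt0 expr_lt1.
by rewrite exprn_gt0// normr_gt0 invr_eq0 disc_sub1_neq0.
Qed.

Lemma cayley_inv l : 0 < 'Im l ->
  [/\ `|(l - 'i) / (l + 'i)| < 1, cayley ((l - 'i) / (l + 'i)) = l & l + 'i != 0].
Proof.
move=> l0; have li : l + 'i != 0.
  apply: contraTneq l0 => /eqP; rewrite addr_eq0 => /eqP ->.
  by rewrite raddfN/= Im_i oppr_gt0 ltr10.
have i0 : 'i != 0 :> C by rewrite -normr_eq0 normCi oner_eq0.
split => //.
  rewrite normrM normfV ltr_pdivrMr ?normr_gt0// mul1r.
  rewrite -(@ltr_pXn2r _ 2) ?nnegrE// -subr_gt0 !normCK rmorphB rmorphD/= conjCi opprK.
  have -> : (l + 'i) * (l^* - 'i) - (l - 'i) * (l^* + 'i) = 4 * 'Im l.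
    by rewrite ImE; field.
  by rewrite mulr_gt0.
rewrite /cayley.
have -> : 1 - (l - 'i) / (l + 'i) = 2 * 'i / (l + 'i).
  by field.
have -> : 2 / (2 * 'i / (l + 'i)) - 1 = l / 'i :> C.
  by field; rewrite i0 li.
by rewrite mulrCA divff// mulr1.
Qed.

Lemma disc_holomorphic_inv : disc_holomorphic (fun z => (1 - z)^-1).
Proof.
move=> z /disc_sub1_neq0; rewrite subr_eq0 eq_sym => z1.
have := derive_in_linear (-1) (derive_in_inv (fun=> True) z1) (derive_in_cst _ 0 z).
move=> h; eexists; apply/complex_derive_in; apply: (eq_derive_in ltr01 _ _ h) => [|w _ _];
  by rewrite addr0 mulN1r -invrN opprB.
Qed.

Lemma disc_holomorphic_cayley : disc_holomorphic cayley.
Proof.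
have := disc_holomorphicM (@disc_holomorphic_cst R 'i)
  (disc_holomorphicD (disc_holomorphicM (@disc_holomorphic_cst R 2) disc_holomorphic_inv)
     (@disc_holomorphic_cst R (-1))).
exact.
Qed.

End Cayley.

(** * The function with nonnegative real part *)

Section CayleyKernel.
Context (R : realType) (M : hilbertType R) (N : R[i] -> set (M * M)).
Local Notation C := R[i].
Variable Q : C -> M -> M.
Hypothesis hQ : inverse_stieltjes_resolvent N Q.
Implicit Types (f g : M) (z l : C).

(* With [l = cayley z], [cayley_function f g z] is
   [- 'i * (l * inner f g + (1 + l ^+ 2) * inner (Q l f) g)]. *)
Definition cayley_symbol f g z : C :=
  4 * 'i * (1 - z)^-1 ^+ 2 * inner (Q (cayley z) f) g + 2 * (1 - z)^-1 * inner f g.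

(** Factoring out [z] exhibits the value at [0], and makes the Taylor coefficients of
    [cayley_symbol] those of this function moved by one index. *)
Definition cayley_function f g z : C := z * cayley_symbol f g z + inner f g.

Lemma disc_holomorphic_resolvent f g :
  disc_holomorphic (fun z => inner (Q (cayley z) f) g).
Proof.
move=> z z1; have [L hL] := disc_holomorphic_cayley z1.
have [D hD] := isr_derive hQ (or_introl (cayley_Im_gt0 z1)) f.
exists (inner D g * L) => e e0.
have L1 : 0 < `|L| + 1 by rewrite ltr_wpDl.
have g1 : 0 < `|g| + 1 by rewrite ltr_wpDl.
have I1 : 0 < `|inner D g| + 1 by rewrite ltr_wpDl.
have e1 : 0 < e / 2 / ((`|L| + 1) * (`|g| + 1)) by rewrite !divr_gt0// mulr_gt0.
have e2 : 0 < e / 2 / (`|inner D g| + 1) by rewrite !divr_gt0.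
have [d1 [d10 h1]] := complex_derive_lip hL.
have [d2 [d20 h2]] := hL _ e2.
have [d3 [d30 h3]] := hD _ e1.
have z0 : 0 < 1 - `|z| by rewrite subr_gt0.
have [d4 [d40 l1 l2]] := common_radius d10 d20.
have [d5 [d50 l3 l4]] := common_radius z0 (divr_gt0 d30 L1).
have [d [d0 l5 l6]] := common_radius d40 d50.
exists d; split => // w wd.
have w4 := lt_le_trans wd l5; have w5 := lt_le_trans wd l6.
have {}h1 := h1 _ (lt_le_trans w4 l1); have {}h2 := h2 _ (lt_le_trans w4 l2).
have w1 : `|w| < 1.
  rewrite -(subrK z w); apply: (le_lt_trans (ler_normD _ _)).
  by rewrite -ltrBrDr (lt_le_trans w5 l3).
have wz : `|cayley w - cayley z| < d3.
  by apply: (le_lt_trans h1); rewrite mulrC -ltr_pdivlMr// (lt_le_trans w5 l4).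
have {}h3 := h3 _ (or_introl (cayley_Im_gt0 w1)) wz.
have -> : inner (Q (cayley w) f) g - inner (Q (cayley z) f) g - inner D g * L * (w - z) =
  inner (Q (cayley w) f - Q (cayley z) f - (cayley w - cayley z) *: D) g +
  inner D g * (cayley w - cayley z - L * (w - z)).
  by rewrite !innerBl innerZl; ring.
apply: (le_trans (ler_normD _ _)); rewrite [e](splitr e) mulrDl; apply: lerD.
  apply: (le_trans (cauchy_schwarz _ _)).
  apply: (@le_trans _ _ (e / 2 / ((`|L| + 1) * (`|g| + 1)) * ((`|L| + 1) * `|w - z|) * (`|g| + 1))).
    apply: ler_pM => //; last by rewrite lerDl.
    by apply: (le_trans h3); rewrite ler_wpM2l// ltW.
  have -> : e / 2 / ((`|L| + 1) * (`|g| + 1)) * ((`|L| + 1) * `|w - z|) * (`|g| + 1) = e / 2 * `|w - z|.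
    by field; rewrite !gt_eqF.
  exact: lexx.
rewrite normrM.
apply: (@le_trans _ _ ((`|inner D g| + 1) * (e / 2 / (`|inner D g| + 1) * `|w - z|))).
  by apply: ler_pM => //; rewrite lerDl.
by rewrite mulrA [_ * (e / 2 / _)]mulrC mulfVK// gt_eqF.
Qed.

Lemma disc_holomorphic_symbol f g : disc_holomorphic (cayley_symbol f g).
Proof.
apply: disc_holomorphicD; apply: disc_holomorphicM.
- apply: disc_holomorphicM; first exact: disc_holomorphic_cst.
  apply: disc_holomorphicM; exact: disc_holomorphic_inv.
- exact: disc_holomorphic_resolvent.
- by apply: disc_holomorphicM; [exact: disc_holomorphic_cst|exact: disc_holomorphic_inv].
exact: disc_holomorphic_cst.
Qed.

Lemma disc_holomorphic_function f g : disc_holomorphic (cayley_function f g).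
Proof.
apply: disc_holomorphicD; last exact: disc_holomorphic_cst.
by apply: disc_holomorphicM; [exact: disc_holomorphic_id|exact: disc_holomorphic_symbol].
Qed.

Let cayley_off z : `|z| < 1 -> ~~ (0 <= cayley z).
Proof. by move=> z1; rewrite nonreal_off_axis// gt_eqF// cayley_Im_gt0. Qed.

Lemma cayley_function_linear a f f' g z : `|z| < 1 ->
  cayley_function (a *: f + f') g z = a * cayley_function f g z + cayley_function f' g z.
Proof.
move=> z1; rewrite /cayley_function /cayley_symbol (isr_linear hQ (cayley_off z1)).
by rewrite !innerDl !innerZl; ring.
Qed.

Lemma cayley_function_antilinear a f g g' z :
  cayley_function f (a *: g + g') z = a^* * cayley_function f g z + cayley_function f g' z.
Proof.
by rewrite /cayley_function /cayley_symbol !innerDr !innerZr; ring.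
Qed.

Lemma cayley_function_gram z (s : seq (C * M)) : `|z| < 1 ->
  gram (fun f g => cayley_function f g z) s s =
  cayley_function (lcomb id s) (lcomb id s) z.
Proof.
move=> z1; rewrite /gram.
have linl (t : seq (C * M)) g : cayley_function (lcomb id t) g z =
    \sum_(p <- t) p.1 * cayley_function p.2 g z.
  elim: t => [|p t ih]; last by rewrite big_cons -ih -cayley_function_linear// /lcomb big_cons.
  rewrite lcomb_nil big_nil; have := cayley_function_linear (-1) 0 0 g z1.
  by rewrite scaler0 addr0 mulN1r addNr.
have linr (t : seq (C * M)) f : cayley_function f (lcomb id t) z =
    \sum_(p <- t) p.1^* * cayley_function f p.2 z.
  elim: t => [|p t ih]; last by rewrite big_cons -ih -cayley_function_antilinear /lcomb big_cons.
  rewrite lcomb_nil big_nil; have := cayley_function_antilinear (-1) f 0 0 z.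
  by rewrite scaler0 addr0 rmorphN1 mulN1r addNr.
rewrite linl; apply: eq_bigr => p _; rewrite linr mulr_sumr.
by apply: eq_bigr => q _; rewrite mulrA.
Qed.

(** Twice the real part is the sum of a multiple of [|f + (l + 'i) h|^2] and a multiple of the
    defect in [isr_im], both with nonnegative factors. *)
Lemma cayley_function_ge0 f z : `|z| < 1 ->
  0 <= cayley_function f f z + (cayley_function f f z)^*.
Proof.
move=> z1; have nz := disc_sub1_neq0 z1; pose l := cayley z; pose h := Q l f.
have l0 : 0 < 'Im l := cayley_Im_gt0 z1.
have i2 := sqrCi C.
have cE : cayley_function f f z = - 'i * (l * inner f f + (1 + l ^+ 2) * inner h f).
  rewrite /cayley_function /cayley_symbol -/l -/h /l /cayley.
  move: (inner h f) (inner f f) => q n.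
  have -> : - 'i * ('i * (2 / (1 - z) - 1) * n + (1 + ('i * (2 / (1 - z) - 1)) ^+ 2) * q) =
    - 'i ^+ 2 * (2 / (1 - z) - 1) * n - 'i * (1 + 'i ^+ 2 * (2 / (1 - z) - 1) ^+ 2) * q :> C by ring.
  by rewrite i2; field.
clearbody l; have := isr_im hQ l0 f; rewrite -/h -subr_ge0 => him.
have fr : (inner f f)^* = inner f f by rewrite -innerC.
have -> : cayley_function f f z + (cayley_function f f z)^* =
    2 * 'Im l * `|f + (l + 'i) *: h| ^+ 2 +
    2 * `|l + 'i| ^+ 2 * ('Im (inner h f) - 'Im l * `|h| ^+ 2).
  rewrite cE norm2D normrZ exprMn innerZr !normCK inner_norm.
  rewrite inner_norm in fr.
  rewrite !ImE (innerC f h); move: (`|f| ^+ 2) fr => n fr.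
  have -> : (- 'i * (l * n + (1 + l ^+ 2) * inner h f))^* =
     'i * (l^* * n + (1 + l^* ^+ 2) * (inner h f)^*).
    rewrite rmorphM rmorphN/= conjCi opprK rmorphD !rmorphM rmorphD rmorphXn rmorph1/=.
    by rewrite fr.
  rewrite !(conjCK, rmorphM, rmorphD)/= !(conjCK, rmorphN, conjCi)/= ?conjCi ?opprK.
  move: (inner h f) (inner h f)^* (`|h| ^+ 2) (l^*) i2 => q p H m.
  move: 'i => i i2.
  (* The two sides differ by this multiple of [1 + i^2]; adding it leaves an identity valid for a
     free variable [i]. *)
  have e : i * (1 + i ^+ 2) * (p - q) = 0 by rewrite i2 subrr mulr0 mul0r.
  rewrite -[RHS]addr0 -[in RHS]e; by field.
have y0 := ltW l0.
by apply: addr_ge0; rewrite mulr_ge0// ?mulr_ge0// ?exprn_ge0.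
Qed.

End CayleyKernel.

Lemma total_orthogonal (R : realType) (H : hilbertType R) X (v : X -> H) d : total v ->
  (forall x, inner d (v x) = 0) -> d = 0.
Proof.
move=> tv dv; have [//|d0] := eqVneq d 0.
apply: (@small_eq0 _ _ _ 1) => e e0; have [l hl] := tv d e e0.
have dl : inner d (lcomb v l) = 0.
  by rewrite /lcomb inner_sumr big1// => p _; rewrite innerZr dv mulr0.
have nd : 0 < `|d| by rewrite normr_gt0.
rewrite mul1r -(ler_pM2l nd) -expr2 -inner_norm.
have -> : inner d d = `|inner d (d - lcomb v l)|.
  by rewrite innerBr dl subr0 inner_norm ger0_norm ?exprn_ge0.
by apply: (le_trans (cauchy_schwarz _ _)); rewrite ler_wpM2l// ltW.
Qed.

(** * The space represented by the Toeplitz kernel *)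

Section CayleyModel.
Context (R : realType) (M : hilbertType R) (N : R[i] -> set (M * M)).
Local Notation C := R[i].
Variable Q : C -> M -> M.
Hypothesis hQ : inverse_stieltjes_resolvent N Q.
Implicit Types (f g : M) (z l : C).

Lemma eq_taylor (u v : C -> C) n : (forall z, `|z| < 1 -> u z = v z) ->
  taylor u n = taylor v n.
Proof.
move=> uv; rewrite /taylor /fourier; congr (_ * _ * _); apply: eq_path_int => t _.
rewrite uv// norm_circle ?invr_ge0 ?ler0n// -[ltRHS]/(1%:C%C) ltcR.
by rewrite invf_lt1 ?ltr0n// ltr1n.
Qed.

Local Notation G := (cayley_function Q).

Definition cayley_coef n f g : C := toep G n f g.

Let hG f g : disc_holomorphic (G f g).
Proof. exact: (disc_holomorphic_function hQ). Qed.

Lemma cayley_coef_linear n a f f' g :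
  cayley_coef n (a *: f + f') g = a * cayley_coef n f g + cayley_coef n f' g.
Proof.
have l1 m : tcoef (G (a *: f + f') g) m = a * tcoef (G f g) m + tcoef (G f' g) m.
  case: m => m /=; last by rewrite mulr0 addr0.
  rewrite -taylor_linear//; apply: eq_taylor => z z1.
  exact: (cayley_function_linear hQ).
have l2 m : tcoef (G g (a *: f + f')) m = a^* * tcoef (G g f) m + tcoef (G g f') m.
  case: m => m /=; last by rewrite mulr0 addr0.
  rewrite -taylor_linear//; apply: eq_taylor => z z1.
  exact: cayley_function_antilinear.
by rewrite /cayley_coef /toep l1 l2 rmorphD rmorphM/= conjCK; ring.
Qed.

(** This makes [f |-> v (0, f)] an isometric embedding of [M]. *)
Lemma cayley_coef0 f g : cayley_coef 0 f g = inner f g.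
Proof.
rewrite /cayley_coef /toep oppr0 /= !taylor0// /cayley_function !mul0r !add0r.
by rewrite -innerC; field.
Qed.

Lemma cayley_coefS n f g : cayley_coef n.+1 f g = taylor (G f g) n.+1 / 2.
Proof. by rewrite /cayley_coef /toep /= rmorph0 addr0. Qed.

Lemma cayley_model_exists : exists (K : hilbertType R) (v : int * M -> hsum M K),
  [/\ forall a b, inner (v a) (v b) = cayley_coef (a.1 - b.1) a.2 b.2,
    total v & forall f, v (0, f) = hsum_inl K f].
Proof.
pose k (a b : int * M) := cayley_coef (a.1 - b.1) a.2 b.2.
have k_conj a b : k a b = (k b a)^*.
  rewrite /k /cayley_coef /toep !opprB rmorphM rmorphD/= conjCK fmorphV/= conjC_nat.
  by rewrite [in RHS]addrC.
have k_psd s : 0 <= gram k s s.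
  apply: toeplitz_psd => // z z1 s1.
  rewrite (cayley_function_gram hQ)//; exact: (cayley_function_ge0 hQ).
have k_sep : exists D : nat -> int * M, forall x (e : C), 0 < e -> exists n,
    k x x - k x (D n) - k (D n) x + k (D n) (D n) < e.
  have [d hd] := separable_seq M.
  exists (fun n => if (unpickle n : option (int * nat)) is Some p then (p.1, d p.2) else (0, 0)).
  move=> [m f] e e0; have s0 : 0 < sqrtC e by rewrite sqrtC_gt0.
  have [j hj] := hd f _ s0; exists (pickle (m, j)); rewrite pickleK /k /= subrr !cayley_coef0.
  have -> : inner f f - inner f (d j) - inner (d j) f + inner (d j) (d j) =
    inner (f - d j) (f - d j) by rewrite innerBl !innerBr; ring.
  by rewrite inner_norm -[ltRHS]sqrtCK ltr_pXn2r ?nnegrE// ltW.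
have [H [v [vk tv]]] := @kernel_representation R _ (PKernel k_conj k_psd k_sep).
(* The kernel representation gives no linearity in [f]; the defect is orthogonal to the total family
   [v]. *)
have lv : linear (fun f => v (0, f)).
  move=> a f g; apply/eqP; rewrite -subr_eq0; apply/eqP.
  apply: (total_orthogonal tv) => x.
  by rewrite innerBl innerDl innerZl !vk /= /k /= cayley_coef_linear subrr.
have iv f g : inner (v (0, f)) (v (0, g)) = inner f g.
  by rewrite vk /= /k /= subrr cayley_coef0.
have [K [T [iT sT vT]]] := hsum_embedding lv iv.
exists K, (T \o v); split=> [a b|h e e0|f] /=; [by rewrite iT vk| |exact: vT].
have [h1 <-] := sT h; have [s hs] := tv h1 e e0; exists s.
have -> : lcomb (T \o v) s = T (lcomb v s).
  by rewrite /lcomb linear_sum; apply: eq_bigr => p _; rewrite linearZ.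
rewrite -linearB; suff -> : `|T (h1 - lcomb v s)| = `|h1 - lcomb v s| by [].
by apply/eqP; rewrite -(@eqrXn2 _ 2)// -!inner_norm iT.
Qed.

End CayleyModel.

(** * The relation of the shift *)

Section CayleyRelation.
Context (R : realType) (H : hilbertType R) (U : {linear H -> H}).
Local Notation C := R[i].
Hypothesis iU : forall x y, inner (U x) (U y) = inner x y.
Hypothesis sU : forall y, exists x, U x = y.
Implicit Types (u w g h k : H) (l m : C).

(* [U = (A + 'i) (A - 'i)^-1]. *)
Definition cayley_relation : set (H * H) :=
  [set p | exists h, p = (U h - h, 'i *: (U h + h))].
Local Notation A := cayley_relation.

Let nU x : `|U x| = `|x|.
Proof. by apply/eqP; rewrite -(@eqrXn2 _ 2)// -!inner_norm iU. Qed.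

Lemma cayley_relation_linear : linear_relation A.
Proof.
split=> [|a _ _ [h ->] [k ->]].
  by exists 0; rewrite linear0 subr0 addr0 scaler0.
exists (a *: h + k); rewrite linearP; congr (_, _) => /=; apply: inner_eq => z;
  by rewrite !(innerDl, innerNl, innerZl); ring.
Qed.

(** Testing a pair of the adjoint against all [(U h - h, 'i (U h + h))] gives
    [U (k2 - 'i k1) = k2 + 'i k1], which is membership with [h = (k2 - 'i k1) / (2 'i)]. No
    injectivity of [U - 1] enters, since [A] is a relation. *)
Lemma cayley_relation_selfadjoint : selfadjoint A.
Proof.
have i2 := sqrCi C; have i0 : 'i != 0 :> C by rewrite -normr_eq0 normCi oner_eq0.
apply/seteqP; split=> [p [h ->] _ [k ->]|[k1 k2] /= Ak].
  rewrite /= !(innerDl, innerDr, innerNl, innerNr, innerZl, innerZr) conjCi !iU.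
  by ring.
have e h : inner h (k2 - 'i *: k1) = inner (U h) (k2 + 'i *: k1).
  have := Ak (_, _) (ex_intro _ h erefl) => /=.
  rewrite !(innerDl, innerDr, innerNl, innerNr, innerZl, innerZr) conjCi.
  move: (inner (U h) k1) (inner (U h) k2) (inner h k1) (inner h k2) => a b c d ee.
  have -> : d = b - 'i * (a + c) by rewrite ee; ring.
  by ring.
have ab : U (k2 - 'i *: k1) = k2 + 'i *: k1.
  by apply: inner_eqr => y; have [h <-] := sU y; rewrite iU e.
exists ((2 * 'i)^-1 *: (k2 - 'i *: k1)).
rewrite linearZ ab; congr (_, _); apply: inner_eq => z;
  by rewrite !(innerDl, innerNl, innerZl); field.
Qed.

Lemma cayley_relation_resolvent h : A ((2 * 'i)^-1 *: (U h - h),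
  h + 'i *: ((2 * 'i)^-1 *: (U h - h))).
Proof.
have i0 : 'i != 0 :> C by rewrite -normr_eq0 normCi oner_eq0.
exists ((2 * 'i)^-1 *: h); rewrite [U (_ *: _)]linearZ; congr (_, _); apply: inner_eq => z;
  by rewrite !(innerDl, innerNl, innerZl); field.
Qed.

Lemma cayley_relation_resolventN h : A ((2 * 'i)^-1 *: (U h - h),
  U h - 'i *: ((2 * 'i)^-1 *: (U h - h))).
Proof.
have i0 : 'i != 0 :> C by rewrite -normr_eq0 normCi oner_eq0.
exists ((2 * 'i)^-1 *: h); rewrite [U (_ *: _)]linearZ; congr (_, _); apply: inner_eq => z;
  by rewrite !(innerDl, innerNl, innerZl); field.
Qed.

Lemma cayley_neumann l g : 0 < 'Im l ->
  exists h, h - ((l - 'i) / (l + 'i)) *: U h = g.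
Proof.
move=> l0; have [z1 _ _] := cayley_inv l0; set z := _ / _ in z1 *.
have [x y||x|h hg] := @neumann R H (fun h => z *: U h) `|z| _ _ z1 _ g.
- by rewrite linearB scalerBr.
- exact: normr_ge0.
- by rewrite normrZ nU.
- by exists h.
Qed.

Lemma cayley_relation_surjective l : 'Im l != 0 ->
  forall g, exists u, A (u, g + l *: u).
Proof.
move=> l0 g; have [lp|ln|l00] := real_ltgtP (real0 C) (Creal_Im l); last first.
- by rewrite -l00 eqxx in l0.
(* In the lower half-plane [(l - 'i) / (l + 'i)] has modulus above [1], so the Neumann iteration
   uses the inverse [V] of [U] and the reciprocal factor. *)
- have lc : 0 < 'Im (l^*) by rewrite Im_conj oppr_gt0.
  have /choice[V hV] := sU.
  have injU x y : U x = U y -> x = y.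
    by move=> xy; apply: inner_eq => z; rewrite -[LHS]iU -[RHS]iU xy.
  have VB x y : V (x - y) = V x - V y by apply: injU; rewrite linearB !hV.
  have nV x : `|V x| = `|x| by rewrite -nU hV.
  have [z1 _ li] := cayley_inv lc.
  have li' : l - 'i != 0.
    by rewrite -conjC_eq0 rmorphB/= conjCi opprK.
  have z1' : `|(l + 'i) / (l - 'i)| < 1.
    rewrite -norm_conjC; move: z1; congr (`|_| < _).
    by rewrite rmorphM fmorphV rmorphD rmorphB/= conjCi opprK.
  set z := _ / _ in z1' .
  have [x y||x|h hg] := @neumann R H (fun h => z *: V h) `|z| _ _ z1' _ ((- (l - 'i)^-1) *: g).
  + by rewrite VB scalerBr.
  + exact: normr_ge0.
  + by rewrite normrZ nV.
  exists (h - V h); exists (V h); rewrite hV; congr (_, _).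
  have -> : g = - (l - 'i) *: (h - z *: V h).
    by rewrite hg scalerA mulrNN divff// scale1r.
  by apply: inner_eq => x; rewrite !(innerDl, innerNl, innerZl) /z; field.
have [h hg] := cayley_neumann ((l + 'i)^-1 *: g) lp.
have [_ _ li] := cayley_inv lp.
exists (U h - h), h; congr (_, _).
have -> : g = (l + 'i) *: (h - ((l - 'i) / (l + 'i)) *: U h).
  by rewrite hg scalerA divff// scale1r.
by apply: inner_eq => x; rewrite !(innerDl, innerNl, innerZl); field.
Qed.

End CayleyRelation.

(** * The resolvent of a selfadjoint relation *)

Section SelfadjointResolvent.
Context (R : realType) (H : hilbertType R) (A : set (H * H)).
Local Notation C := R[i].
Hypotheses (lA : linear_relation A) (sA : selfadjoint A).
Hypothesis surjA : forall l : C, 'Im l != 0 -> forall g, exists u, A (u, g + l *: u).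
Implicit Types (u w g h k : H) (l m : C).

Let r_ex : exists r : C -> H -> H, forall l, 'Im l != 0 -> forall g, A (r l g, g + l *: r l g).
Proof.
have /choice[r hr] (lg : C * H) : exists u, 'Im lg.1 != 0 -> A (u, lg.2 + lg.1 *: u).
  have [l0|l0] := eqVneq ('Im lg.1) 0; first by exists 0.
  by have [u hu] := surjA l0 lg.2; exists u.
by exists (fun l g => r (l, g)) => l l0 g; exact: (hr (l, g)).
Qed.

Definition sa_resolvent := projT1 (cid r_ex).
Local Notation r := sa_resolvent.

Lemma sa_resolventP l g : 'Im l != 0 -> A (r l g, g + l *: r l g).
Proof. by move=> l0; exact: (projT2 (cid r_ex)). Qed.

Lemma sa_resolvent_uniq l g u : 'Im l != 0 -> A (u, g + l *: u) -> u = r l g.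
Proof.
move=> l0 Au; have := selfadjoint_near lA sA (sa_resolventP g l0) Au.
by rewrite subrr normr0 mul0r pmulr_rle0 ?normr_gt0// normr_le0 subr_eq0 => /eqP.
Qed.

Lemma sa_resolvent_linear l a g h : 'Im l != 0 -> r l (a *: g + h) = a *: r l g + r l h.
Proof.
move=> l0; apply/esym/sa_resolvent_uniq => //.
have := lA.2 a _ _ (sa_resolventP g l0) (sa_resolventP h l0).
congr (A _); congr (_, _) => /=; apply: inner_eq => z.
by rewrite !(innerDl, innerZl); ring.
Qed.

Lemma sa_resolventB l g h : 'Im l != 0 -> r l (g - h) = r l g - r l h.
Proof.
by move=> l0; rewrite -(scaleN1r h) [g + _]addrC sa_resolvent_linear// scaleN1r addrC.
Qed.

Lemma sa_resolventZ l a g : 'Im l != 0 -> r l (a *: g) = a *: r l g.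
Proof.
move=> l0; apply/esym/sa_resolvent_uniq => //.
have := linear_relZ a lA (sa_resolventP g l0).
by congr (A _); congr (_, _); rewrite /= scalerDr !scalerA mulrC.
Qed.

Lemma sa_resolvent_identity l m g : 'Im l != 0 -> 'Im m != 0 ->
  r m g - r l g = (m - l) *: r m (r l g).
Proof.
move=> l0 m0; rewrite -sa_resolventZ//; apply: sa_resolvent_uniq => //.
have := linear_relB lA (sa_resolventP g m0) (sa_resolventP g l0).
congr (A _); congr (_, _) => /=; apply: inner_eq => z.
by rewrite !(innerDl, innerNl, innerZl); ring.
Qed.

Lemma sa_resolvent_adjoint l g h : 'Im l != 0 ->
  inner (r l g) h = inner g (r l^* h).
Proof.
move=> l0; have lc : 'Im (l^*) != 0 by rewrite Im_conj oppr_eq0.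
have := selfadjoint_sym sA (sa_resolventP g l0) (sa_resolventP h lc).
rewrite /= innerDl innerDr innerZl innerZr conjCK => e.
by apply: (addIr (l * inner (r l g) (r l^* h))); rewrite e.
Qed.

Lemma sa_resolvent_bound l g : 'Im l != 0 -> `|'Im l| * `|r l g| <= `|g|.
Proof. by move=> l0; apply: (selfadjoint_bound sA); exact: sa_resolventP. Qed.

End SelfadjointResolvent.

(** * Resolvent invariance of the closed span of the minimality condition *)

Section Span.
Context (R : realType) (M K : hilbertType R).
Local Notation C := R[i].
Local Notation H := (hsum M K).
Local Notation inl := (@hsum_inl R M K).
Variable A : set (H * H).
Hypotheses (lA : linear_relation A) (sA : selfadjoint A).
Hypothesis surjA : forall l : C, 'Im l != 0 -> forall g, exists u, A (u, g + l *: u).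
Implicit Types (u w g h k : H) (l m : C).
Local Notation r := (sa_resolvent surjA).

Definition span_gen (x : M + C * M) : H :=
  match x with
  | Datatypes.inl f => inl f
  | inr (l, f) => if 'Im l != 0 then r l (inl f) else 0
  end.

Lemma lcomb_span (s : seq (C * (M + C * M))) : linear_span
  [set x | exists (l : R[i]) (f g : M) (h : hsum M K),
      [/\ l \isn't Num.real, resolvent A l (inl g, h) & x = inl f + h]] (lcomb span_gen s).
Proof.
set S := [set x | _].
have i0 : 'Im ('i : C) != 0 by rewrite Im_i oner_eq0.
have ir l : 'Im l != 0 -> l \isn't Num.real by apply: contraNN => /Creal_ImP ->.
have A00 (l : C) : A (0, 0 + l *: 0) by rewrite scaler0 addr0; case: lA.
have gS x : S (span_gen x).
  case: x => [f|[l f]] /=.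
    exists 'i, f, 0, 0; split; [exact: ir| |by rewrite addr0].
    by apply/inv_shiftP; rewrite scaleNr opprK; exact: A00.
  case: ifP => l0.
    exists l, 0, f, (r l (inl f)); split; [exact: ir| |].
      by apply/inv_shiftP; rewrite scaleNr opprK; exact: sa_resolventP.
    by rewrite -[LHS]add0r.
  exists 'i, 0, 0, 0; split; [exact: ir| |by rewrite addr0].
  by apply/inv_shiftP; rewrite scaleNr opprK; exact: A00.
pose x0 : C * (M + C * M) := (0, Datatypes.inl 0).
exists (size s), (fun i => (nth x0 s i).1), (fun i => span_gen (nth x0 s i).2).
by split=> [i|]; [exact: gS|rewrite /lcomb (big_nth x0) big_mkord].
Qed.

Lemma minimal_total : total span_gen -> minimal A.
Proof.
move=> tg; apply/seteqP; split => // h _ B /nbhs_ballP[e /= e0 eB].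
have [s hs] := tg h _ e0; exists (lcomb span_gen s); split; first exact: lcomb_span.
by apply: eB; rewrite -ball_normE.
Qed.

(** For distinct parameters the resolvent identity turns a product of resolvents into a divided
    difference; equal parameters are reached through [l + t] with small [t]. *)
Let span_gen_resolvent m x : 'Im m != 0 -> approximable span_gen (r m (span_gen x)).
Proof.
move=> m0; case: x => [f|[l f]] /=.
  by have := approximable_gen span_gen (inr (m, f)); rewrite /= m0.
case: ifP => l0; last first.
  by rewrite -(scale0r 0) sa_resolventZ// scale0r; exact: approximable0.
have rm (k : M) n : 'Im n != 0 -> approximable span_gen (r n (inl k)).
  by move=> n0; have := approximable_gen span_gen (inr (n, k)); rewrite /= n0.
have off n : 'Im n != 0 -> m != n -> approximable span_gen (r m (r n (inl f))).
  move=> n0; rewrite -subr_eq0 => mn.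
  have -> : r m (r n (inl f)) = (m - n)^-1 *: (r m (inl f) - r n (inl f)).
    by rewrite sa_resolvent_identity// scalerA mulVf// scale1r.
  rewrite [X in _ *: X]addrC -(scaleN1r (r n (inl f))) -[X in approximable _ X]addr0.
  exact: (approximable_linear (m - n)^-1 (approximable_linear (-1) (rm f n n0) (rm f m m0))
    (approximable0 span_gen)).
have [e|] := eqVneq m l; last exact: off.
apply: approximable_closed => e1 e10.
pose q := `|'Im l| ^+ 2.
have q0 : 0 < q by rewrite exprn_gt0// normr_gt0.
pose u := r l (inl f); have d0 : 0 < `|u| + 1 by rewrite ltr_wpDl.
(* The two resolvents each cost a factor [1 / |Im l|], which [q] compensates. *)
pose t := e1 * q / (`|u| + 1); have t0 : 0 < t by rewrite divr_gt0// mulr_gt0.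
have lt : 'Im (l + t) = 'Im l by rewrite raddfD/= (Creal_ImP _ (gtr0_real t0)) addr0.
have lt0 : 'Im (l + t) != 0 by rewrite lt.
exists (r m (r (l + t) (inl f))); split.
  apply: off => //; rewrite e -subr_eq0 opprD addrA subrr add0r oppr_eq0 gt_eqF//.
have := selfadjoint_near lA sA (sa_resolventP surjA (inl f) l0) (sa_resolventP surjA (inl f) lt0).
rewrite lt (addrAC l) subrr add0r (gtr0_norm t0) -/u => h1.
have -> : r m u - r m (r (l + t) (inl f)) = r m (u - r (l + t) (inl f)).
  by rewrite sa_resolventB.
have := sa_resolvent_bound sA surjA (u - r (l + t) (inl f)) m0.
rewrite e => h2; rewrite -(ltr_pM2l q0) /q expr2 -mulrA.
apply: (@le_lt_trans _ _ (`|'Im l| * `|u - r (l + t) (inl f)|)).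
  by rewrite ler_wpM2l.
rewrite distrC; apply: (le_lt_trans h1); rewrite /t mulrAC ltr_pdivrMr// -expr2 -/q mulrC.
by rewrite [q * e1]mulrC [_ * (`|u| + 1)]mulrC ltr_pM2r ?ltrDl// mulr_gt0.
Qed.

Lemma approximable_resolvent m h : 'Im m != 0 ->
  approximable span_gen h -> approximable span_gen (r m h).
Proof.
move=> m0 ah; apply: approximable_closed => e e0.
have e1 : 0 < `|'Im m| * e by rewrite mulr_gt0// normr_gt0.
have [s hs] := ah _ e1; exists (r m (lcomb span_gen s)); split.
  elim: s {hs} => [|[a x] s ih].
    by rewrite lcomb_nil -(scale0r 0) sa_resolventZ// scale0r; exact: approximable0.
  rewrite /lcomb big_cons /= sa_resolvent_linear//.
  by apply: approximable_linear ih; exact: span_gen_resolvent.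
have n0 : 0 < `|'Im m| by rewrite normr_gt0.
rewrite -(ltr_pM2l n0); apply: le_lt_trans hs.
have -> : r m h - r m (lcomb span_gen s) = r m (h - lcomb span_gen s).
  by rewrite sa_resolventB.
exact: sa_resolvent_bound.
Qed.

End Span.

(** * Compression and minimality of the relation of the shift *)

Section CayleyDilation.
Context (R : realType) (M : hilbertType R) (N : R[i] -> set (M * M)).
Local Notation C := R[i].
Variable Q : C -> M -> M.
Hypothesis hQ : inverse_stieltjes_resolvent N Q.
Context (K : hilbertType R).
Local Notation H := (hsum M K).
Local Notation inl := (@hsum_inl R M K).
Context (v : int * M -> H) (U : {linear H -> H}).
Hypothesis vG : forall a b, inner (v a) (v b) = cayley_coef Q (a.1 - b.1) a.2 b.2.
Hypothesis tv : total v.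
Hypothesis v0 : forall f, v (0, f) = inl f.
Hypothesis iU : forall x y, inner (U x) (U y) = inner x y.
Hypothesis sU : forall y, exists x, U x = y.
Hypothesis Uv : forall n f, U (v (n, f)) = v (n + 1, f).
Implicit Types (f g : M) (u w h k : H) (l m z : C).
Local Notation A := (cayley_relation U).

Let lA : linear_relation A. Proof. exact: cayley_relation_linear. Qed.
Let sA : selfadjoint A. Proof. exact: cayley_relation_selfadjoint. Qed.
Hypothesis surjA : forall l, 'Im l != 0 -> forall g : H, exists u, A (u, g + l *: u).
Local Notation r := (sa_resolvent surjA).

Let nU n x : `|iter n U x| = `|x|.
Proof.
elim: n => //= n <-; apply/eqP.
by rewrite -(@eqrXn2 _ 2)// -!inner_norm iU.
Qed.

(** Iterating [h = f + z U h] expands [U h] in the vectors [U^(j+1) f] with coefficients [z^j].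
    Their inner products with [g] are the kernel coefficients of index [j + 1], that is, half the
    Taylor coefficients of the symbol; the half comes from the real part in [toep]. *)
Lemma cayley_neumann_inner z h f g : `|z| < 1 -> h - z *: U h = inl f ->
  inner (U h) (inl g) = cayley_symbol Q f g z / 2.
Proof.
move=> z1 hf; have hB := disc_holomorphic_symbol hQ f g.
have coefE n : cayley_coef Q n.+1 f g = 2^-1 * taylor (cayley_symbol Q f g) n.
  by rewrite (cayley_coefS) /cayley_function taylor_affine// mulrC.
have Uf n : iter n U (inl f) = v (n%:Z, f).
  elim: n => [|n ih]; first by rewrite -v0.
  by rewrite iterS ih Uv -PoszD addn1.
have iterB n x y : iter n U (x - z *: y) = iter n U x - z *: iter n U y.
  by elim: n => //= n ->; rewrite linearB linearZ.
have itE n : iter n.+1 U h = v (n.+1%:Z, f) + z *: iter n.+2 U h.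
  by rewrite -Uf -hf iterB -iterSr subrK.
have sumE n : inner (U h) (inl g) = \sum_(j < n) cayley_coef Q j.+1 f g * z ^+ j +
    z ^+ n * inner (iter n.+1 U h) (inl g).
  elim: n => [|n ih]; first by rewrite big_ord0 add0r expr0 mul1r.
  rewrite {}ih big_ord_recr -addrA; congr (_ + _).
  rewrite [in LHS]itE innerDl innerZl -v0 vG subr0 exprS.
  by move: (inner _ _) (cayley_coef _ _ _ _) => a b; rewrite /=; ring.
apply: (@conv_uniq _ (fun n => \sum_(j < n) cayley_coef Q j.+1 f g * z ^+ j)).
  move=> e e0; have c0 : 0 < `|h| * `|inl g : H| + 1 by rewrite ltr_wpDl// mulr_ge0.
  have [n0 hn0] := geom_small (normr_ge0 z) z1 (divr_gt0 e0 c0); exists n0 => n nn.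
  rewrite [X in X - _](sumE n) addrC addKr normrM normrX.
  apply: (@le_lt_trans _ _ (`|z| ^+ n * (`|h| * `|inl g : H|))).
    rewrite ler_wpM2l ?exprn_ge0//; apply: (le_trans (cauchy_schwarz _ _)).
    by rewrite nU.
  apply: (@le_lt_trans _ _ (`|z| ^+ n * (`|h| * `|inl g : H| + 1))).
    by rewrite ler_wpM2l ?exprn_ge0// lerDl.
  by rewrite -ltr_pdivlMr// hn0.
have := conv_linear 2^-1 (taylor_expansion hB z1) (conv_cst 0).
rewrite addr0 mulrC; apply: eq_conv => n.
by rewrite addr0 mulr_sumr; apply: eq_bigr => j _; rewrite coefE mulrA.
Qed.

Lemma cayley_compression_upper l f u : 0 < 'Im l -> A (u, inl f + l *: u) -> u.1 = Q l f.
Proof.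
move=> l0 Au; have [z1 zl li] := cayley_inv l0.
set z := _ / _ in z1 zl.
have i0 : 'i != 0 :> C by rewrite -normr_eq0 normCi oner_eq0.
have z2 : 1 - z = 2 * 'i / (l + 'i) by rewrite /z; field.
have [h hf] := cayley_neumann iU (inl f) l0; rewrite -/z in hf.
pose w := (l + 'i)^-1 *: (U h - h).
have Aw : A (w, inl f + l *: w).
  exists ((l + 'i)^-1 *: h); rewrite [U (_ *: _)]linearZ -hf.
  by congr (_, _); apply: inner_eq => x; rewrite !(innerDl, innerNl, innerZl) /z; field.
have ln : 0 < `|'Im l| by rewrite normr_gt0 gt_eqF.
have -> : u = w.
  apply/eqP; rewrite -subr_eq0 -normr_eq0 eq_le normr_ge0 andbT -(pmulr_rle0 _ ln).
  by have := selfadjoint_near lA sA Aw Au; rewrite subrr normr0 mul0r.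
apply: inner_eq => g; rewrite -inner_inl innerZl innerBl.
have hE : inner h (inl g) = z * inner (U h) (inl g) + inner f g.
  by rewrite -(inner_inl (inl f)) -hf innerBl innerZl addrC subrK.
rewrite hE (cayley_neumann_inner _ z1 hf) /cayley_symbol zl z2.
by rewrite /z; field; rewrite i0 li.
Qed.

Lemma cayley_compression l f u : 'Im l != 0 -> A (u, inl f + l *: u) -> u.1 = Q l f.
Proof.
move=> l0 Au; have [lp|ln|l00] := real_ltgtP (real0 C) (Creal_Im l); last first.
- by rewrite -l00 eqxx in l0.
- have lc : 0 < 'Im (l^*) by rewrite Im_conj oppr_gt0.
  apply: inner_eq => g; have [w Aw] := surjA (lt0r_neq0 lc) (inl g).
  rewrite (isr_adjoint hQ l0) -(cayley_compression_upper lc Aw).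
  have := selfadjoint_sym sA Au Aw.
  rewrite /= innerDl innerDr innerZl innerZr conjCK => e.
  have e2 : inner (inl f) w = inner u (inl g).
    by apply: (addIr (l * inner u w)); rewrite e.
  by rewrite -[LHS]inner_inl -e2 innerC inner_inl -innerC.
exact: cayley_compression_upper.
Qed.

(** [U = 1 + 2 'i (A - 'i)^-1] and [U^-1 = 1 - 2 'i (A + 'i)^-1], so the closed span, being stable
    under resolvents, contains all [v (n, f)] once it contains [M]. *)
Lemma cayley_total : total (span_gen surjA).
Proof.
have i0 : 'i != 0 :> C by rewrite -normr_eq0 normCi oner_eq0.
have i20 : 2 * 'i != 0 :> C by rewrite mulf_neq0 ?pnatr_eq0.
have im1 : 'Im ('i : C) != 0 by rewrite Im_i oner_eq0.
have im2 : 'Im (- 'i : C) != 0 by rewrite raddfN/= Im_i oppr_eq0 oner_eq0.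
have aU h : approximable (span_gen surjA) h -> approximable (span_gen surjA) (U h).
  move=> ah; have -> : U h = (2 * 'i) *: r 'i h + h.
    rewrite -(sa_resolvent_uniq lA sA surjA im1 (cayley_relation_resolvent U h)).
    by rewrite scalerA (divff i20) scale1r subrK.
  by apply: approximable_linear => //; exact: (approximable_resolvent lA sA).
have aV h : approximable (span_gen surjA) (U h) -> approximable (span_gen surjA) h.
  move=> ah; have -> : h = (- (2 * 'i)) *: r (- 'i) (U h) + U h.
    have := cayley_relation_resolventN U h; rewrite -scaleNr.
    move=> /(sa_resolvent_uniq lA sA surjA im2) <-.
    by rewrite scalerA mulNr (divff i20) scaleN1r opprB subrK.
  by apply: approximable_linear => //; exact: (approximable_resolvent lA sA).
have av n f : approximable (span_gen surjA) (v (n, f)).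
  elim/int_rect: n => [|n ih|n ih].
  - by rewrite v0; exact: (approximable_gen (span_gen surjA) (Datatypes.inl f)).
  - by rewrite -addn1 PoszD -Uv; exact: aU.
  apply: aV; rewrite Uv; congr (approximable _ (v (_, f))): ih.
  by rewrite -addn1 PoszD opprD addrNK.
move=> h; apply: approximable_closed => e e0; have [s hs] := tv h e0.
exists (lcomb v s); split => //.
elim: s {hs} => [|[a [n f]] s ih]; first by rewrite lcomb_nil; exact: approximable0.
by rewrite /lcomb big_cons; exact: (approximable_linear a (av n f) ih).
Qed.

End CayleyDilation.

(** * Nonnegativity and the negative axis *)

(** Let [s] be the supremum of the points up to which the estimate from [a] holds. The local
    condition to the left of [s] puts [s] itself in the set, and to the right of [s] it would go
    further unless [s = b]. *)
Lemma ndecr_local (R : realType) (phi : R -> R) (a b e : R) : a <= b ->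
  (forall x, a <= x <= b -> exists d, 0 < d /\ forall y, `|y - x| < d ->
     (x <= y -> phi x - e * (y - x) <= phi y) /\
     (y <= x -> phi y - e * (x - y) <= phi x)) ->
  phi a - e * (b - a) <= phi b.
Proof.
move=> ab loc; pose S := [set t : R | a <= t <= b /\ phi a - e * (t - a) <= phi t].
have Sa : S a by rewrite /S /= lexx ab subrr mulr0 subr0.
have ubS : ubound S b by move=> t [/andP[]].
have supS : has_sup S by split; [exists a|exists b].
set s := sup S; have sa : a <= s by apply: ub_le_sup => //; exists b.
have sb : s <= b by apply: ge_sup => //; exists a.
have [|d [d0 hd]] := loc s; first by rewrite sa sb.
have Ss : S s.
  have [t St ts] := sup_adherent d0 supS; rewrite -/s in ts.
  have tles : t <= s by apply: ub_le_sup => //; exists b.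
  split; first by rewrite sa sb.
  have [|_ /(_ tles)] := hd t.
    by rewrite distrC ger0_norm ?subr_ge0// ltrBlDr -ltrBlDl.
  case: St => _ h1 h2; apply: le_trans h2.
  have -> : phi a - e * (s - a) = (phi a - e * (t - a)) - e * (s - t) by ring.
  by rewrite lerD2r.
have [sb'|bs] := ltP s b; last first.
  by case: Ss => _; have <- : s = b by apply: le_anti; rewrite bs sb.
case: Ss => _ hs; pose y := Num.min (s + d / 2) b.
have sy : s < y by rewrite lt_min sb' ltrDl divr_gt0.
have d2 : d / 2 < d by rewrite ltr_pdivrMr// ltr_pMr// ltr1n.
have [|/(_ (ltW sy)) h _] := hd y.
  rewrite ger0_norm ?subr_ge0 ?(ltW sy)// ltrBlDl; apply: (@le_lt_trans _ _ (s + d / 2)).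
    by rewrite ge_min lexx.
  by rewrite ltrD2l.
have Sy : S y.
  split; first by rewrite (le_trans sa (ltW sy)) ge_min lexx orbT.
  apply: le_trans h.
  have -> : phi a - e * (y - a) = (phi a - e * (s - a)) - e * (y - s) by ring.
  by rewrite lerD2r.
have : y <= s by apply: ub_le_sup => //; exists b.
by rewrite leNgt sy.
Qed.

(** * Functions continued to the negative axis *)

Section Regular.
Context (R : realType).
Local Notation C := R[i].
Implicit Types (P F : C -> C) (x a c l : C).

Definition upper_or_neg l : Prop := 0 < 'Im l \/ l < 0.

(** Both conditions survive linear combinations and divided differences. The decay like [1 / |x|]
    makes the limit at [-oo] equal to [0]. *)
Definition regular P := (forall x, x < 0 -> exists D, derive_in upper_or_neg P x D) /\
  exists c, forall x, x <= -1 -> `|x| * `|P x| <= c.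

Lemma regular_linear a P F : regular P -> regular F -> regular (fun l => a * P l + F l).
Proof.
move=> [dP [c hc]] [dF [c' hc']]; split=> [x x0|].
  have [D hD] := dP _ x0; have [E hE] := dF _ x0.
  by exists (a * D + E); exact: derive_in_linear.
exists (`|a| * c + c') => x x1; apply: (@le_trans _ _ (`|x| * (`|a| * `|P x| + `|F x|))).
  by rewrite ler_wpM2l// -normrM ler_normD.
rewrite mulrDr; apply: lerD; last exact: hc'.
by rewrite mulrCA ler_wpM2l// hc.
Qed.

Lemma norm_Im_le l : `|'Im l| <= `|l|.
Proof.
rewrite ImE !normrM normCi mul1r normfV normr_nat ler_pdivrMr ?ltr0n//.
by apply: (le_trans (ler_normB _ _)); rewrite norm_conjC mulr_natr mulr2n.
Qed.

(** The value [w] at [a] is free: [a] is not real, so a neighbourhood of any negative point avoids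
    it. *)
Lemma regular_div a c w P : 'Im a != 0 -> regular P ->
  regular (fun l => if l == a then w else (P l - c) / (l - a)).
Proof.
move=> a0 [dP [b hb]].
have xa x : x < 0 -> x != a.
  by move=> x0; apply: contraNneq a0 => <-; rewrite (Creal_ImP _ (ltr0_real x0)).
split=> [x x0|].
  have [D hD] := dP _ x0; have := xa _ x0 => xa0.
  have h1 := derive_in_linear 1 hD (derive_in_cst upper_or_neg (- c) x).
  have h2 := derive_inM h1 (derive_in_inv upper_or_neg xa0).
  have r0 : 0 < `|x - a| by rewrite normr_gt0 subr_eq0.
  eexists; apply: (eq_derive_in r0 _ _ h2) => [|l _ lx].
    by rewrite (negbTE xa0) mul1r.
  case: eqP => [la|_]; last by rewrite mul1r.
  by move: lx; rewrite la distrC ltxx.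
exists ((1 + `|a| / `|'Im a|) * (b + `|c|)) => x x1.
have x0 : x < 0 by apply: le_lt_trans x1 _; rewrite oppr_lt0 ltr01.
rewrite (negbTE (xa _ x0)).
have n0 : 0 < `|'Im a| by rewrite normr_gt0.
have ax : `|'Im a| <= `|x - a|.
  have -> : `|'Im a| = `|'Im (x - a)|.
    by rewrite raddfB/= (Creal_ImP _ (ltr0_real x0)) sub0r normrN.
  exact: norm_Im_le.
have nxa : 0 < `|x - a| by apply: lt_le_trans ax.
have xx : `|x| <= (1 + `|a| / `|'Im a|) * `|x - a|.
  have -> : `|x| = `|x - a + a| by rewrite subrK.
  apply: (le_trans (ler_normD _ _)); rewrite mulrDl mul1r lerD2l mulrAC ler_pdivlMr//.
  by rewrite ler_wpM2l.
have pc : `|P x - c| <= b + `|c|.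
  apply: (le_trans (ler_normB _ _)); rewrite lerD2r; apply: le_trans (hb _ x1).
  rewrite -[leLHS]mul1r ler_wpM2r// ler0_norm ?(ltW x0)//.
  by rewrite lerNr.
by rewrite normrM normfV mulrA ler_pdivrMr// [leRHS]mulrAC; apply: ler_pM.
Qed.

End Regular.

Arguments upper_or_neg {R} l.

Section RegularPositive.
Context (R : realType).
Local Notation C := R[i].
Local Notation Re := (@complex.Re R).
Local Notation Im := (@complex.Im R).
Implicit Types (P F : C -> C) (x l : C).

Lemma regular_cont P x : regular P -> x < 0 -> exists c, 0 < c /\ exists d, 0 < d /\
  forall l, upper_or_neg l -> `|l - x| < d -> `|P l - P x| <= c * `|l - x|.
Proof.
move=> [dP _] x0; have [D /derive_in_lip[d [d0 hd]]] := dP _ x0.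
exists (`|D| + 1); split; first by rewrite ltr_wpDl.
by exists d.
Qed.

Lemma upper_or_neg_real (t : R) : t < 0 -> upper_or_neg (t%:C%C).
Proof. by move=> t0; right; rewrite -[0]/(0%:C%C) ltcR. Qed.

(** A vertical step ['i y] from the axis changes the imaginary part of [P] by about [y Re D]; this
    part starts at [0] and may not become negative. *)
Lemma regular_Re_derive P x D (e : R) : (forall l, 0 < 'Im l -> 0 <= 'Im (P l)) ->
  P x \is Num.real -> x < 0 -> derive_in upper_or_neg P x D -> 0 < e -> - e <= Re D.
Proof.
move=> Pu Px x0 hD e0; have eC : 0 < e%:C%C :> C by rewrite ltcR.
have [d [/complex_gt0E[dE d0] hd]] := hD _ eC.
pose y := Re d / 2; have y0 : 0 < y by rewrite divr_gt0.
pose l : C := x + 'i%C * y%:C%C.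
have lx : l - x = 'i%C * y%:C%C by rewrite /l addrAC subrr add0r.
have nlx : `|l - x| = y%:C%C.
  by rewrite lx normrM norm_iC mul1r norm_real_complex gtr0_norm.
have lu : 0 < 'Im l.
  rewrite -complexIm -[0]/(0%:C%C) ltcR /l.
  have -> : Im (x + 'i%C * y%:C%C) = Im x + Im ('i%C * y%:C%C) by exact: raddfD.
  have -> : Im x = 0 by apply: (@complexI R); exact: RIm_real (ltr0_real x0).
  by rewrite /= !mul0r mul1r !add0r.
have yd : y%:C%C < d by rewrite dE ltcR ltr_pdivrMr// ltr_pMr// ltr1n.
have := hd l (or_introl lu); rewrite nlx => /(_ yd) h.
have := le_trans (normc_ge_Im _) h; rewrite -rmorphM/= lecR ler_norml => /andP[_ h1].
have PlC := Pu _ lu; rewrite -complexIm -[0]/(0%:C%C) lecR in PlC.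
have {}Px : Im (P x) = 0 by apply: (@complexI R); exact: RIm_real.
have ImE : Im (P l - P x - D * (l - x)) = Im (P l) - y * Re D.
  rewrite lx; move: Px; case: (P l) (P x) D {h h1 hD hd} => [a b] [a' b'] [p q] /= ->.
  by ring.
rewrite ImE in h1; rewrite -(ler_pM2l y0); lra.
Qed.

Lemma regular_ge0 P : regular P -> (forall l, 0 < 'Im l -> 0 <= 'Im (P l)) ->
  (forall x, x < 0 -> P x \is Num.real) -> forall x, x < 0 -> 0 <= P x.
Proof.
move=> [dP [c hc]] Pu Pr.
pose phi (t : R) := Re (P t%:C%C).
have tC (t : R) : t < 0 -> t%:C%C < 0 :> C by move=> t0; rewrite -[0]/(0%:C%C) ltcR.
have mono (a b : R) : a <= b -> b < 0 -> phi a <= phi b.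
  move=> ab b0; apply/ler_addgt0Pr => e e0.
  have k0 : 0 < e / (b - a + 1) by rewrite divr_gt0// ltr_wpDl ?subr_ge0.
  have := @ndecr_local R phi a b (e / (b - a + 1)) ab.
  rewrite lerBlDr => h; apply: (le_trans (h _)); last first.
    rewrite lerD2l mulrAC ler_pdivrMr ?ltr_wpDl ?subr_ge0//.
    by rewrite ler_pM2l// lerDl.
  move: {h} (e / _) k0 => k k0 x /andP[ax xb]; have x0 := le_lt_trans xb b0.
  have [D hD] := dP _ (tC _ x0).
  have k2 : 0 < k / 2 by rewrite divr_gt0.
  have k2C : 0 < (k / 2)%:C%C :> C by rewrite ltcR.
  have rD := regular_Re_derive Pu (Pr _ (tC _ x0)) (tC _ x0) hD k2.
  have [d [/complex_gt0E[dE d0] hd]] := hD _ k2C.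
  exists (Num.min (Re d) (- x)); split; first by rewrite lt_min d0 oppr_gt0.
  move=> y; rewrite lt_min => /andP[yd yx].
  have y0 : y < 0.
    by have := le_lt_trans (ler_norm _) yx; rewrite ltrBlDr addNr.
  have := hd _ (upper_or_neg_real y0); rewrite -rmorphB norm_real_complex dE ltcR.
  move=> /(_ yd) h.
  have := le_trans (normc_ge_Re _) h; rewrite -rmorphM/= lecR.
  have -> : Re (P y%:C%C - P x%:C%C - D * (y - x)%:C%C) = phi y - phi x - Re D * (y - x).
    rewrite /phi; case: (P y%:C%C) (P x%:C%C) D {hD hd h rD} => [? ?] [? ?] [? ?] /=.
    by ring.
  rewrite ler_norml => /andP[h1 h2]; move: (Re D) rD h1 h2 => q rD h1 h2; split => xy.
    have n0 : 0 <= y - x by rewrite subr_ge0.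
    by move: h1; rewrite ger0_norm//; nra.
  have n0 : y - x <= 0 by rewrite subr_le0.
  by move: h2; rewrite ler0_norm//; nra.
move=> x x0; have xr := ltr0_real x0; have xE := RRe_real xr; rewrite -xE in x0 *.
have {}x0 : Re x < 0 by move: x0; rewrite -[0]/(0%:C%C) ltcR.
rewrite -(RRe_real (Pr _ (tC _ x0))) -[0]/(0%:C%C) lecR -/(phi _).
rewrite leNgt; apply/negP => phi0.
have c0 : 0 <= c.
  by apply: le_trans (hc (-1) (lexx _)); rewrite mulr_ge0.
(* If [phi] were negative at [x], monotonicity would keep it at least as negative to the left, and
   at this distance [|a| |phi a|] would exceed the decay constant [c]. *)
pose q := Re c / - phi (Re x).
have q0 : 0 <= q.
  rewrite divr_ge0 ?oppr_ge0 ?(ltW phi0)//.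
  by have := ger0_real c0 => /RRe_real cE; move: c0; rewrite -cE -[0]/(0%:C%C) lecR.
pose a := Re x - 1 - q.
have ax : a <= Re x by rewrite /a; lra.
have a0 : a < 0 by rewrite (le_lt_trans ax).
have pa := mono _ _ ax x0.
have : (- a * - phi (Re x))%:C%C <= c.
  apply: le_trans (hc a%:C%C _); last first.
    have -> : -1 = (-1)%:C%C :> C by rewrite rmorphN1.
    by rewrite lecR /a; lra.
  rewrite norm_real_complex (ltr0_norm a0) rmorphM ler_wpM2l//.
    by rewrite -[0]/(0%:C%C) lecR oppr_ge0 ltW.
  apply: le_trans (normc_ge_Re _); rewrite lecR -/(phi a).
  by rewrite ler0_norm ?lerN2// (le_trans pa) ?ltW.
have cE := RRe_real (ger0_real c0).
rewrite -cE lecR -ler_pdivlMr ?oppr_gt0// -/q /a.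
by clearbody q; move: x0; clear; move: (Re x) => y y0 h; lra.
Qed.

End RegularPositive.

(** * Boundary values of the resolvent and positivity *)

Section Boundary.
Context (R : realType) (H : hilbertType R) (A : set (H * H)).
Local Notation C := R[i].
Hypotheses (lA : linear_relation A) (sA : selfadjoint A).
Hypothesis surjA : forall l : C, 'Im l != 0 -> forall g, exists u, A (u, g + l *: u).
Implicit Types (u w g h k : H) (l m x : C).
Local Notation r := (sa_resolvent surjA).

Definition boundary h g (P : C -> C) :=
  regular P /\ forall l, 0 < 'Im l -> P l = inner (r l h) g.

(** The adjoint of the resolvent at [l] lives at [l^*], outside the upper half-plane, so conjugation
    symmetry cannot be read off there. One function for each order of the arguments is carried
    along; for [h = g] their conjugacy makes the boundary values real. *)
Definition has_boundary h g := exists P P', [/\ boundary h g P, boundary g h P' &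
  forall x, x < 0 -> P x = (P' x)^*].

Lemma has_boundary_sym h g : has_boundary h g -> has_boundary g h.
Proof.
move=> [P [P' [b b' e]]]; exists P', P; split => // x x0.
by rewrite (e x x0) conjCK.
Qed.

Lemma has_boundary_linear a h h' g : has_boundary h g -> has_boundary h' g ->
  has_boundary (a *: h + h') g.
Proof.
move=> [P [P' [[rP bP] [rP' bP'] e]]] [F [F' [[rF bF] [rF' bF'] e']]].
exists (fun l => a * P l + F l), (fun l => a^* * P' l + F' l); split.
- split=> [|l l0]; first exact: regular_linear.
  by rewrite bP// bF// sa_resolvent_linear ?gt_eqF// innerDl innerZl.
- split=> [|l l0]; first exact: regular_linear.
  by rewrite bP'// bF'// innerDr innerZr.
by move=> x x0; rewrite e// e'// rmorphD rmorphM/= conjCK.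
Qed.

(** By the resolvent identity the new boundary functions are divided differences of the old ones, at
    [a] and at [a^*]. Whichever of the two points lies in the upper half-plane needs its own
    value. *)
Lemma has_boundary_resolvent a h g : 'Im a != 0 -> has_boundary h g ->
  has_boundary (r a h) g.
Proof.
move=> a0 [P [P' [[rP bP] [rP' bP'] e]]].
have ac : 'Im (a^*) != 0 by rewrite Im_conj oppr_eq0.
exists (fun l => if l == a then inner (r a (r a h)) g else (P l - inner (r a h) g) / (l - a)).
exists (fun l => if l == a^* then inner (r a^* (r a^* g)) h
                 else (P' l - inner (r a^* g) h) / (l - a^*)); split.
- split=> [|l l0]; first exact: regular_div.
  case: eqP => [->//|/eqP la]; rewrite bP//; have l1 : 'Im l != 0 by rewrite gt_eqF.
  have {}la : l - a != 0 by rewrite subr_eq0.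
  by rewrite -innerBl (sa_resolvent_identity lA sA surjA h a0 l1) innerZl mulrC mulKf.
- split=> [|l l0]; first exact: regular_div.
  have l1 : 'Im l != 0 by rewrite gt_eqF.
  rewrite -[in RHS](conjCK a) -(sa_resolvent_adjoint sA surjA _ _ ac).
  case: eqP => [->//|/eqP la]; rewrite bP'//.
  have {}la : a^* - l != 0 by rewrite subr_eq0 eq_sym.
  rewrite -innerBl -[r l g - _]opprB (sa_resolvent_identity lA sA surjA g l1 ac).
  by rewrite innerNl innerZl -[l - _]opprB invrN mulrNN mulrC mulKf.
move=> x x0; have xr : x^* = x by apply: CrealP; exact: ltr0_real.
have na b : 'Im b != 0 -> (x == b) = false.
  by move=> b0; apply: contraNF b0 => /eqP <-; rewrite (Creal_ImP _ (ltr0_real x0)).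
rewrite !na// e// rmorphM fmorphV !rmorphB/= conjCK xr; congr ((_ - _) / _).
by rewrite (sa_resolvent_adjoint sA surjA g h ac) conjCK -innerC.
Qed.

Lemma upper_near x (d : C) : x < 0 -> 0 < d ->
  exists l, [/\ 0 < 'Im l, `|l - x| < d & `|l - x| <= d].
Proof.
move=> x0 d0; exists (x + 'i * (d / 2)).
have d2 : d / 2 \is Num.real by rewrite gtr0_real// divr_gt0.
rewrite Im_rect ?(ltr0_real x0)// divr_gt0//.
have -> : x + 'i * (d / 2) - x = 'i * (d / 2) by rewrite addrAC subrr add0r.
rewrite normrM normCi mul1r gtr0_norm ?divr_gt0//.
have dd : d / 2 < d by rewrite ltr_pdivrMr// ltr_pMr// ltr1n.
by split=> //; exact: ltW.
Qed.

(* If [A u = k + x u] then [R l k = u + (l - x) R l u], so letting [l] tend to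
   [x] identifies the boundary value of [(R l k, k)]. *)
Lemma boundary_value u k P F x : x < 0 -> A (u, k + x *: u) ->
  boundary k k P -> boundary u k F -> P x = inner u k.
Proof.
move=> x0 Au [rP bP] [rF bF].
have [c [c0 [d [d0 hd]]]] := regular_cont rP x0.
have [c' [c'0 [d' [d'0 hd']]]] := regular_cont rF x0.
have [d1 [d10 l1 l2]] := common_radius d0 d'0.
have [d2 [d20 l3 l4]] := common_radius d10 ltr01.
apply/eqP; rewrite -subr_eq0; apply/eqP.
apply: (@small_eq0 R (R[i]^o) _ (c + (`|F x| + c'))) => e e0.
have [d3 [d30 l5 l6]] := common_radius d20 e0.
have [l [lu lx _]] := upper_near x0 d30.
have ll := lt_le_trans lx l5; have le := ltW (lt_le_trans lx l6).
have {}hd := hd l (or_introl lu) (lt_le_trans ll (le_trans l3 l1)).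
have {}hd' := hd' l (or_introl lu) (lt_le_trans ll (le_trans l3 l2)).
have le1 := ltW (lt_le_trans ll l4).
have lne : 'Im l != 0 by rewrite gt_eqF.
have ru : u = r l k - (l - x) *: r l u.
  rewrite -sa_resolventZ// -sa_resolventB//; apply: sa_resolvent_uniq => //.
  move: Au; congr (A _); congr (_, _); apply: inner_eq => z.
  by rewrite !(innerDl, innerNl, innerZl); ring.
have -> : P x - inner u k = - (P l - P x) + (l - x) * F l.
  by rewrite [in LHS]ru innerBl innerZl -bP// -bF//; ring.
rewrite [leRHS]mulrDl; apply: (le_trans (ler_normD _ _)); rewrite normrN normrM; apply: lerD.
  by apply: (le_trans hd); rewrite ler_wpM2l// ltW.
rewrite mulrC; apply: ler_pM => //.
rewrite -(subrK (F x) (F l)) addrC; apply: (le_trans (ler_normD _ _)); rewrite lerD2l.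
by apply: (le_trans hd'); rewrite -[leRHS]mulr1 ler_wpM2l// ltW.
Qed.

Lemma boundary_uniq h g P F x : x < 0 -> boundary h g P -> boundary h g F -> P x = F x.
Proof.
move=> x0 [rP bP] [rF bF].
have [c [c0 [d [d0 hd]]]] := regular_cont rP x0.
have [c' [c'0 [d' [d'0 hd']]]] := regular_cont rF x0.
have [d1 [d10 l1 l2]] := common_radius d0 d'0.
apply/eqP; rewrite -subr_eq0; apply/eqP.
apply: (@small_eq0 R (R[i]^o) _ (c + c')) => e e0.
have [d3 [d30 l5 l6]] := common_radius d10 e0.
have [l [lu lx _]] := upper_near x0 d30.
have ll := lt_le_trans lx l5; have le := ltW (lt_le_trans lx l6).
have {}hd := hd l (or_introl lu) (lt_le_trans ll l1).
have {}hd' := hd' l (or_introl lu) (lt_le_trans ll l2).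
have -> : P x - F x = - (P l - P x) + (F l - F x) by rewrite (bP l)// (bF l)//; ring.
rewrite mulrDl; apply: (le_trans (ler_normD _ _)); rewrite normrN; apply: lerD.
  by apply: (le_trans hd); rewrite ler_wpM2l// ltW.
by apply: (le_trans hd'); rewrite ler_wpM2l// ltW.
Qed.

Lemma boundary_ge0 h P : has_boundary h h -> boundary h h P -> forall x, x < 0 -> 0 <= P x.
Proof.
move=> [F [F' [bF bF' e]]] bP; apply: regular_ge0; first by case: bP.
  move=> l l0; case: bP => _ ->//; have l1 : 'Im l != 0 by rewrite gt_eqF.
  have := selfadjoint_Im sA (sa_resolventP surjA h l1) => /= Ah.
  have hr : inner h (r l h) = - (l * `|r l h| ^+ 2) + inner (h + l *: r l h) (r l h).
    by rewrite innerDl innerZl inner_norm [inner h _ + _]addrC addKr.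
  rewrite innerC Im_conj hr raddfD/= Ah addr0 raddfN/= opprK mulrC.
  have n0 : 0 <= `|r l h| ^+ 2 by rewrite exprn_ge0.
  by rewrite ImMl ?ger0_real// mulr_ge0// ltW.
move=> x x0; apply/CrealP; rewrite {1}(boundary_uniq x0 bP bF') -(e x x0).
exact: boundary_uniq x0 bF bP.
Qed.

Lemma boundary_nonneg u w : A (u, w) ->
  has_boundary u u -> has_boundary w w -> has_boundary w u -> 0 <= inner w u.
Proof.
move=> Auw uu ww wu.
have uw := selfadjoint_sym sA Auw Auw; rewrite /= in uw.
have uw' : (inner w u)^* = inner w u by rewrite -innerC.
have key x : x < 0 -> x * `|u| ^+ 2 <= inner w u.
  move=> x0; pose k := (- x) *: u + w.
  have xr : x^* = x by apply: CrealP; exact: ltr0_real.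
  have uk : has_boundary u k.
    by apply: has_boundary_sym; apply: has_boundary_linear.
  have kk : has_boundary k k.
    by apply: has_boundary_linear => //; apply: has_boundary_sym; apply: has_boundary_linear => //;
      exact: has_boundary_sym.
  have [P [_ [bP _ _]]] := kk; have [F [_ [bF _ _]]] := uk.
  have Au : A (u, k + x *: u).
    move: Auw; congr (A (_, _)); rewrite /k addrAC.
    by apply: inner_eq => z; rewrite !(innerDl, innerNl, innerZl); ring.
  have := boundary_ge0 kk bP x0; rewrite (boundary_value x0 Au bP bF).
  rewrite /k innerDr innerZr rmorphN/= xr -uw inner_norm mulNr addrC.
  by rewrite subr_ge0.
have wr : inner w u \is Num.real by apply/CrealP.
rewrite real_leNgt ?real0//; apply/negP => w0.
have n0 : 0 <= `|u| ^+ 2 by rewrite exprn_ge0.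
have n1 : 0 < `|u| ^+ 2 + 1 by rewrite ltr_wpDl.
(* If [inner w u] is negative, this is a point of the negative axis so close to [0] that
   [x * |u|^2 > inner w u]. *)
have := key (inner w u / (`|u| ^+ 2 + 1)).
rewrite pmulr_llt0 ?invr_gt0// => /(_ w0).
rewrite mulrAC ler_pdivrMr// -subr_ge0.
have -> : inner w u * (`|u| ^+ 2 + 1) - inner w u * `|u| ^+ 2 = inner w u by ring.
by rewrite lt_geF.
Qed.

End Boundary.

Lemma ge0_limit (R : realType) (X c : R[i]) :
  (forall e, 0 < e -> e <= 1 -> exists Y, 0 <= Y /\ `|X - Y| <= c * e) -> 0 <= X.
Proof.
move=> h; suff -> : X = `|X| by [].
apply/eqP; rewrite -subr_eq0; apply/eqP.
apply: (@small_eq0 R (R[i]^o) _ (c + c)) => e e0.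
have [d [d0 de d1]] := common_radius e0 (ltr01 : 0 < 1 :> R[i]).
have [Y [Y0 XY]] := h d d0 d1.
have c0 : 0 <= c by rewrite -(pmulr_lge0 _ d0) (le_trans _ XY).
have XYe : `|X - Y| <= c * e by apply: (le_trans XY); rewrite ler_wpM2l.
have -> : X - `|X| = (X - Y) + (`|Y| - `|X|) by rewrite (ger0_norm Y0) subrKA.
rewrite mulrDl; apply: (le_trans (ler_normD _ _)); apply: lerD => //.
by rewrite distrC; apply: (le_trans (ler_dist_dist _ _)).
Qed.

Lemma hermitian_of_real (R : realType) (M : hilbertType R) (T : M -> M) f g : linear T ->
  (forall h, inner (T h) h \is Num.real) -> inner (T f) g = (inner (T g) f)^*.
Proof.
move=> lT Tr; have r h : (inner (T h) h)^* = inner (T h) h by apply/CrealP.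
have i0 : 'i != 0 :> R[i] by rewrite -normr_eq0 normCi oner_eq0.
have h1 := r (1 *: f + g); have h2 := r ('i *: f + g).
have := r f; have := r g; move: h1 h2.
rewrite !lT !(innerDl, innerDr, innerZl, innerZr) conjCi rmorph1.
move: (inner (T f) f) (inner (T g) g) (inner (T f) g) (inner (T g) f) => a b c d.
rewrite !(rmorphD, rmorphM)/= !(rmorphN, rmorph1)/= !conjCi !opprK => h1 h2 bb aa.
rewrite {}aa {}bb in h1 h2; move: (c^*) (d^*) h1 h2 => c' d' /eqP h1 /eqP h2.
rewrite -subr_eq0 in h1; rewrite -subr_eq0 in h2.
apply/eqP; rewrite -subr_eq0; apply/eqP; move/eqP: h1 => h1; move/eqP: h2 => h2.
(* The reality conditions for [f + g] and ['i f + g] are combined with the weights that eliminate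
   [d] and [c^*]. *)
transitivity (- 0 / 2 - 0 / (2 * 'i) : R[i]); last by rewrite oppr0 !mul0r subrr.
by rewrite -{1}h1 -h2; field.
Qed.

(** * Nonnegativity of the dilation and compression at negative points *)

Section NegativeAxis.
Context (R : realType) (M : hilbertType R) (N : R[i] -> set (M * M)).
Local Notation C := R[i].
Variable Q : C -> M -> M.
Hypothesis hQ : inverse_stieltjes_resolvent N Q.
Context (K : hilbertType R).
Local Notation H := (hsum M K).
Local Notation inl := (@hsum_inl R M K).
Context (A : set (H * H)).
Hypotheses (lA : linear_relation A) (sA : selfadjoint A).
Hypothesis surjA : forall l : C, 'Im l != 0 -> forall g : H, exists u, A (u, g + l *: u).
Hypothesis compA : forall (l : C) (f : M) (u : H),
  'Im l != 0 -> A (u, inl f + l *: u) -> u.1 = Q l f.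
Hypothesis totA : total (span_gen surjA).
Implicit Types (f g : M) (u w h k : H) (l m x : C).
Local Notation r := (sa_resolvent surjA).
Local Notation has_boundary := (has_boundary surjA).

Lemma regular_compression f g : regular (fun l => inner (Q l f) g).
Proof.
split=> [x x0|].
  have [D hD] := isr_derive hQ (or_intror x0) f.
  exists (inner D g) => e e0; have g1 : 0 < `|g| + 1 by rewrite ltr_wpDl.
  have [d [d0 hd]] := hD _ (divr_gt0 e0 g1); exists d; split => // l lu lx.
  have -> : inner (Q l f) g - inner (Q x f) g - inner D g * (l - x) =
      inner (Q l f - Q x f - (l - x) *: D) g by rewrite !innerBl innerZl; ring.
  apply: (le_trans (cauchy_schwarz _ _)).
  apply: (@le_trans _ _ (e / (`|g| + 1) * `|l - x| * (`|g| + 1))).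
    by apply: ler_pM => //; [exact: hd|rewrite lerDl].
  by rewrite mulrAC mulfVK// gt_eqF.
exists (`|f| * `|g|) => x x1.
have x0 : x < 0 by apply: le_lt_trans x1 _; rewrite oppr_lt0 ltr01.
apply: (@le_trans _ _ (`|x| * (`|Q x f| * `|g|))); first by rewrite ler_wpM2l// cauchy_schwarz.
by rewrite mulrA ler_wpM2r//; exact: (isr_bound hQ x0).
Qed.

Lemma has_boundary_inl f g : has_boundary (inl f) (inl g).
Proof.
have b a b' : boundary surjA (inl a) (inl b') (fun l => inner (Q l a) b').
  split=> [|l l0]; first exact: regular_compression.
  have l1 : 'Im l != 0 by rewrite gt_eqF.
  by rewrite inner_inl (compA l1 (sa_resolventP surjA (inl a) l1)).
exists (fun l => inner (Q l f) g), (fun l => inner (Q l g) f); split => // x x0.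
apply: hermitian_of_real; first exact: (isr_linear hQ (neg_off_axis x0)).
by move=> h; apply: ger0_real; exact: (isr_ge0 hQ x0).
Qed.

Lemma has_boundary_span s t :
  has_boundary (lcomb (span_gen surjA) s) (lcomb (span_gen surjA) t).
Proof.
have b0 h (g : H) : has_boundary h g -> has_boundary 0 g.
  move=> hg; have := has_boundary_linear lA sA (-1) hg hg; by rewrite scaleN1r addNr.
have bl h (g : H) s1 : has_boundary h g -> (forall y, has_boundary (span_gen surjA y) g) ->
    has_boundary (lcomb (span_gen surjA) s1) g.
  move=> hg hx; elim: s1 => [|[a x] s1 ih]; first by rewrite lcomb_nil; exact: b0 hg.
  by rewrite /lcomb big_cons; exact: (has_boundary_linear lA sA a (hx x) ih).
have bg f y : has_boundary (span_gen surjA y) (inl f).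
  case: y => [g|[l g]] /=; first exact: has_boundary_inl.
  case: ifP => l0; last exact: (b0 _ _ (has_boundary_inl f f)).
  by apply: (has_boundary_resolvent lA sA) => //; exact: has_boundary_inl.
have bb (x y : M + C * M) : has_boundary (span_gen surjA x) (span_gen surjA y).
  case: x => [g|[l g]] /=; first by apply: has_boundary_sym; exact: bg.
  have h1 : has_boundary (inl g) (span_gen surjA y) by apply: has_boundary_sym; exact: bg.
  case: ifP => l0; last exact: (b0 _ _ h1).
  by apply: (has_boundary_resolvent lA sA).
pose x0 : M + C * M := Datatypes.inl 0.
apply: (bl (span_gen surjA x0)) => [|x]; apply: has_boundary_sym;
  by apply: (bl (span_gen surjA x0)) => *; exact: bb.
Qed.

(** Approximating [p.2 - 'i p.1] by a combination [h] of generators, rather than [p] itself,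
    controls both components of the pair at once, since [(A - 'i)^-1] is a contraction. All boundary
    functions needed for [u = (A - 'i)^-1 h] exist. *)
Lemma dilation_nonnegative : nonnegative A.
Proof.
have i0 : 'Im ('i : C) != 0 by rewrite Im_i oner_eq0.
move=> p Ap; apply: (@ge0_limit _ _ (2 * `|p.1| + (`|p.2| + 2))) => e e0 e1.
have [s hs] := totA (p.2 - 'i *: p.1) e0; pose h := lcomb (span_gen surjA) s.
pose u := r 'i h; pose w := 'i *: u + h.
have hh : has_boundary h h by exact: has_boundary_span.
have uh : has_boundary u h by exact: (has_boundary_resolvent lA sA).
have hu := has_boundary_sym uh.
have uu : has_boundary u u by exact: (has_boundary_resolvent lA sA).
have wu : has_boundary w u by exact: (has_boundary_linear lA sA).
have wh : has_boundary w h by exact: (has_boundary_linear lA sA).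
have ww : has_boundary w w.
  by apply: (has_boundary_linear lA sA); apply: has_boundary_sym.
have Auw : A (u, w) by rewrite /w addrC; exact: sa_resolventP.
exists (inner w u); split; first exact: (boundary_nonneg lA sA Auw uu ww wu).
have pu : `|p.1 - u| <= e.
  apply: le_trans (ltW hs); rewrite -/h -[leLHS]mul1r.
  have := @selfadjoint_bound _ _ _ sA 'i (p.1 - u) (p.2 - 'i *: p.1 - h).
  rewrite Im_i normr1; apply; have := linear_relB lA Ap Auw.
  congr (A _); congr (_, _); rewrite /w; apply: inner_eq => z /=.
  by rewrite !(innerDl, innerNl, innerZl); ring.
have pw : `|p.2 - w| <= 2 * e.
  have -> : p.2 - w = (p.2 - 'i *: p.1 - h) + 'i *: (p.1 - u).
    by rewrite /w; apply: inner_eq => z; rewrite !(innerDl, innerNl, innerZl); ring.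
  apply: (le_trans (ler_normD _ _)); rewrite normrZ normCi mul1r mulr_natl mulr2n.
  by apply: lerD => //; exact: ltW.
have -> : inner p.2 p.1 - inner w u = inner (p.2 - w) p.1 + inner w (p.1 - u).
  by rewrite innerBl innerBr; ring.
rewrite mulrDl; apply: (le_trans (ler_normD _ _)); apply: lerD.
  by apply: (le_trans (cauchy_schwarz _ _)); rewrite mulrAC ler_wpM2r.
apply: (le_trans (cauchy_schwarz _ _)); apply: ler_pM => //.
have -> : w = p.2 - (p.2 - w) by rewrite opprB addrC subrK.
apply: (le_trans (ler_normB _ _)); rewrite lerD2l; apply: (le_trans pw).
by rewrite -[leRHS]mulr1 ler_wpM2l.
Qed.

Lemma dilation_bound l u w : l + l^* <= 0 -> A (u, w) -> `|l| * `|u| <= `|w - l *: u|.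
Proof.
move=> l0 Auw; have n : nonpositive (rel_opp A).
  move=> _ [_ [p Ap <-] <-] /=; rewrite opprK; exact: dilation_nonnegative.
have Aw : rel_opp A (u, - w) by exists (u, w).
have := nonpositive_bound n l0 Aw.
by have -> : - w + l *: u = - (w - l *: u); [rewrite opprB addrC|rewrite normrN].
Qed.

Let near_neg x t : x < 0 -> t \is Num.real -> (x + 'i * t) + (x + 'i * t)^* <= 0.
Proof.
move=> x0 tr; have xr : x^* = x by apply: CrealP; exact: ltr0_real.
have tr' : t^* = t by apply: CrealP.
rewrite rmorphD rmorphM/= conjCi xr tr'.
have -> : x + 'i * t + (x + - 'i * t) = x + x by ring.
by rewrite -[leRHS]addr0; apply: lerD; exact: ltW.
Qed.

Lemma dilation_surjective x h : x < 0 -> exists u, A (u, h + x *: u).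
Proof.
(* With this [t] the distance from [l] to [x] is [t], while [|l| >= |x| - t = 3 t], so the step from
   [l] to [x] is shorter than the bound allows. *)
move=> x0; pose t := - x / 4; have t0 : 0 < t by rewrite divr_gt0// oppr_gt0.
pose l := x + 'i * t.
have lx : l - x = 'i * t by rewrite /l addrAC subrr add0r.
have nlx : `|l - x| = t by rewrite lx normrM normCi mul1r gtr0_norm.
have nl : 3 * t <= `|l|.
  have -> : 3 * t = `|x| - `|x - l|.
    by rewrite distrC nlx ltr0_norm// /t; field.
  by apply: (le_trans (lerB_dist _ _)); rewrite opprB addrC subrK.
have l0 : 0 < `|l| by apply: lt_le_trans nl; rewrite mulr_gt0.
have lim : 'Im l != 0.
  by rewrite /l Im_rect ?(ltr0_real x0) ?gtr0_real// gt_eqF.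
have [||||u hu] := @shift_surjective _ _ A (- l) (- x) `|l|^-1 lA _ _ _ _ h.
- by move=> g; have [u Au] := surjA lim g; exists u; rewrite scaleNr opprK.
- move=> u w Auw; rewrite mulrC ler_pdivlMr// mulrC scaleNr.
  by apply: dilation_bound => //; apply: near_neg => //; exact: gtr0_real.
- by rewrite invr_ge0.
- have -> : - l - - x = - (l - x) by rewrite opprB opprK addrC.
  rewrite normrN nlx ltr_pdivrMr// mul1r; apply: lt_le_trans nl.
  by rewrite -[ltLHS]mul1r ltr_pM2r// ltr1n.
by exists u; move: hu; rewrite scaleNr opprK.
Qed.

(** Both sides are limits along [l = x + 'i t]: the right one by continuity of [Q], the left one
    because [(A - l)^-1 f - u] has norm at most [t |u| / |l|] once [A >= 0]. *)
Lemma dilation_compression_neg x f u : x < 0 -> A (u, inl f + x *: u) -> u.1 = Q x f.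
Proof.
move=> x0 Au; apply: inner_eq => g.
have [c [c0 [d [d0 hd]]]] := regular_cont (regular_compression f g) x0.
have x2 : 0 < `|x| / 2 by rewrite divr_gt0// normr_gt0 lt_eqF.
have [d1 [d10 l1 l2]] := common_radius d0 x2.
apply/eqP; rewrite -subr_eq0; apply/eqP.
apply: (@small_eq0 R (R[i]^o) _ (c + `|u| * `|inl g : H| / (`|x| / 2))) => e e0.
have [d2 [d20 l3 l4]] := common_radius d10 e0.
pose t := d2 / 2; have t0 : 0 < t by rewrite divr_gt0.
have td : t < d2 by rewrite ltr_pdivrMr// ltr_pMr// ltr1n.
pose l := x + 'i * t.
have lx : l - x = 'i * t by rewrite /l addrAC subrr add0r.
have nlx : `|l - x| = t by rewrite lx normrM normCi mul1r gtr0_norm.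
have lim : 0 < 'Im l by rewrite /l Im_rect ?(ltr0_real x0) ?gtr0_real.
have lne : 'Im l != 0 by rewrite gt_eqF.
have {}hd := hd l (or_introl lim); rewrite nlx in hd.
have {}hd := hd (lt_le_trans td (le_trans l3 l1)).
pose q := r l (inl f) - u.
have nl : `|x| / 2 <= `|l|.
  have -> : `|x| / 2 = `|x| - `|x| / 2 by field.
  apply: (@le_trans _ _ (`|x| - `|x - l|)).
    by rewrite lerD2l lerN2 distrC nlx (le_trans (ltW td))// (le_trans l3).
  by apply: (le_trans (lerB_dist _ _)); rewrite opprB addrC subrK.
have Aq : A (q, (l - x) *: u + l *: q).
  have := linear_relB lA (sa_resolventP surjA (inl f) lne) Au.
  congr (A _); congr (_, _); rewrite /q; apply: inner_eq => z /=.
  by rewrite !(innerDl, innerNl, innerZl); ring.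
have nq : `|q| <= t * `|u| / (`|x| / 2).
  rewrite ler_pdivlMr//; apply: (@le_trans _ _ (`|q| * `|l|)); first by rewrite ler_wpM2l.
  have := dilation_bound (near_neg x0 (gtr0_real t0)) Aq.
  by rewrite -/l addrK normrZ nlx mulrC.
have te := ltW (lt_le_trans td l4).
have -> : inner u.1 g - inner (Q x f) g =
    (inner (Q l f) g - inner (Q x f) g) - inner q (inl g).
  by rewrite /q innerBl !inner_inl (compA lne (sa_resolventP surjA (inl f) lne)); ring.
rewrite mulrDl; apply: (le_trans (ler_normB _ _)); apply: lerD.
  by apply: (le_trans hd); rewrite ler_wpM2l// ltW.
apply: (le_trans (cauchy_schwarz _ _)).
apply: (@le_trans _ _ (t * `|u| / (`|x| / 2) * `|inl g : H|)); first by rewrite ler_wpM2r.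
have -> : t * `|u| / (`|x| / 2) * `|inl g : H| = `|u| * `|inl g : H| / (`|x| / 2) * t by ring.
by rewrite ler_wpM2l// mulr_ge0 ?mulr_ge0// ltW// invr_gt0.
Qed.

Lemma dilation_compressed l : ~~ (0 <= l) -> compressed_resolvent A l = graph (Q l).
Proof.
move=> l0.
have uq f u : A (u, inl f + l *: u) -> u.1 = Q l f.
  by case: (off_axis_cases l0) => h; [apply: compA; rewrite gt_eqF|
    apply: compA; rewrite lt_eqF|exact: dilation_compression_neg].
have ex f : exists u, A (u, inl f + l *: u).
  by case: (off_axis_cases l0) => h; [apply: surjA; rewrite gt_eqF|
    apply: surjA; rewrite lt_eqF|exact: dilation_surjective].
apply/seteqP; split=> -[f g] /=.
  by move=> [k /inv_shiftP]; rewrite scaleNr opprK => /uq.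
rewrite /graph/= => ->; have [[u k] Au] := ex f; exists k; apply/inv_shiftP.
by rewrite scaleNr opprK /= -(uq _ _ Au).
Qed.

End NegativeAxis.

Theorem theorem3p6 (R : realType) (M : hilbertType R)
    (N : R[i] -> set (M * M)) (hN : inverse_stieltjes_family N) :
  (exists (K : hilbertType R) (A : set (hsum M K * hsum M K)),
     is_minimal_model N A) /\
  (forall (K1 K2 : hilbertType R) (A1 : set (hsum M K1 * hsum M K1))
     (A2 : set (hsum M K2 * hsum M K2)),
     is_minimal_model N A1 -> is_minimal_model N A2 ->
     unitarily_equivalent A1 A2).
Proof.
have [Q hQ] := inverse_stieltjes_resolvent_exists hN.
split=> [|K1 K2 A1 A2 mA1 mA2]; last exact: (model_equivalence hQ mA1 mA2).
have [K [v [vG tv v0]]] := cayley_model_exists hQ.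
pose sh n (a : int * M) : int * M := (a.1 + n, a.2).
(* The kernel depends on the difference of the indices only; since the shifted family runs through
   the same vectors, it is again total, and the shift extends to a unitary. *)
have vsh a b : inner (v a) (v b) = inner (v (sh 1 a)) (v (sh 1 b)).
  by rewrite !vG /sh /= opprD addrACA subrr addr0.
have tsh : total (v \o sh 1).
  move=> h e e0; have [s hs] := tv h e e0.
  exists [seq (p.1, sh (- 1) p.2) | p <- s].
  suff -> : lcomb (v \o sh 1) [seq (p.1, sh (- 1) p.2) | p <- s] = lcomb v s by [].
  rewrite /lcomb big_map; apply: eq_bigr => -[a [n f]] _ /=.
  by rewrite /sh /= subrK.
have [U [isoU sU Uv]] := gram_unitary vsh tv tsh.
have iU x y : inner (U x) (U y) = inner x y := isoU x y.
have {}Uv n f : U (v (n, f)) = v (n + 1, f) := Uv (n, f).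
have lA := cayley_relation_linear U.
have sA := cayley_relation_selfadjoint iU sU.
have surjA (l : R[i]) : 'Im l != 0 -> forall g, exists u, cayley_relation U (u, g + l *: u).
  exact: cayley_relation_surjective.
have compA (l : R[i]) f u : 'Im l != 0 ->
    cayley_relation U (u, hsum_inl K f + l *: u) -> u.1 = Q l f.
  exact: (cayley_compression hQ vG v0 iU sU Uv surjA).
have totA : total (span_gen surjA) by exact: (cayley_total tv v0 iU sU Uv surjA).
exists K, (cayley_relation U); split=> //.
- exact: (dilation_nonnegative hQ lA sA compA totA).
- exact: (minimal_total lA totA).
move=> l l0; rewrite (model_graph hQ l0).
exact: (dilation_compressed hQ lA sA compA totA).
Qed.
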